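(* (i) Let $\Delta\subset\mathbb{R}^2$ be any triangle with centroid at the origin and let $T=\mathrm{conv}(J\Delta\cup(-J\Delta+t))$ with $t\in -J(\partial\Delta)$. Then $\mathrm{int}(\Delta)\times\mathrm{int}(T)$ is symplectomorphic to an open Euclidean ball in $\mathbb{R}^4$. (ii) Let $\square\subset\mathbb{R}^2$ be any square with sides parallel to the coordinate axes. Then for all $a_1,a_2\in[0,1]$, $\mathrm{int}(\square)\times\mathrm{int}(\diamondsuit(a_1,a_2))$ is symplectomorphic to an open Euclidean ball in $\mathbb{R}^4$. (iii) Let $Q\subset\mathbb{R}^2$ be a trapezoid which is neither a triangle nor a parallelogram, written $Q=M(\diamondsuit(a_1,a_2))+c$ with $M\in GL_2(\mathbb{R})$, $c\in\mathbb{R}^2$, $a_1,a_2\in[0,1]$, and let $P=(M^T)^{-1}([0,1]^2)$. Then $\mathrm{int}(Q)\times\mathrm{int}(P)$ is symplectomorphic to an open Euclidean ball in $\mathbb{R}^4$.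
   Context: $\mathbb{R}^4=\mathbb{R}^2(x)\times\mathbb{R}^2(y)$ carries the standard symplectic form $\omega=dx_1\wedge dy_1+dx_2\wedge dy_2$; a symplectomorphism between open sets is a diffeomorphism pulling back $\omega$ to $\omega$. On $\mathbb{R}^2$, $J$ denotes the linear map $J(a,b)=(b,-a)$. For $a_1,a_2\in[0,1]$, $\diamondsuit(a_1,a_2)=\mathrm{conv}(([0,1]\times\{a_2\})\cup(\{a_1\}\times[0,1]))$. A trapezoid is a convex quadrilateral with at least one pair of parallel sides (triangles counted as degenerate trapezoids). *)

(* Defs.v *)
From HB Require Import structures.
From mathcomp Require Import all_boot all_order all_algebra.
From mathcomp Require Import all_classical all_reals all_analysis.
Set Implicit Arguments. Unset Strict Implicit. Unset Printing Implicit Defensive.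
Import Order.TTheory GRing.Theory Num.Theory.
Import numFieldNormedType.Exports.
Local Open Scope classical_set_scope.
Local Open Scope ring_scope.

Section Defs.
Variable R : realType.

(* Points of the plane R^2 are row vectors 'rV[R]_2 (coordinates p 0 0, p 0 1).
   Points of R^4 = R^2(x) x R^2(y) are 'rV[R]_(2+2): x = lsubmx z, y = rsubmx z. *)
Notation R2 := 'rV[R]_2.
Notation R4 := 'rV[R]_(2 + 2).

Definition pt (a b : R) : R2 := \row_(i < 2) (if i == 0 :> nat then a else b).

Definition Jmap (p : R2) : R2 := pt (p 0 1) (- p 0 0).

Definition cross2 (u v : R2) : R := u 0 0 * v 0 1 - u 0 1 * v 0 0.

Definition chull (n : nat) (S : set 'rV[R]_n) : set 'rV[R]_n :=
  [set x | exists (k : nat) (w : 'I_k -> R) (p : 'I_k -> 'rV[R]_n),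
      (forall i, 0 <= w i) /\ \sum_(i < k) w i = 1 /\ (forall i, S (p i)) /\
      x = \sum_(i < k) w i *: p i].

Definition bdry (n : nat) (A : set 'rV[R]_n) : set 'rV[R]_n :=
  closure A `\` interior A.

Definition is_triangle (A : set R2) : Prop :=
  exists a b c : R2, cross2 (b - a) (c - a) != 0 /\ A = chull [set a; b; c].

Definition is_parallelogram (A : set R2) : Prop :=
  exists p v w : R2, cross2 v w != 0 /\
    A = [set z | exists s t : R, 0 <= s <= 1 /\ 0 <= t <= 1 /\
                  z = p + s *: v + t *: w].

(* trapezoid: convex hull of two segments [p1,p2], [p3,p4] that are parallel
   (degenerate segments allowed, so triangles count), with nonempty interior. *)
Definition is_trapezoid (A : set R2) : Prop :=
  exists p1 p2 p3 p4 : R2, A = chull [set p1; p2; p3; p4] /\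
    cross2 (p2 - p1) (p4 - p3) = 0 /\ interior A !=set0.

Definition diamond (a1 a2 : R) : set R2 :=
  chull ([set pt s a2 | s in [set s : R | 0 <= s <= 1]] `|`
        [set pt a1 s | s in [set s : R | 0 <= s <= 1]]).

Definition unit_square : set R2 :=
  [set p | 0 <= p 0 0 <= 1 /\ 0 <= p 0 1 <= 1].

Definition lin (M : 'M[R]_2) (p : R2) : R2 := (M *m p^T)^T.

Definition prod4 (A B : set R2) : set R4 :=
  [set z | A (lsubmx z) /\ B (rsubmx z)].

Definition eball4 (c : R4) (r : R) : set R4 :=
  [set z | \sum_(i < 2 + 2) (z 0 i - c 0 i) ^+ 2 < r ^+ 2].

Definition omega (u v : R4) : R :=
  \sum_(i < 2) (lsubmx u 0 i * rsubmx v 0 i - rsubmx u 0 i * lsubmx v 0 i).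

Fixpoint iter_deriv (vs : seq R4) (f : R4 -> R4) : R4 -> R4 :=
  match vs with
  | [::] => f
  | v :: vs' => fun x => 'D_v (iter_deriv vs' f) x
  end.

Definition smooth_on (U : set R4) (f : R4 -> R4) : Prop :=
  forall (vs : seq R4) (x : R4), U x ->
    {for x, continuous (iter_deriv vs f)} /\
    (forall v : R4, derivable (iter_deriv vs f) x v).

Definition symplectomorphic (U V : set R4) : Prop :=
  exists f g : R4 -> R4,
    (forall x, U x -> V (f x) /\ g (f x) = x) /\
    (forall y, V y -> U (g y) /\ f (g y) = y) /\
    smooth_on U f /\ smooth_on V g /\
    (forall x, U x -> forall u v : R4, omega ('D_u f x) ('D_v f x) = omega u v).

Definition sympl_to_ball (U : set R4) : Prop :=
  exists (c : R4) (r : R), 0 < r /\ symplectomorphic U (eball4 c r).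

End Defs.

(* Main.v *)
(** Linear symplectic maps, the exchange of positions and momenta, and scaling
    reduce everything to the domains [W(a,b)], the product of the open unit
    square with the interior of [diamond a b].  In (i) the vector [t = -J p]
    comes from a point [p] of an edge; in the frame spanned by this edge and a
    suitable transversal, [Delta] becomes [diamond s 0], and [T] is the
    parallelogram dual to that frame.

    Write the interior of [diamond a b] as
    [-a g(y2) < y1 - a < (1 - a) g(y2)].  Lambert's equal-area projection
    replaces the square of the second coordinate pair by a disc, on which a
    function of the radius generates rotations.  A generating function turns
    the half strip [0 < x < 1, 0 < y] into itself so that it exchanges [x] and
    [y] near [y = 0] and is the identity for large [y].  Used with weights
    [1 - a] above and [-a] below the kink [y1 = a], scaled by a width [c] that
    depends on the radius, and corrected by a rotation of the disc, it maps
    [W(a,b)] onto a prism over [0 < y1 < g(y2)] from which the slit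
    [x1 = 0, c <= y1] has been removed.  Such a slit is harmless: it can be
    pushed out of every compact set by compactly supported symplectomorphisms,
    and an exhaustion argument puts these together.  Hence [W(a,b)] is
    symplectomorphic to [W(0,b)], to [W(b,0)] and to [W(0,0)], which in
    action-angle coordinates is the ball minus two slits.  All maps are given
    by generating functions, so no vector field has to be integrated. *)

Require Import Defs.
From HB Require Import structures.
From mathcomp Require Import all_boot all_order all_algebra.
From mathcomp Require Import all_classical all_reals all_analysis.
From mathcomp Require Import ring lra.
From mathcomp Require finmap.
Set Implicit Arguments.
Unset Strict Implicit.
Unset Printing Implicit Defensive.
Import Order.TTheory GRing.Theory Num.Theory.
Import numFieldNormedType.Exports.
Local Open Scope classical_set_scope.
Local Open Scope ring_scope.


(** * Smooth functions *)

(** The profile over a slice has a corner at [y2 = b] and may vanish at the ends, so it cannot serve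
    as the scale of a smooth fold. The fold uses instead a smooth width [c] below the profile: it
    acts only under the height [L * c], and above it only the weight rescales, so the upper boundary
    keeps its shape. A map of the first plane whose scale depends on the second is not symplectic;
    the defect is [dG /\ dc], where [G] is a primitive attached to the fold. When [c] depends only
    on the squared radius [s], a rotation by a multiple of [c'(s) G] cancels it, and this is why the
    base is turned into a disc. Lambert's projection suits the purpose because [1 - pi s] is a
    height on the sphere and [(1 - pi s)^2 <= 4 y (1 - y)], while every profile that occurs is at
    least [y (1 - y)]; hence [c = (1 - pi s)^2 / (8 L)]. The weights have absolute values of sum 1:
    the two sides of the kink are folded next to each other over an interval of length 1. They
    communicate through the door [x1 = 0], [y1 < c], where the fold is the quarter turn
    [(x, y) |-> (y, 1 - x)] and the weight cancels; the slit is the rest of the wall between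
    them. *)

Section SmoothScalar.
Context {R : realType}.

Lemma is_diff_eps (V W : normedModType R) (f : V -> W) (L : {linear V -> W}) x :
  continuous L ->
  (forall e : R, 0 < e -> \forall h \near (0 : V),
     `|f (h + x) - f x - L h| <= e * `|h|) ->
  is_diff x f L.
Proof.
move=> cL fL.
have E : f \o shift x = cst (f x) + L +o_ 0 id.
  apply/eqaddoP => e e0; near do idtac.
  have := fL e e0; apply: filterS => h /=.
  rewrite /cst /shift /=.
  by rewrite !fctE opprD addrA.
have dE := diff_unique cL E.
apply: DiffDef => //.
by apply/diff_locallyP; rewrite dE.
Unshelve. all: by end_near. Qed.

(** Differentiability is in the sense of Fréchet, but the recursion runs over directional
    derivatives: these are again real-valued functions on [V], so one predicate serves all
    orders. *)
Fixpoint Cn (V : normedModType R) (n : nat) (U : set V) (f : V -> R) : Prop :=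
  if n is m.+1 then
    (forall x, U x -> differentiable f x) /\
    (forall v, Cn m U (fun x => 'D_v f x))
  else forall x, U x -> {for x, continuous f}.

Definition smooth (V : normedModType R) (U : set V) (f : V -> R) :=
  forall n, Cn n U f.

Section Basic.
Context {V : normedModType R}.
Implicit Types (U : set V) (f g : V -> R).

Lemma near_eq_diff (f g : V -> R) x : (\near x, f x = g x) ->
  differentiable f x -> differentiable g x.
Proof.
move=> fg df; have fgx : f x = g x by exact: nbhs_singleton fg.
have D : is_diff x g ('d f x).
apply: is_diff_eps; first exact: diff_continuous.
move=> e e0.
have /diff_locally/eqaddoP/(_ e e0) := df.
have : \forall h \near (0 : V), f (h + x) = g (h + x).
  have /(_ _ fg) : (fun h : V => h + x) @ (0 : V) --> x; last exact.
  by rewrite -[X in _ --> X]add0r; apply: cvgD; [exact: cvg_id|exact: cvg_cst].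
apply: filterS2 => h /= E.
by rewrite !fctE /= opprD addrA -E -fgx.
exact: ex_diff.
Qed.

Lemma smooth_diff U f x : smooth U f -> U x -> differentiable f x.
Proof. by move=> /(_ 1%N) [+ _]; apply. Qed.

Lemma CnW n U f : Cn n.+1 U f -> Cn n U f.
Proof.
elim: n f => [|n IH] f [df Df].
  by move=> x Ux; apply/differentiable_continuous/df.
by split=> // v; apply: IH; exact: Df.
Qed.

Lemma Cn_sub n U (U' : set V) f : U' `<=` U -> Cn n U f -> Cn n U' f.
Proof.
move=> UU'; elim: n f => [|n IH] f; first by move=> cf x /UU'; exact: cf.
by move=> [df Df]; split=> [x /UU'|v]; [exact: df|exact: IH (Df v)].
Qed.

Lemma smooth_sub U (U' : set V) f : U' `<=` U -> smooth U f -> smooth U' f.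
Proof. by move=> UU' sf n; apply: Cn_sub (sf n). Qed.

Lemma Cn_ext n U f g : open U -> (forall x, U x -> f x = g x) ->
  Cn n U f -> Cn n U g.
Proof.
move=> oU; elim: n f g => [|n IH] f g fg.
  move=> cf x Ux; have nU : nbhs x U by exact: open_nbhs_nbhs.
  have E : \near x, f x = g x by apply: filterS nU => y; exact: fg.
  have := cf x Ux; rewrite /prop_for /continuous_at (fg x Ux).
  by apply: cvg_trans; apply: near_eq_cvg; exact: E.
move=> [df Df]; have E x : U x -> \near x, f x = g x.
  by move=> Ux; apply: filterS (open_nbhs_nbhs (conj oU Ux)) => y; exact: fg.
split=> [x Ux|v]; first by apply: near_eq_diff (df x Ux); exact: E.
apply: IH (Df v) => x Ux; apply: near_eq_derive; exact: E.
Qed.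

Lemma smooth_ext U f g : open U -> (forall x, U x -> f x = g x) ->
  smooth U f -> smooth U g.
Proof. by move=> oU fg sf n; apply: Cn_ext (sf n). Qed.

Lemma Cn_local n U f : (forall x, U x -> exists2 W, W x & Cn n W f) -> Cn n U f.
Proof.
elim: n f => [|n IH] f H; first by move=> x /H [W Wx]; apply.
split=> [x Ux|v]; first by have [W Wx K] := H x Ux; case: K => df _; exact: df.
by apply: IH => x Ux; have [W Wx K] := H x Ux; exists W => //; case: K => _ Df; exact: Df.
Qed.

Lemma smooth_local U f :
  (forall x, U x -> exists2 W, W x & smooth W f) -> smooth U f.
Proof.
by move=> H n; apply: Cn_local => x /H[W Wx sf]; exists W.
Qed.

Lemma Cn_cst n U (c : R) : Cn n U (fun=> c).
Proof.
elim: n c => [|n IH] c; first by move=> x _; exact: cvg_cst.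
split=> [x _|v]; first exact: differentiable_cst.
have -> : (fun x : V => 'D_v (fun=> c) x) = fun=> 0; last exact: IH.
by rewrite funeqE => x; exact: derive_cst.
Qed.

Lemma smooth_cst U (c : R) : smooth U (fun=> c).
Proof. by move=> n; exact: Cn_cst. Qed.

Lemma smooth_lin U (L : {linear V -> R}) : continuous L -> smooth U L.
Proof.
move=> cL [|n]; first by move=> x _; exact: cL.
split=> [x _|v]; first exact: linear_differentiable.
have -> : (fun x : V => 'D_v L x) = fun=> L v; last exact: Cn_cst.
rewrite funeqE => x; rewrite deriveE; last exact: linear_differentiable.
by rewrite diff_lin.
Qed.

Lemma CnD n U f g : open U -> Cn n U f -> Cn n U g -> Cn n U (fun x => f x + g x).
Proof.
move=> oU; elim: n f g => [|n IH] f g.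
  by move=> cf cg x Ux; apply: cvgD; [exact: cf|exact: cg].
move=> [df Df] [dg Dg]; split=> [x Ux|v].
  by apply: differentiableD; [exact: df|exact: dg].
apply: Cn_ext (IH _ _ (Df v) (Dg v)) => // x Ux.
by rewrite deriveD//; apply: diff_derivable; [exact: df|exact: dg].
Qed.

Lemma CnM n U f g : open U -> Cn n U f -> Cn n U g -> Cn n U (fun x => f x * g x).
Proof.
move=> oU; elim: n f g => [|n IH] f g.
  by move=> cf cg x Ux; apply: cvgM; [exact: cf|exact: cg].
move=> sf sg; have [df Df] := sf; have [dg Dg] := sg; split=> [x Ux|v].
  by apply: differentiableM; [exact: df|exact: dg].
apply: Cn_ext (CnD oU (IH _ _ (CnW sf) (Dg v)) (IH _ _ (CnW sg) (Df v))) => // x Ux.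
by rewrite deriveM//; apply: diff_derivable; [exact: df|exact: dg].
Qed.

Lemma smoothD U f g : open U -> smooth U f -> smooth U g ->
  smooth U (fun x => f x + g x).
Proof. by move=> oU sf sg n; exact: CnD. Qed.

Lemma smoothM U f g : open U -> smooth U f -> smooth U g ->
  smooth U (fun x => f x * g x).
Proof. by move=> oU sf sg n; exact: CnM. Qed.

Lemma smoothN U f : open U -> smooth U f -> smooth U (fun x => - f x).
Proof.
move=> oU sf; apply: (smooth_ext oU _ (smoothM oU (smooth_cst U (-1)) sf)).
by move=> x _; rewrite mulN1r.
Qed.

Lemma smoothB U f g : open U -> smooth U f -> smooth U g ->
  smooth U (fun x => f x - g x).
Proof. by move=> oU sf sg; apply: smoothD => //; exact: smoothN. Qed.

Lemma smoothX U f n : open U -> smooth U f -> smooth U (fun x => f x ^+ n).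
Proof.
move=> oU sf; elim: n => [|n IH].
  by apply: (smooth_ext oU _ (smooth_cst U 1)) => x _; rewrite expr0.
by apply: (smooth_ext oU _ (smoothM oU sf IH)) => x _; rewrite exprS.
Qed.

Lemma smooth_derive U f v : smooth U f -> smooth U (fun x => 'D_v f x).
Proof. by move=> sf n; have [_] := sf n.+1; apply. Qed.

Lemma smooth_derivable U f x v : smooth U f -> U x -> derivable f x v.
Proof. by move=> sf Ux; apply: diff_derivable; exact: smooth_diff sf Ux. Qed.

Lemma smooth_continuous U f x : smooth U f -> U x -> {for x, continuous f}.
Proof. by move=> /(_ 0%N); apply. Qed.

Lemma derive_comp1 (h : R -> R) f x v : differentiable f x ->
  differentiable h (f x) -> 'D_v (h \o f) x = 'D_1 h (f x) * 'D_v f x.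
Proof.
move=> df dh; rewrite deriveE; last exact: differentiable_comp.
rewrite diff_comp// /comp [in RHS]deriveE// [in RHS]deriveE//.
by rewrite -[in LHS](mulr1 ('d f x v)) linearZ/= mulrC.
Qed.

Lemma Cn_comp1 n U (I : set R) (h : R -> R) f : open U ->
  (forall x, U x -> I (f x)) -> Cn n I h -> Cn n U f -> Cn n U (h \o f).
Proof.
move=> oU UI; elim: n h f UI => [|n IH] h f UI.
  by move=> ch cf x Ux; apply: continuous_comp; [exact: cf|exact: ch (UI _ Ux)].
move=> [dh Dh] sf; have [df Df] := sf; split=> [x Ux|v].
  by apply: differentiable_comp; [exact: df|exact: dh (UI _ Ux)].
apply: Cn_ext (CnM oU (IH _ f UI (Dh 1) (CnW sf)) (Df v)) => // x Ux.
by rewrite derive_comp1//; [exact: df|exact: dh (UI _ Ux)].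
Qed.

Lemma smooth_comp1 U (I : set R) (h : R -> R) f : open U ->
  (forall x, U x -> I (f x)) -> smooth I h -> smooth U f -> smooth U (h \o f).
Proof. by move=> oU UI sh sf n; apply: Cn_comp1 UI _ _. Qed.

End Basic.
End SmoothScalar.


(** * Smooth maps on products and into row vectors *)

Section SmoothComposition.
Context {R : realType}.

Lemma smooth_fst (V : normedModType R) (U : set (V * R)) (h : V -> R) (W : set V) :
  open U -> (forall q, U q -> W q.1) -> smooth W h -> smooth U (fun q => h q.1).
Proof.
move=> oU UW sh n; elim: n h sh => [|n IH] h sh.
  move=> q Uq; apply: (@continuous_comp _ _ _ fst h); first exact: cvg_fst.
  exact: smooth_continuous sh (UW _ Uq).
have dfst (q : V * R) : is_diff q fst fst.
  have cf : continuous (fst : V * R -> V) by move=> p; exact: cvg_fst.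
  apply: DiffDef; first exact: (@linear_differentiable _ _ _ (GRing.Linear.clone _ _ _ _ fst _)).
  exact: (@diff_lin _ _ _ (GRing.Linear.clone _ _ _ _ fst _)).
split=> [q Uq|v].
  apply: (@differentiable_comp _ _ _ _ fst h) => //.
  exact: smooth_diff sh (UW _ Uq).
exact: (IH (fun x => 'D_(v.1) h x) (smooth_derive _ sh)).
Qed.

Lemma smooth_snd (V : normedModType R) (U : set (V * R)) : smooth U (fun q => q.2).
Proof.
apply: (@smooth_lin R _ U (GRing.Linear.clone _ _ _ _ snd _)) => p; exact: cvg_snd.
Qed.


Lemma is_diff_graph (V : normedModType R) (sg : V -> R) z :
  differentiable sg z -> is_diff z (fun z => (z, sg z)) (fun v => (v, 'd sg z v)).
Proof.
move=> ds; exact: (is_diff_pair (is_diff_id z) (differentiableP ds)).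
Qed.

Lemma derive_graph (V : normedModType R) (F : V * R -> R) (sg : V -> R) z v :
  differentiable sg z -> differentiable F (z, sg z) ->
  'D_v (fun z => F (z, sg z)) z =
  'D_((v, 0) : V * R) F (z, sg z) + 'D_v sg z * 'D_((0, 1) : V * R) F (z, sg z).
Proof.
move=> ds dF; have dg := is_diff_graph ds.
rewrite deriveE; last exact: (@differentiable_comp _ _ _ _ (fun z => (z, sg z)) F).
rewrite (@diff_comp _ _ _ _ (fun z => (z, sg z)) F)//=.
rewrite diff_val /= !deriveE// -[in RHS]/('d sg z v *: 'd F (z, sg z) (0, 1)) -linearZ -linearD.
congr ('d F _ _).
apply/pair_equal_spec; split=> /=.
  by rewrite scaler0 addr0.
by rewrite add0r /GRing.scale/= mulr1.
Qed.

(** Stated order by order: in the implicit function theorem the regularity of [sg] is known only up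
    to the order already reached. *)
Lemma Cn_graph n (V : normedModType R) (U : set V) (W : set (V * R))
    (F : V * R -> R) (sg : V -> R) : open U ->
  (forall z, U z -> W (z, sg z)) -> Cn n W F -> Cn n U sg ->
  Cn n U (fun z => F (z, sg z)).
Proof.
move=> oU UW; elim: n F => [|n IH] F.
  move=> cF cs z Uz; apply: (@continuous_comp _ _ _ (fun z => (z, sg z)) F).
    exact: (@cvg_pair _ _ _ (nbhs z) (nbhs z) (nbhs (sg z)) _ _ _ id sg cvg_id (cs z Uz)).
  exact: cF (UW _ Uz).
move=> [dF DF] ss; have [ds Ds] := ss; split=> [z Uz|v].
  apply: (@differentiable_comp _ _ _ _ (fun z => (z, sg z)) F).
    exact: (@ex_diff _ _ _ _ _ _ _ (is_diff_graph (ds z Uz))).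
  exact: dF (UW _ Uz).
apply: Cn_ext (CnD oU (IH _ (DF (v, 0)) (CnW ss))
  (CnM oU (Ds v) (IH _ (DF (0, 1)) (CnW ss)))) => // z Uz.
by rewrite derive_graph//; [exact: ds|exact: dF (UW _ Uz)].
Qed.


Lemma mx_sum_delta (V : normedModType R) m (F : V -> 'rV[R]_m) :
  F = \sum_(j < m) (fun z => F z 0 j *: delta_mx 0 j).
Proof. by rewrite funeqE => z; rewrite fct_sumE [LHS]row_sum_delta. Qed.

Lemma differentiable_rV (V : normedModType R) m (F : V -> 'rV[R]_m) z :
  (forall j, differentiable (fun z => F z 0 j) z) -> differentiable F z.
Proof.
move=> dF; rewrite (mx_sum_delta F); apply: differentiable_sum => j.
exact: differentiableZl.
Qed.

Lemma derive_rV (V : normedModType R) m (F : V -> 'rV[R]_m) z v :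
  (forall j, differentiable (fun z => F z 0 j) z) ->
  'D_v F z = \row_j 'D_v (fun z => F z 0 j) z.
Proof.
move=> dF; rewrite derive_mx; last exact/diff_derivable/differentiable_rV.
by apply/rowP => j; rewrite !mxE.
Qed.

Lemma derive_comp_rV (V : normedModType R) m (F : V -> 'rV[R]_m)
    (G : 'rV[R]_m -> R) z v :
  (forall j, differentiable (fun z => F z 0 j) z) -> differentiable G (F z) ->
  'D_v (G \o F) z =
  \sum_(j < m) 'D_v (fun z => F z 0 j) z * 'D_(delta_mx 0 j) G (F z).
Proof.
move=> dF dG; have dF' := differentiable_rV dF.
rewrite deriveE; last exact: differentiable_comp.
rewrite diff_comp// /comp -(deriveE v dF') derive_rV//.
rewrite [X in 'd G _ X]row_sum_delta linear_sum; apply: eq_bigr => j _.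
by rewrite linearZ/= mxE -deriveE.
Qed.

Lemma continuous_rV (V : normedModType R) m (F : V -> 'rV[R]_m) z :
  (forall j, {for z, continuous (fun z => F z 0 j)}) -> {for z, continuous F}.
Proof.
move=> cF; apply/cvgrPdist_le => /= e e0; near=> t.
rewrite [leLHS]/Num.Def.normr/= mx_normrE; apply: bigmax_le; first exact: ltW.
case=> i j _ /=; rewrite !mxE ord1; move: j; near: t; apply: filter_forall => j.
by have /cvgrPdist_le/(_ e e0) := cF j.
Unshelve. all: by end_near. Qed.

Lemma Cn_sum n (V : normedModType R) m (U : set V) (F : 'I_m -> V -> R) : open U ->
  (forall j, Cn n U (F j)) -> Cn n U (fun z => \sum_(j < m) F j z).
Proof.
move=> oU; elim: m F => [|m IH] F sF.
  by apply: (Cn_ext oU _ (Cn_cst n U 0)) => z _; rewrite big_ord0.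
apply: (Cn_ext oU _ (CnD oU (IH _ (fun j => sF (widen_ord (leqnSn m) j))) (sF ord_max))).
by move=> z _; rewrite big_ord_recr.
Qed.

Lemma Cn_comp_rV n (V : normedModType R) m (U : set V) (W : set 'rV[R]_m)
    (F : V -> 'rV[R]_m) (G : 'rV[R]_m -> R) : open U ->
  (forall z, U z -> W (F z)) -> Cn n W G ->
  (forall j, Cn n U (fun z => F z 0 j)) -> Cn n U (G \o F).
Proof.
move=> oU UW; elim: n G => [|n IH] G.
  move=> cG cF z Uz; apply: continuous_comp; last exact: cG (UW _ Uz).
  by apply: continuous_rV => j; exact: cF.
move=> [dG DG] sF; split=> [z Uz|v].
  apply: differentiable_comp; last exact: dG (UW _ Uz).
  by apply: differentiable_rV => j; have [+ _] := sF j; apply.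
have H : Cn n U (fun z => \sum_(j < m) 'D_v (fun z => F z 0 j) z *
    ('D_(delta_mx 0 j) G \o F) z).
  apply: Cn_sum => // j; apply: CnM => //; first by have [_] := sF j; apply.
  by apply: IH => [|k]; [exact: DG|exact: CnW].
apply: Cn_ext H => // z Uz.
rewrite derive_comp_rV//; last exact: dG (UW _ Uz).
by move=> j; have [+ _] := sF j; apply.
Qed.

Definition smooth_rV (V : normedModType R) m (U : set V) (F : V -> 'rV[R]_m) :=
  forall j, smooth U (fun z => F z 0 j).

Lemma smooth_comp_rV (V : normedModType R) m (U : set V) (W : set 'rV[R]_m)
    (F : V -> 'rV[R]_m) (G : 'rV[R]_m -> R) : open U ->
  (forall z, U z -> W (F z)) -> smooth W G -> smooth_rV U F -> smooth U (G \o F).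
Proof.
by move=> oU UW sG sF n; apply: Cn_comp_rV UW _ _ => // j; exact: sF.
Qed.

Lemma smooth_rV_diff (V : normedModType R) m (U : set V) (F : V -> 'rV[R]_m) z :
  smooth_rV U F -> U z -> differentiable F z.
Proof. by move=> sF Uz; apply: differentiable_rV => j; exact: smooth_diff (sF j) Uz. Qed.

(** Bridge to [smooth_on]: every iterated derivative is computed coordinatewise and is smooth
    again. *)
Lemma smooth_rV_on (U : set 'rV[R]_(2 + 2)) (F : 'rV[R]_(2 + 2) -> 'rV[R]_(2 + 2)) :
  open U -> smooth_rV U F -> smooth_on U F.
Proof.
move=> oU sF vs; have {}sF : smooth_rV U (iter_deriv vs F).
  elim: vs => [|v vs IH] //= j.
  apply: (smooth_ext oU _ (smooth_derive v (IH j))) => z Uz.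
  by rewrite derive_rV ?mxE// => k; exact: smooth_diff (IH k) Uz.
move=> z Uz; have dF := smooth_rV_diff sF Uz; split=> [|v].
  exact: differentiable_continuous.
exact: diff_derivable.
Qed.

End SmoothComposition.


(** * Elementary smooth functions and the implicit function theorem *)

Section Elementary.
Context {R : realType}.

Lemma derive_R (f : R -> R) x v : differentiable f x -> 'D_v f x = v * 'D_1 f x.
Proof.
by move=> df; rewrite !deriveE// -[in LHS](mulr1 v) -[v * 1]/(v *: 1) linearZ.
Qed.

Lemma Cn1S n (I : set R) (h dh : R -> R) : open I ->
  (forall x, I x -> is_derive x 1 h (dh x)) -> Cn n I dh -> Cn n.+1 I h.
Proof.
move=> oI dhE sdh; have dif x : I x -> differentiable h x.
  by move=> /dhE H; apply/derivable1_diffP; exact: ex_derive.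
split=> // v; apply: (Cn_ext oI _ (CnM oI (Cn_cst n I v) sdh)) => x Ix.
by rewrite derive_R ?(@derive_val _ _ _ _ _ _ _ (dhE x Ix))//; exact: dif.
Qed.

Lemma smooth1 (I : set R) (h dh : R -> R) : open I ->
  (forall x, I x -> is_derive x 1 h (dh x)) -> smooth I dh -> smooth I h.
Proof. by move=> oI dhE sdh n; apply: CnW; apply: (Cn1S oI dhE). Qed.

Lemma open_neq0 : open [set x : R | x != 0].
Proof. exact: open_neq. Qed.

Lemma smooth_inv : smooth [set x : R | x != 0] (fun x => x^-1).
Proof.
move=> n; elim: n => [|n IH] /=; first by move=> x x0; exact: inv_continuous.
apply: (@Cn1S n _ _ (fun x => - (x^-1 * x^-1)) open_neq0).
  move=> x x0; apply: DeriveDef; first by apply: derivableV.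
  by rewrite deriveV// derive_id /GRing.scale/= mulr1 expr2 invfM.
apply: (Cn_ext open_neq0 _ (CnM open_neq0 (Cn_cst n _ (-1)) (CnM open_neq0 IH IH))).
by move=> x _; rewrite mulN1r.
Qed.

Lemma CnV n (V : normedModType R) (U : set V) (f : V -> R) : open U ->
  (forall x, U x -> f x != 0) -> Cn n U f -> Cn n U (fun x => (f x)^-1).
Proof. by move=> oU f0; exact: (Cn_comp1 oU f0 (smooth_inv n)). Qed.

Lemma smoothV (V : normedModType R) (U : set V) (f : V -> R) : open U ->
  (forall x, U x -> f x != 0) -> smooth U f -> smooth U (fun x => (f x)^-1).
Proof. by move=> oU f0 sf n; exact: CnV. Qed.

Lemma smooth_id (I : set R) : smooth I id.
Proof.
apply: (@smooth_lin R R I idfun) => x; exact: cvg_id.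
Qed.


Lemma smooth_sin_cos n : Cn n setT (@sin R) /\ Cn n setT (@cos R).
Proof.
elim: n => [|n [IH1 IH2]].
  by split=> x _; [exact: continuous_sin|exact: continuous_cos].
split; first by apply: (@Cn1S n _ _ (@cos R) openT) => // x _; exact: is_derive_sin.
apply: (@Cn1S n _ _ (fun x => - sin x) openT).
by apply: (Cn_ext openT _ (CnM openT (Cn_cst n _ (-1)) IH1)) => x _; rewrite mulN1r.
Qed.

Lemma smooth_sin (I : set R) : smooth I sin.
Proof. by move=> n; apply: (@Cn_sub _ _ n setT) => //; have [] := smooth_sin_cos n. Qed.

Lemma smooth_cos (I : set R) : smooth I cos.
Proof. by move=> n; apply: (@Cn_sub _ _ n setT) => //; have [] := smooth_sin_cos n. Qed.

Lemma smooth_atan (I : set R) : smooth I atan.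
Proof.
apply: (@smooth_sub _ _ setT) => //.
apply: (@smooth1 _ _ (fun x => (1 + x ^+ 2)^-1) openT).
apply: smoothV; first exact: openT.
  by move=> x _; rewrite gt_eqF// ltr_pwDl// sqr_ge0.
apply: smoothD; first exact: openT.
  exact: smooth_cst.
by apply: smoothX; [exact: openT|exact: smooth_id].
Qed.

Lemma open_gt0 : open [set x : R | 0 < x].
Proof. exact: open_gt. Qed.

Lemma smooth_sqrt : smooth [set x : R | 0 < x] Num.sqrt.
Proof.
move=> n; elim: n => [|n IH]; first by move=> x _; exact: sqrt_continuous.
apply: (@Cn1S n _ _ (fun x => (2 * Num.sqrt x)^-1) open_gt0).
apply: (CnV open_gt0).
  by move=> x x0 /=; rewrite mulf_neq0// gt_eqF// sqrtr_gt0.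
exact: (CnM open_gt0 (Cn_cst n _ 2) IH).
Qed.

(* The derivative of the implicit function is itself an expression in the
   implicit function, so its regularity improves by one degree at a time. *)
Lemma smooth_implicit (V : normedModType R) (U : set V) (I : set R)
    (F : V * R -> R) (sg : V -> R) :
  open U -> open I -> smooth [set q | U q.1 /\ I q.2] F ->
  (forall z, U z -> I (sg z)) -> (forall z, U z -> F (z, sg z) = 0) ->
  (forall z s t, U z -> I s -> I t -> s < t -> F (z, s) < F (z, t)) ->
  (forall z, U z -> 0 < 'D_((0, 1) : V * R) F (z, sg z)) ->
  smooth U sg.
Proof.
move=> oU oI sF Isg Fsg Fmono Fpos.
have oW : open [set q : V * R | U q.1 /\ I q.2].
  exact: openI (open_comp (fun q _ => cvg_fst) oU) (open_comp (fun q _ => cvg_snd) oI).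
have Wg z : U z -> [set q | U q.1 /\ I q.2] (z, sg z) by move=> Uz; split=> //; exact: Isg.
have csg z : U z -> {for z, continuous sg}.
  (* Continuity by trapping: [F] is negative at [sg z - d] and positive at [sg z + d]; both signs
     persist for nearby [y], and monotonicity places [sg y] in between. *)
  move=> Uz; apply/cvgrPdist_lt => e e0.
  have /nbhs_ballP[d0 d00 dI] : nbhs (sg z) I by apply: open_nbhs_nbhs; split=> //; exact: Isg.
  pose d := Num.min e d0 / 2.
  have m0 : 0 < Num.min e d0 by rewrite lt_min e0.
  have dlt : d < e /\ d < d0.
    have [? ?] : Num.min e d0 <= e /\ Num.min e d0 <= d0 by rewrite !ge_min !lexx orbT.
    by rewrite /d; split; lra.
  have dp : 0 < d by rewrite /d; lra.
  have I1 : I (sg z - d).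
    by apply: dI; rewrite -ball_normE/= opprB addrC subrK gtr0_norm//; case: dlt.
  have I2 : I (sg z + d).
    by apply: dI; rewrite -ball_normE/= opprD addrA subrr sub0r normrN gtr0_norm//; case: dlt.
  have cF s : I s -> (fun y : V => F (y, s)) y @[y --> z] --> F (z, s).
    move=> Is; apply: (@continuous_comp _ _ _ (fun y => (y, s)) F z).
      exact: (@cvg_pair _ _ _ (nbhs z) (nbhs z) (nbhs s) _ _ _ id (fun=> s) cvg_id (cvg_cst s)).
    by apply: smooth_continuous sF _.
  have F1 : F (z, sg z - d) < 0 by rewrite -(Fsg z Uz); apply: Fmono => //; [exact: Isg|lra].
  have F2 : 0 < F (z, sg z + d) by rewrite -(Fsg z Uz); apply: Fmono => //; [exact: Isg|lra].
  have U1 := open_nbhs_nbhs (conj oU Uz).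
  near=> y.
  have Uy : U y by near: y.
  have y1 : F (y, sg z - d) < 0 by near: y; exact: (cvgr_lt _ (cF _ I1)).
  have y2 : 0 < F (y, sg z + d) by near: y; exact: (cvgr_gt _ (cF _ I2)).
  have l1 : sg z - d < sg y.
    rewrite ltNge; apply/negP; rewrite le_eqVlt => /predU1P[E|/(Fmono y _ _ Uy (Isg _ Uy) I1)].
      by move: y1; rewrite -E Fsg// ltxx.
    by rewrite Fsg// => /lt_trans/(_ y1); rewrite ltxx.
  have l2 : sg y < sg z + d.
    rewrite ltNge; apply/negP; rewrite le_eqVlt => /predU1P[E|/(Fmono y _ _ Uy I2 (Isg _ Uy))].
      by move: y2; rewrite E Fsg// ltxx.
    by rewrite Fsg// => /(lt_trans y2); rewrite ltxx.
  by rewrite ltr_norml; case: dlt => ? ?; lra.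
have dsg z : U z -> is_diff z sg (fun v => - ('D_((0, 1) : V * R) F (z, sg z))^-1 *
    'D_((v, 0) : V * R) F (z, sg z)).
  move=> Uz; set q := (z, sg z); have dF : differentiable F q by exact: smooth_diff sF (Wg z Uz).
  set a := 'D_(0, 1) F q; have a0 : 0 < a by exact: Fpos.
  pose L0 (v : V) := - a^-1 * 'd F q ((v, 0) : V * R).
  have L0lin : linear L0.
    move=> k u v; rewrite /L0.
    have -> : ((k *: u + v, 0) : V * R) = k *: ((u, 0) : V * R) + (v, 0).
      by apply/pair_equal_spec; split=> //=; rewrite scaler0 addr0.
    by rewrite linearD linearZ mulrDr; congr (_ + _); exact: mulrCA.
  pose LM := GRing.isLinear.Build _ _ _ _ _ L0lin.
  pose L : {linear V -> R} := HB.pack L0 LM.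
  have cL : continuous L.
    move=> v; apply: cvgM; first exact: cvg_cst.
    apply: (@continuous_comp _ _ _ (fun v => (v, 0)) ('d F q) v).
      exact: (@cvg_pair _ _ _ (nbhs v) (nbhs v) (nbhs 0) _ _ _ id (fun=> 0) cvg_id (cvg_cst 0)).
    exact: diff_continuous.
  rewrite (_ : (fun v => _) = L); last by rewrite funeqE => v; rewrite deriveE.
  apply: is_diff_eps => // e e0.
  have [C /= C0 LC] := linear_lipschitz cL.
  (* If [t] is the increment of [sg], the error is at most [m * (|h| + |t|)]. The bound [1 / 2]
     allows [|t|] to be absorbed, so that [|t| <= (2 * C + 1) * |h|]; the other bound then makes the
     error at most [e * |h|]. *)
  pose m := Num.min (1 / 2) (e / (2 * C + 2)).
  have m0 : 0 < m by rewrite lt_min divr_gt0//=; apply: divr_gt0 => //; lra.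
  have [m1 m2] : m <= 1 / 2 /\ m * (2 * C + 2) <= e.
    rewrite -ler_pdivlMr; last by lra.
    by rewrite /m !ge_min !lexx orbT.
  have /diff_locally/eqaddoP/(_ (a * m) (mulr_gt0 a0 m0)) := dF.
  have cg : (fun h : V => (h, sg (h + z) - sg z)) h @[h --> (0 : V)] --> (0 : V, 0 : R).
    have hz : (fun h : V => h + z) @ (0 : V) --> z.
      by rewrite -[X in _ --> X]add0r; apply: cvgD; [exact: cvg_id|exact: cvg_cst].
    have E : (fun h => sg (h + z) - sg z) @ (0 : V) --> sg z - sg z.
      by apply: cvgB; [apply: (@cvg_comp _ _ _ (fun h => h + z) sg _ _ _ hz); exact: csg|exact: cvg_cst].
    rewrite subrr in E.
    exact: (@cvg_pair _ _ _ (nbhs 0) (nbhs 0) (nbhs 0) _ _ _ id _ cvg_id E).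
  move=> /cg.
  have /(_ _ (open_nbhs_nbhs (conj oU Uz))) : (fun h : V => h + z) @ (0 : V) --> z.
    by rewrite -[X in _ --> X]add0r; apply: cvgD; [exact: cvg_id|exact: cvg_cst].
  move=> nU nF; near=> h.
  have Uh : U (h + z) by near: h.
  have : `|(F \o shift q - (cst (F q) + 'd F q)) (h, sg (h + z) - sg z)| <=
    a * m * `|(h, sg (h + z) - sg z)| by near: h.
  rewrite !fctE /=.
  set t := sg (h + z) - sg z.
  rewrite (_ : F ((h, t) + q) = 0); last first.
    by rewrite /q -[_ + _]/(h + z, t + sg z) /t subrK Fsg.
  rewrite (_ : F q = 0) ?Fsg// sub0r add0r normrN.
  have -> : 'd F q (h, t) = a * (t - L h).
    have -> : ((h, t) : V * R) = (h, 0) + t *: (0, 1).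
      apply/pair_equal_spec; split=> /=; first by rewrite scaler0 addr0.
      by rewrite add0r /GRing.scale/= mulr1.
    have e1 : 'd F q (0, 1) = a by rewrite /a deriveE.
    have e2 : a * L h = - 'd F q (h, 0) by rewrite /L/= /L0 mulrA mulrN mulfV ?gt_eqF// mulN1r.
    rewrite linearD linearZ mulrBr e2 opprK [RHS]addrC; congr (_ + _).
    by rewrite -[LHS]/(t * 'd F q (0, 1)) e1 mulrC.
  rewrite normrM gtr0_norm// -mulrA ler_pM2l// => tL.
  have Lh := LC h; have nh := normr_ge0 h.
  have nt : `|(h, t)| <= `|h| + `|t|.
    by rewrite prod_normE/= ge_max lerDl lerDr !normr_ge0.
  have tt : `|t| <= `|t - L h| + `|L h| by rewrite -[in leLHS](subrK (L h) t) ler_normD.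
  have b1 : m * `|(h, t)| <= m * (`|h| + `|t|) by rewrite ler_wpM2l// ltW.
  have b2 : m * (`|h| + `|t|) <= 1 / 2 * (`|h| + `|t|) by rewrite ler_wpM2r// addr_ge0.
  have b3 : `|t| <= (2 * C + 1) * `|h| by lra.
  have b4 : m * (`|h| + `|t|) <= m * ((2 * C + 2) * `|h|).
    by rewrite ler_wpM2l//; [exact: ltW|lra].
  have b5 : m * (2 * C + 2) * `|h| <= e * `|h| by rewrite ler_wpM2r.
  rewrite -/t; lra.
elim=> [|n IH] //; split=> [z Uz|v].
  exact: (@ex_diff _ _ _ _ _ _ _ (dsg z Uz)).
have H w : Cn n U (fun z => 'D_w F (z, sg z)).
  apply: (@Cn_graph _ n _ _ _ ('D_w F)) Wg _ IH => //.
  exact: smooth_derive.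
apply: (Cn_ext oU _ (CnM oU (Cn_cst n U (-1)) (CnM oU (CnV oU _ (H (0, 1))) (H (v, 0))))).
  move=> z Uz; have ds := @ex_diff _ _ _ _ _ _ _ (dsg z Uz).
  by rewrite [RHS]deriveE// (@diff_val _ _ _ _ _ _ _ (dsg z Uz)); ring.
by move=> z Uz; rewrite gt_eqF// Fpos.
Unshelve. all: by end_near. Qed.

End Elementary.


(** * Flat functions and cutoffs *)

Section Step.
Context {R : realType}.

(** The powers [x ^- m] in front of the exponential make the span of the family closed under
    differentiation. *)
Definition flat (m : nat) (x : R) := if 0 < x then x ^- m * expR (- x^-1) else 0.

Lemma flat_ge0 m x : 0 <= flat m x.
Proof.
rewrite /flat; case: ifPn => // x0; rewrite mulr_ge0 ?expR_ge0// invr_ge0 exprn_ge0//.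
exact: ltW.
Qed.

Lemma flat_gt0 m x : 0 < x -> 0 < flat m x.
Proof. by move=> x0; rewrite /flat x0 mulr_gt0 ?expR_gt0// invr_gt0 exprn_gt0. Qed.

(** The exponential beats every power, [(y / (m + 1)) ^ (m + 1) <= exp y] at [y = 1 / x], which
    follows from [1 + u <= exp u]. *)
Lemma flat_le m x : 0 <= x -> flat m x <= m.+1%:R ^+ m.+1 * x.
Proof.
move=> x0; rewrite /flat; case: ifPn => [{}x0|_]; last first.
  by rewrite mulr_ge0// exprn_ge0.
have y0 : 0 < x^-1 by rewrite invr_gt0.
have k0 : (0 : R) < m.+1%:R ^+ m.+1 by rewrite exprn_gt0// ltr0n.
have H : (x^-1 / m.+1%:R) ^+ m.+1 <= expR x^-1.
  have -> : expR x^-1 = expR (x^-1 / m.+1%:R) ^+ m.+1.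
    by rewrite -expRM_natl; congr expR; rewrite mulrC divfK// pnatr_eq0.
  apply: lerXn2r; rewrite ?nnegrE ?expR_ge0 ?divr_ge0//; first exact: ltW.
  by apply: le_trans (expR_ge1Dx _); rewrite lerDr.
rewrite -exprVn expRN ler_pdivrMr ?expR_gt0//.
rewrite expr_div_n ler_pdivrMr// mulrC in H.
rewrite -(ler_pM2r y0) -exprSr (le_trans H)//.
have E : x * x^-1 = 1 by rewrite mulfV ?gt_eqF.
by rewrite mulrAC -(mulrA _ x) E mulr1 mulrC.
Qed.

Lemma is_derive_flat m (x : R) :
  is_derive x 1 (flat m) (flat m.+2 x - m%:R * flat m.+1 x).
Proof.
have [x0|x0|->] := ltgtP x 0.
- have H : is_derive x 1 (fun=> 0 : R) 0 by exact: is_derive_cst.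
  have E k : flat k x = 0 by rewrite /flat ltNge (ltW x0).
  rewrite !E mulr0 subr0; apply: near_eq_is_derive H; near=> y.
  by rewrite /flat ltNge ltW//=; near: y; exact: lt_nbhsl.
- pose h := (fun y : R => y^-1 ^+ m * expR (- y^-1)).
  have dV : is_derive x 1 (fun y : R => y^-1) (- x ^- 2).
    apply: DeriveDef; first by apply: derivableV; rewrite ?gt_eqF.
    by rewrite deriveV ?gt_eqF// derive_id /GRing.scale/= mulr1.
  have xn0 : x != 0 by rewrite gt_eqF.
  have H : is_derive x 1 h (flat m.+2 x - m%:R * flat m.+1 x).
    have d1 : is_derive x 1 (fun y : R => y^-1 ^+ m) (m%:R * x^-1 ^+ m.-1 * (- x ^- 2)).
      rewrite (_ : (fun y : R => y^-1 ^+ m) = (fun y : R => y^-1) ^+ m).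
        exact: is_deriveX.
      by rewrite funeqE => y; rewrite exprfctE.
    have d2 : is_derive x 1 (fun y : R => expR (- y^-1)) (expR (- x^-1) * x ^- 2).
      have dN : is_derive x 1 (fun y : R => - y^-1) (x ^- 2).
        by apply: is_derive_eq (is_deriveN _) _; rewrite opprK.
      exact: (@is_derive1_comp _ expR (fun y : R => - y^-1) x _ _ _ dN).
    apply: is_derive_eq (is_deriveM d1 d2) _.
    rewrite /flat x0 /GRing.scale/=.
    case: (m) => [|k] /=; first by rewrite !mul0r !mulr0 subr0 addr0 expr0 mul1r mulrC.
    by rewrite -!exprVn !exprS; ring.
  apply: near_eq_is_derive H; near=> y.
  have y0 : 0 < y by near: y; exact: lt_nbhsr.
  by rewrite /flat /h y0 exprVn.
- have E k : flat k 0 = 0 by rewrite /flat ltxx.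
  rewrite !E mulr0 subr0.
  have H : is_diff (0 : R) (flat m) (\0 : {linear R -> R}).
    apply: is_diff_eps => [z|e e0]; first exact: cvg_cst.
    pose C : R := m.+2%:R ^+ m.+2.
    have C0 : 0 < C by rewrite exprn_gt0// ltr0n.
    have eC : 0 < e / C by rewrite divr_gt0.
    apply: filterS (nbhs0_le eC) => h hle; rewrite addr0 E !subr0.
    have [h0|h0] := ltP 0 h; last first.
      by rewrite /flat ltNge h0/= normr0 mulr_ge0// ltW.
    (* Raising the index yields one factor [h] and [flat_le] a second one, so the increment at 0 is
       quadratic. *)
    have -> : flat m h = h * flat m.+1 h.
      rewrite /flat h0 mulrA exprS invfM mulrA mulfV ?mul1r// gt_eqF//.
    rewrite normrM mulrC ler_pM2r ?normr_gt0 ?gt_eqF// ger0_norm ?flat_ge0//.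
    apply: le_trans (flat_le _ (ltW h0)) _.
    by rewrite -/C mulrC -ler_pdivlMr// (le_trans (ler_norm h)).
  apply: DeriveDef.
    by apply: diff_derivable; exact: (@ex_diff _ _ _ _ _ _ _ H).
  rewrite deriveE; last exact: (@ex_diff _ _ _ _ _ _ _ H).
  by rewrite (@diff_val _ _ _ _ _ _ _ H).
Unshelve. all: by end_near. Qed.

Lemma smooth_flat m : smooth setT (flat m).
Proof.
move=> n; elim: n m => [|n IH] m.
  move=> x _; apply: differentiable_continuous; apply/derivable1_diffP.
  exact: (@ex_derive _ _ _ _ _ _ _ (is_derive_flat m x)).
apply: (@Cn1S _ n _ _ (fun x => flat m.+2 x + (- m%:R) * flat m.+1 x) openT).
  by move=> x _; apply: is_derive_eq (is_derive_flat m x) _; rewrite mulNr.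
exact: (CnD openT (IH _) (CnM openT (Cn_cst _ _ _) (IH _))).
Qed.

Definition step (x : R) := flat 0 x / (flat 0 x + flat 0 (1 - x)).

Lemma step_den_gt0 x : 0 < flat 0 x + flat 0 (1 - x).
Proof.
have [x0|x0] := ltP 0 x; first by rewrite ltr_pwDl ?flat_gt0 ?flat_ge0.
by rewrite ltr_wpDl ?flat_ge0// flat_gt0//; lra.
Qed.

Lemma step_ge0 x : 0 <= step x.
Proof. by rewrite divr_ge0 ?flat_ge0// ltW// step_den_gt0. Qed.


Lemma step_le1 x : step x <= 1.
Proof. by rewrite ler_pdivrMr ?step_den_gt0// mul1r lerDl flat_ge0. Qed.

Lemma step0 x : x <= 0 -> step x = 0.
Proof. by move=> x0; rewrite /step {1}/flat ltNge x0 mul0r. Qed.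

Lemma step1 x : 1 <= x -> step x = 1.
Proof.
move=> x0; rewrite /step; have -> : flat 0 (1 - x) = 0.
  by rewrite /flat; case: ifPn => //; lra.
by rewrite addr0 mulfV// gt_eqF// flat_gt0//; lra.
Qed.

Lemma smooth_step : smooth setT step.
Proof.
have s2 : smooth setT (fun x : R => flat 0 (1 - x)).
  apply: (smooth_comp1 (f := fun x : R => 1 - x) openT (I := setT)) => //.
    exact: smooth_flat.
  by apply: smoothB; [exact: openT|exact: smooth_cst|exact: smooth_id].
apply: (smoothM openT (@smooth_flat 0)).
apply: smoothV; first exact: openT.
  by move=> x _; rewrite gt_eqF// step_den_gt0.
exact: (smoothD openT (@smooth_flat 0) s2).
Qed.

Lemma smooth_bounded (h : R -> R) a b : smooth setT h ->
  (forall x, x < a \/ b < x -> h x = 0) -> exists2 C : R, 0 < C & forall x, `|h x| <= C.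
Proof.
move=> sh h0; have [ab|ba] := leP a b; last first.
  exists 1 => // x; rewrite h0 ?normr0//.
  by have [?|?] := ltP x a; [left|right; lra].
have ch : {within `[a, b], continuous (fun x => `|h x|)}.
  apply: continuous_subspaceT => x; apply: cvg_norm.
  exact: (smooth_continuous sh).
have [c cab cM] := EVT_max ab ch.
exists (`|h c| + 1) => [|x]; first by rewrite ltr_wpDl.
have [xa|xa] := ltP x a; first by rewrite h0 ?normr0 ?addr_ge0//; left.
have [xb|xb] := ltP b x; first by rewrite h0 ?normr0 ?addr_ge0//; right.
by rewrite (le_trans (cM x _)) ?lerDl// in_itv/= xa.
Qed.

Lemma derive_flat_region (h : R -> R) c x : (\near x, h x = c) -> 'D_1 h x = 0.
Proof.
by move=> hc; rewrite (near_eq_derive _ (g := cst c)) ?derive_cst.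
Qed.

End Step.


(** * A calculus of directional derivatives *)

Section DirectionalDerivative.
Context {R : realType} {V : normedModType R}.

Implicit Types (z v : V) (f g : V -> R) (a b : R).
(** Differentiability and value in one predicate: the derivative of a composite expression is
    assembled from the rules below, and two expressions of one function are compared by [der_uniq],
    without rewriting under ['D_v]. *)
Definition der (z v : V) (f : V -> R) (d : R) := differentiable f z /\ 'D_v f z = d.

Lemma der_cst z v c : der z v (fun=> c) 0.
Proof. by split; [exact: differentiable_cst|exact: derive_cst]. Qed.

Lemma derD z v f g a b : der z v f a -> der z v g b -> der z v (fun z => f z + g z) (a + b).
Proof.
move=> [df <-] [dg <-]; split; first exact: differentiableD.
by rewrite deriveD//; exact: diff_derivable.
Qed.

Lemma derN z v f a : der z v f a -> der z v (fun z => - f z) (- a).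
Proof.
move=> [df <-]; split; first exact: differentiableN.
by rewrite deriveN//; exact: diff_derivable.
Qed.

Lemma derB z v f g a b : der z v f a -> der z v g b -> der z v (fun z => f z - g z) (a - b).
Proof. by move=> df /derN; exact: derD. Qed.

Lemma derM z v f g a b : der z v f a -> der z v g b ->
  der z v (fun z => f z * g z) (f z * b + g z * a).
Proof.
move=> [df <-] [dg <-]; split; first exact: differentiableM.
by rewrite deriveM//; exact: diff_derivable.
Qed.

Lemma der_sqr z v f a : der z v f a -> der z v (fun z => f z ^+ 2) (2 * f z * a).
Proof.
move=> df; have := derM df df; rewrite (_ : (fun z => f z * f z) = (fun z => f z ^+ 2)).
  by congr der; ring.
by rewrite funeqE => w; rewrite expr2.
Qed.

Lemma der_comp z v (h : R -> R) f a b : is_derive (f z) 1 h b -> der z v f a ->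
  der z v (fun z => h (f z)) (b * a).
Proof.
move=> dh [df <-]; have dh' : differentiable h (f z).
  by apply/derivable1_diffP; exact: ex_derive.
split; first exact: (@differentiable_comp _ _ _ _ f h).
by rewrite (derive_comp1 _ df dh') derive_val.
Qed.

Lemma derV z v f a : f z != 0 -> der z v f a ->
  der z v (fun z => (f z)^-1) (- (f z)^-1 ^+ 2 * a).
Proof.
move=> f0; apply: (@der_comp z v (fun x => x^-1)).
apply: DeriveDef; first by apply: derivableV.
by rewrite deriveV// derive_id /GRing.scale/= mulr1 exprVn.
Qed.

Lemma der_smooth (U : set V) z v f : smooth U f -> U z -> der z v f ('D_v f z).
Proof. by move=> sf Uz; split=> //; exact: smooth_diff sf Uz. Qed.

Lemma der_ext z v f g a b : (\near z, f z = g z) -> der z v f a -> der z v g b -> a = b.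
Proof. by move=> fg [_ <-] [_ <-]; exact: near_eq_derive. Qed.

Lemma der_uniq z v f a b : der z v f a -> der z v f b -> a = b.
Proof. by move=> [_ <-] [_ <-]. Qed.

End DirectionalDerivative.

(** * Coordinates and symplectomorphisms *)

Section Coordinates.
Context {R : realType}.
Notation R4 := 'rV[R]_(2 + 2).

Definition X1 (z : R4) : R := lsubmx z 0 0.
Definition X2 (z : R4) : R := lsubmx z 0 1.
Definition Y1 (z : R4) : R := rsubmx z 0 0.
Definition Y2 (z : R4) : R := rsubmx z 0 1.
Definition mk (a b c d : R) : R4 := row_mx (pt a b) (pt c d).

Lemma X1_mk a b c d : X1 (mk a b c d) = a. Proof. by rewrite /X1 row_mxKl !mxE. Qed.
Lemma X2_mk a b c d : X2 (mk a b c d) = b. Proof. by rewrite /X2 row_mxKl !mxE. Qed.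
Lemma Y1_mk a b c d : Y1 (mk a b c d) = c. Proof. by rewrite /Y1 row_mxKr !mxE. Qed.
Lemma Y2_mk a b c d : Y2 (mk a b c d) = d. Proof. by rewrite /Y2 row_mxKr !mxE. Qed.
Definition mkE := (X1_mk, X2_mk, Y1_mk, Y2_mk).

Lemma ptE (p : 'rV[R]_2) : p = pt (p 0 0) (p 0 1).
Proof.
apply/rowP => i; rewrite !mxE.
by case: i => [[|[|//]] Hi] /=; congr (p _ _); apply: val_inj.
Qed.

Lemma mk_eta z : mk (X1 z) (X2 z) (Y1 z) (Y2 z) = z.
Proof. by rewrite /mk /X1 /X2 /Y1 /Y2 -!ptE hsubmxK. Qed.

Lemma mk_ext z w : X1 z = X1 w -> X2 z = X2 w -> Y1 z = Y1 w -> Y2 z = Y2 w -> z = w.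
Proof. by move=> e1 e2 e3 e4; rewrite -(mk_eta z) -(mk_eta w) e1 e2 e3 e4. Qed.

Lemma omegaE u v : omega u v =
  X1 u * Y1 v - Y1 u * X1 v + (X2 u * Y2 v - Y2 u * X2 v) :> R.
Proof.
rewrite /omega !big_ord_recl big_ord0 addr0.
by have -> : lift ord0 ord0 = 1 :> 'I_2 by exact: val_inj.
Qed.

Lemma coordE (z : R4) (j : 'I_(2 + 2)) :
  [\/ z 0 j = X1 z /\ j = lshift 2 0, z 0 j = X2 z /\ j = lshift 2 1,
      z 0 j = Y1 z /\ j = rshift 2 0 | z 0 j = Y2 z /\ j = rshift 2 1].
Proof.
rewrite /X1 /X2 /Y1 /Y2 !mxE.
case: (split_ordP j) => k -> {j}.
  have [->|->] : k = 0 \/ k = 1.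
    by case: k => [[|[|//]] Hi]; [left|right]; apply: val_inj.
  - by constructor 1.
  - by constructor 2.
have [->|->] : k = 0 \/ k = 1.
  by case: k => [[|[|//]] Hi]; [left|right]; apply: val_inj.
- by constructor 3.
- by constructor 4.
Qed.

Lemma smooth_coord (U : set R4) j : smooth U (fun z => z 0 j).
Proof.
have @f : {linear R4 -> R}.
  by exists (fun N : 'rV[R]_(2 + 2) => N 0 j); do 2![eexists]; do ?[constructor];
     rewrite ?mxE// => ? *; rewrite ?mxE//; move=> ?; rewrite !mxE.
exact: (@smooth_lin R _ U f (@coord_continuous _ _ _ _ _)).
Qed.

Lemma X1E : X1 = (fun z => z 0 (lshift 2 0)). Proof. by rewrite funeqE => z; rewrite /X1 mxE. Qed.
Lemma X2E : X2 = (fun z => z 0 (lshift 2 1)). Proof. by rewrite funeqE => z; rewrite /X2 mxE. Qed.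
Lemma Y1E : Y1 = (fun z => z 0 (rshift 2 0)). Proof. by rewrite funeqE => z; rewrite /Y1 mxE. Qed.
Lemma Y2E : Y2 = (fun z => z 0 (rshift 2 1)). Proof. by rewrite funeqE => z; rewrite /Y2 mxE. Qed.

Lemma smooth_X1 U : smooth U X1. Proof. rewrite X1E; exact: smooth_coord. Qed.
Lemma smooth_X2 U : smooth U X2. Proof. rewrite X2E; exact: smooth_coord. Qed.
Lemma smooth_Y1 U : smooth U Y1. Proof. rewrite Y1E; exact: smooth_coord. Qed.
Lemma smooth_Y2 U : smooth U Y2. Proof. rewrite Y2E; exact: smooth_coord. Qed.

Lemma derive_coord (z v : R4) j : 'D_v (fun z : R4 => z 0 j) z = v 0 j.
Proof.
have d : derivable (id : R4 -> R4) z v by exact: derivable_id.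
by have := derive_mx d; rewrite derive_id => /(congr1 (fun M : R4 => M 0 j)); rewrite mxE => <-.
Qed.

Lemma smooth_mk (U : set R4) (f1 f2 g1 g2 : R4 -> R) :
  smooth U f1 -> smooth U f2 -> smooth U g1 -> smooth U g2 ->
  smooth_rV U (fun z => mk (f1 z) (f2 z) (g1 z) (g2 z)).
Proof.
move=> s1 s2 s3 s4 j.
suff H f : smooth U f -> (forall z, mk (f1 z) (f2 z) (g1 z) (g2 z) 0 j = f z) ->
    smooth U (fun z => mk (f1 z) (f2 z) (g1 z) (g2 z) 0 j).
  have [[_ jE]|[_ jE]|[_ jE]|[_ jE]] := coordE 0 j.
  - by apply: (H _ s1) => z; rewrite jE -[LHS](congr1 (@^~ _) X1E) X1_mk.
  - by apply: (H _ s2) => z; rewrite jE -[LHS](congr1 (@^~ _) X2E) X2_mk.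
  - by apply: (H _ s3) => z; rewrite jE -[LHS](congr1 (@^~ _) Y1E) Y1_mk.
  - by apply: (H _ s4) => z; rewrite jE -[LHS](congr1 (@^~ _) Y2E) Y2_mk.
by move=> sf E; rewrite (_ : (fun z => _) = f)// funeqE.
Qed.

Implicit Types (z v : R4) (f g : R4 -> R) (a b : R).

Lemma derX1 z v : der z v X1 (X1 v).
Proof.
by split; [exact: smooth_diff (@smooth_X1 setT) _|rewrite X1E derive_coord].
Qed.
Lemma derX2 z v : der z v X2 (X2 v).
Proof.
by split; [exact: smooth_diff (@smooth_X2 setT) _|rewrite X2E derive_coord].
Qed.
Lemma derY1 z v : der z v Y1 (Y1 v).
Proof.
by split; [exact: smooth_diff (@smooth_Y1 setT) _|rewrite Y1E derive_coord].
Qed.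
Lemma derY2 z v : der z v Y2 (Y2 v).
Proof.
by split; [exact: smooth_diff (@smooth_Y2 setT) _|rewrite Y2E derive_coord].
Qed.

Lemma derive_mk z v f1 f2 g1 g2 a b c d :
  der z v f1 a -> der z v f2 b -> der z v g1 c -> der z v g2 d ->
  'D_v (fun z => mk (f1 z) (f2 z) (g1 z) (g2 z)) z = mk a b c d.
Proof.
set F := fun z => _.
move=> [d1 <-] [d2 <-] [d3 <-] [d4 <-].
have e1 : (fun z => F z 0 (lshift 2 0)) = f1.
  by rewrite funeqE => w; rewrite -[LHS](congr1 (@^~ _) X1E) X1_mk.
have e2 : (fun z => F z 0 (lshift 2 1)) = f2.
  by rewrite funeqE => w; rewrite -[LHS](congr1 (@^~ _) X2E) X2_mk.
have e3 : (fun z => F z 0 (rshift 2 0)) = g1.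
  by rewrite funeqE => w; rewrite -[LHS](congr1 (@^~ _) Y1E) Y1_mk.
have e4 : (fun z => F z 0 (rshift 2 1)) = g2.
  by rewrite funeqE => w; rewrite -[LHS](congr1 (@^~ _) Y2E) Y2_mk.
rewrite derive_rV; last first.
  by move=> j; have [[_ ->]|[_ ->]|[_ ->]|[_ ->]] := coordE 0 j; rewrite ?e1 ?e2 ?e3 ?e4.
by apply: mk_ext; rewrite mkE /X1 /X2 /Y1 /Y2 !mxE ?e1 ?e2 ?e3 ?e4.
Qed.

End Coordinates.

Section Symplectic.
Context {R : realType}.
Notation R4 := 'rV[R]_(2 + 2).

(** The inverse belongs to the data, so that restriction, gluing and passage to a limit treat both
    directions alike; that it is symplectic as well is [sympl_pair_sym]. *)
Definition sympl_pair (U V : set R4) (f g : R4 -> R4) :=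
  [/\ forall x, U x -> V (f x) /\ g (f x) = x,
      forall y, V y -> U (g y) /\ f (g y) = y,
      smooth_rV U f, smooth_rV V g &
      forall x, U x -> forall u v, omega ('D_u f x) ('D_v f x) = omega u v].

Definition symp (U V : set R4) := [/\ open U, open V & exists f g, sympl_pair U V f g].

Lemma symp_symplectomorphic U V : symp U V -> symplectomorphic U V.
Proof.
move=> [oU oV [f [g [fg gf sf sg om]]]]; exists f, g.
split; first exact: fg.
split; first exact: gf.
split; first exact: smooth_rV_on.
by split; first exact: smooth_rV_on.
Qed.

Lemma derive_comp_vec (U V : set R4) (f g : R4 -> R4) x u :
  smooth_rV U f -> smooth_rV V g -> U x -> V (f x) ->
  'D_u (g \o f) x = 'D_('D_u f x) g (f x).
Proof.
move=> sf sg Ux Vfx; have df := smooth_rV_diff sf Ux; have dg := smooth_rV_diff sg Vfx.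
have dc : differentiable (g \o f) x by exact: differentiable_comp.
by rewrite (deriveE u dc) (diff_comp df dg) [RHS](deriveE _ dg) (deriveE u df).
Qed.

Lemma sympl_pair_sym U V f g : open U -> open V -> sympl_pair U V f g -> sympl_pair V U g f.
Proof.
move=> oU oV [fg gf sf sg om]; split=> // y Vy u v.
have [Ugy fgy] := gf y Vy.
have H w : 'D_('D_w g y) f (g y) = w.
  rewrite -(derive_comp_vec w sg sf)// -[RHS](derive_id y w).
  apply: near_eq_derive; apply: filterS (open_nbhs_nbhs (conj oV Vy)) => t Vt.
  by rewrite /= (gf t Vt).2.
by rewrite -(om (g y) Ugy) !H.
Qed.

Lemma smooth_rV_comp (U V : set R4) (f g : R4 -> R4) : open U ->
  (forall x, U x -> V (f x)) -> smooth_rV U f -> smooth_rV V g -> smooth_rV U (g \o f).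
Proof. by move=> oU UV sf sg j; exact: (smooth_comp_rV oU UV (sg j) sf). Qed.

Lemma sympl_pair_trans U V W f g f' g' : open U -> open W ->
  sympl_pair U V f g -> sympl_pair V W f' g' -> sympl_pair U W (f' \o f) (g \o g').
Proof.
move=> oU oW [fg gf sf sg om] [fg' gf' sf' sg' om']; split.
- by move=> x /fg[/fg'[Wx ffx] fx]; rewrite /= ffx.
- by move=> y /gf'[/gf[Uy ggy] gy]; rewrite /= ggy.
- by apply: (smooth_rV_comp oU _ sf sf') => x /fg[].
- by apply: (smooth_rV_comp oW _ sg' sg) => x /gf'[].
- move=> x Ux u v; have [Vfx _] := fg x Ux.
  by rewrite !(derive_comp_vec _ sf sf')// om' ?om.
Qed.

Lemma symp_sym U V : symp U V -> symp V U.
Proof.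
by move=> [oU oV [f [g fg]]]; split=> //; exists g, f; exact: sympl_pair_sym.
Qed.

Lemma symp_trans V U W : symp U V -> symp V W -> symp U W.
Proof.
move=> [oU oV [f [g fg]]] [_ oW [f' [g' fg']]]; split=> //.
by exists (f' \o f), (g \o g'); exact: (sympl_pair_trans oU oW fg fg').
Qed.

Lemma sympl_pair_id U : sympl_pair U U id id.
Proof.
split=> //; [by move=> j; exact: smooth_coord..|].
by move=> x _ u v; rewrite !derive_id.
Qed.

Lemma symp_refl U : open U -> symp U U.
Proof. by move=> oU; split=> //; exists id, id; exact: sympl_pair_id. Qed.

Lemma sympl_pair_ext U V f g f' g' : open U -> open V ->
  (forall x, U x -> f x = f' x) -> (forall y, V y -> g y = g' y) ->
  sympl_pair U V f g -> sympl_pair U V f' g'.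
Proof.
move=> oU oV ff gg [fg gf sf sg om]; split.
- by move=> x Ux; have [Vx gx] := fg x Ux; rewrite -ff// -gg.
- by move=> y Vy; have [Uy fy] := gf y Vy; rewrite -gg// -ff.
- by move=> j; apply: (smooth_ext oU _ (sf j)) => x Ux; rewrite ff.
- by move=> j; apply: (smooth_ext oV _ (sg j)) => x Ux; rewrite gg.
- move=> x Ux u v; rewrite -(om x Ux u v).
  have E : \near x, f' x = f x.
    by apply: filterS (open_nbhs_nbhs (conj oU Ux)) => t /ff.
  by rewrite !(near_eq_derive _ E).
Qed.

Lemma sympl_pair_sub U V f g (U' V' : set R4) :
  sympl_pair U V f g -> U' `<=` U -> V' `<=` V ->
  (forall x, U' x -> V' (f x)) -> (forall y, V' y -> U' (g y)) ->
  sympl_pair U' V' f g.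
Proof.
move=> [fg gf sf sg om] UU VV fU gV; split.
- by move=> x Ux; split; [exact: fU|exact: (fg x (UU _ Ux)).2].
- by move=> y Vy; split; [exact: gV|exact: (gf y (VV _ Vy)).2].
- by move=> j; exact: smooth_sub (sf j).
- by move=> j; exact: smooth_sub (sg j).
- by move=> x /UU Ux; exact: om.
Qed.

End Symplectic.


(** * Removing slits *)

Section Swallow.
Context {R : realType}.
Notation R4 := 'rV[R]_(2 + 2).

Definition exhaust (M : set R4) (n : nat) : set R4 :=
  [set z | `|z| <= n%:R /\ forall w, ~ M w -> n.+1%:R^-1 <= `|z - w|].

Lemma exhaust_sub M n : exhaust M n `<=` M.
Proof.
move=> z [_ H]; apply: contrapT => /H; rewrite subrr normr0 leNgt invr_gt0.
by rewrite ltr0n.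
Qed.

Lemma exhaust_compact M n : compact (exhaust M n).
Proof.
apply: bounded_closed_compact.
  exists n%:R; split => // x nx z [zn _].
  exact: le_trans zn (ltW nx).
rewrite (_ : exhaust M n = [set z | `|z| <= n%:R] `&`
    \bigcap_(w in ~` M) [set z | n.+1%:R^-1 <= `|z - w|]); last first.
  by apply/seteqP; split=> z [].
apply: closedI.
  apply: (@closed_comp _ _ (fun z : R4 => `|z|) [set x : R | x <= n%:R]).
    by move=> z _; exact: norm_continuous.
  exact: closed_le.
apply: closed_bigI => w _.
apply: (@closed_comp _ _ (fun z : R4 => `|z - w|) [set x : R | n.+1%:R^-1 <= x]).
  move=> z _; apply: (@continuous_comp R4 R4 R (fun z => z - w) (fun z => `|z|) z).
    by apply: (@cvgB _ R4 _ (nbhs z) _ id (fun=> w)); [exact: cvg_id|exact: cvg_cst].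
  exact: norm_continuous.
exact: closed_ge.
Qed.

Lemma exhaust_nbhs M z : open M -> M z -> exists n, nbhs z (exhaust M n).
Proof.
move=> oM Mz; have /nbhs_ballP[e /= e0 eM] := open_nbhs_nbhs (conj oM Mz).
pose C := `|z| + 1 + (e / 2)^-1.
have C0 : 0 <= C by rewrite !addr_ge0// invr_ge0 divr_ge0// ltW.
exists (Num.truncn C).+1.
have nC : C < (Num.truncn C).+1%:R by rewrite truncnS_gt.
set n := (Num.truncn C).+1 in nC *.
have e20 : 0 < (e / 2)^-1 by rewrite invr_gt0 divr_gt0.
have nz := normr_ge0 z.
apply/nbhs_ballP; exists (Num.min 1 (e / 2)) => /=.
  by rewrite lt_min ltr01 divr_gt0.
move=> y; rewrite -ball_normE/= lt_min => /andP[y1 y2]; split.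
  rewrite -(subrK z y) (le_trans (ler_normD _ _))//.
  rewrite distrC (le_trans (lerD (ltW y1) (lexx _)))//.
  by move: nC; rewrite /C; lra.
move=> w nMw; have ew : e <= `|z - w|.
  rewrite leNgt; apply/negP => H; apply: nMw; apply: eM.
  by rewrite -ball_normE.
have : `|z - w| <= `|z - y| + `|y - w|.
  by rewrite (le_trans _ (ler_normD _ _))// addrA subrK.
have : n.+1%:R^-1 <= e / 2.
  rewrite -[leRHS]invrK lef_pV2 ?posrE ?ltr0n//.
  by rewrite (le_trans _ (ltW (lt_trans nC _)))// ?ltr_nat// /C lerDr addr_ge0.
by move=> ne tri; apply: le_trans ne _; move: y2 ew tri; set p := `|z - y|; set q := `|y - w|; set r := `|z - w|; move=> y2 ew tri; lra.
Qed.

(* The maps [F_n : M -> M] stabilize on an exhaustion of [N], and their inverses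
   on an exhaustion of [M], so that the limit maps [N] onto [M]. *)
Lemma swallow (M N : set R4) : open M -> open N -> N `<=` M ->
  (forall K L : set R4, compact K -> compact L -> K `<=` M -> L `<=` N ->
     exists P P', [/\ sympl_pair M M P P', forall x, L x -> P x = x &
                      forall y, K y -> N (P' y)]) ->
  symp N M.
Proof.
move=> oM oN NM H; split=> //.
pose st := ((R4 -> R4) * (R4 -> R4) * set R4)%type.
pose inv (s : st) := [/\ sympl_pair M M s.1.1 s.1.2, compact s.2 & s.2 `<=` N].
pose rel (n : nat) (s t : st) := [/\ forall x, s.2 x -> t.1.1 x = s.1.1 x,
  s.2 `<=` t.2, exhaust N n `<=` t.2 &
  forall y, exhaust M n y -> t.2 (t.1.2 y)].
have stepP (ns : nat * st) : exists t, inv ns.2 -> inv t /\ rel ns.1 ns.2 t.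
  case: ns => n s; have [/= iv|ni] := pselect (inv s); last by exists s => /ni.
  move: iv (iv) => [sp cL LN] iv.
  have [fg gf sf sg om] := sp.
  have cM : {in exhaust M n, continuous s.1.2}.
    move=> y /set_mem/exhaust_sub My.
    by apply: differentiable_continuous; exact: smooth_rV_diff sg My.
  have cimg (h : R4 -> R4) (A : set R4) : compact A -> A `<=` M -> smooth_rV M h ->
      compact (h @` A).
    move=> cA AM sh; apply: continuous_compact => //.
    apply: continuous_in_subspaceT => y /set_mem /AM My.
    by apply: differentiable_continuous; exact: smooth_rV_diff sh My.
  have cK := cimg _ _ (@exhaust_compact M n) (@exhaust_sub M n) sg.
  have KM : s.1.2 @` exhaust M n `<=` M by move=> _ [y /exhaust_sub/gf[My _] <-].
  have [P [P' [PP PL PK]]] := H _ _ cK cL KM LN.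
  have [Pfg Pgf sP sP' Pom] := PP.
  (* [P] acts before the old map and fixes the old compact set, where the composite is therefore
     unchanged. [P'] brings the old preimage of [exhaust M n] into [N]; this new preimage joins the
     compact set and stays frozen from then on. *)
  exists (s.1.1 \o P, P' \o s.1.2, s.2 `|` exhaust N n `|` P' @` (s.1.2 @` exhaust M n)).
  move=> _; split; last first.
    split=> /=.
    - by move=> x /PL ->.
    - by move=> x ?; left; left.
    - by move=> x ?; left; right.
    - by move=> y ?; right; exists (s.1.2 y) => //; exists y.
  split=> /=; first exact: sympl_pair_trans PP sp.
    apply: compactU; first by apply: compactU => //; exact: exhaust_compact.
    exact: cimg sP'.
  by move=> x [[/LN//|/exhaust_sub//]|[y /PK Ny <-]].
have [nxt nxtP] := choice stepP.
pose s := fix s n := if n is m.+1 then nxt (m, s m) else (id, id, set0) : st.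
have invs n : inv (s n).
  elim: n => [|n /(nxtP (n, s n))[]//].
  by split=> //=; [exact: sympl_pair_id|exact: compact0].
have rs n : rel n (s n) (s n.+1) by have [_] := nxtP (n, s n) (invs n).
have Lmono m n : (m <= n)%N -> (s m).2 `<=` (s n).2.
  move=> mn; rewrite -(subnK mn); elim: (n - m)%N => // k IH x /IH.
  by have [_ + _ _] := rs (k + m)%N; exact.
have Fstab m n x : (m <= n)%N -> (s m).2 x -> (s n).1.1 x = (s m).1.1 x.
  move=> mn Lx; rewrite -(subnK mn); elim: (n - m)%N => // k IH.
  have [E _ _ _] := rs (k + m)%N; transitivity ((s (k + m)%N).1.1 x) => //.
  by apply: E; apply: Lmono Lx; exact: leq_addl.
have Gstab m n y : (m <= n)%N -> M y -> (s m).2 ((s m).1.2 y) ->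
    (s n).1.2 y = (s m).1.2 y.
  move=> mn My Ly.
  have [[_ gf _ _ _] _ LN] := invs m; have [Mg fgy] := gf y My.
  have [[fgn _ _ _ _] _ _] := invs n.
  by rewrite -{1}fgy -(Fstab _ _ _ mn Ly) (fgn _ Mg).2.
(* By stability every index whose compact set contains [x] gives the same value, so the choice is
   immaterial. *)
pose k x := xget 0%N [set n | (s n).2 x].
pose F x := (s (k x)).1.1 x.
have FE n x : (s n).2 x -> F x = (s n).1.1 x.
  move=> Lx; have Lk : (s (k x)).2 x by exact: (xgetPex 0%N (ex_intro [set n | (s n).2 x] n Lx)).
  rewrite /F; have [kn|nk] := leqP (k x) n; first by rewrite (Fstab _ _ _ kn Lk).
  by rewrite (Fstab _ _ _ (ltnW nk) Lx).
pose l y := xget 0%N [set n | (s n).2 ((s n).1.2 y)].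
pose G y := (s (l y)).1.2 y.
have GE n y : M y -> (s n).2 ((s n).1.2 y) -> G y = (s n).1.2 y.
  move=> My Ly; have Lk : (s (l y)).2 ((s (l y)).1.2 y).
    exact: (xgetPex 0%N (ex_intro [set n | (s n).2 ((s n).1.2 y)] n Ly)).
  rewrite /G; have [kn|nk] := leqP (l y) n; first by rewrite (Gstab _ _ _ kn My Lk).
  by rewrite (Gstab _ _ _ (ltnW nk) My Ly).
have inL x : N x -> exists n, nbhs x (s n).2.
  move=> Nx; have [n nx] := exhaust_nbhs oN Nx; exists n.+1.
  by apply: filterS nx; have [_ _ + _] := rs n.
have inG y : M y -> exists n, nbhs y [set y | M y /\ (s n).2 ((s n).1.2 y)].
  move=> My; have [n ny] := exhaust_nbhs oM My; exists n.+1.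
  apply: filterS ny => t Et; split; first exact: exhaust_sub Et.
  by have [_ _ _] := rs n; apply.
exists F, G; split.
- move=> x Nx; have [n /nbhs_singleton Lx] := inL x Nx.
  rewrite (FE n x Lx); have [[fg _ _ _ _] _ LN] := invs n.
  have [Mf gfx] := fg x (NM _ Nx); split=> //.
  by rewrite (GE n)// gfx.
- move=> y My; have [n /nbhs_singleton[_ Ly]] := inG y My.
  rewrite (GE n y My Ly); have [[_ gf _ _ _] _ LN] := invs n.
  have [Mf gfx] := gf y My; split; first exact: LN.
  by rewrite (FE n).
- move=> j; apply: smooth_local => x Nx; have [n nx] := inL x Nx.
  exists (interior (s n).2 `&` M); first by split=> //; exact: NM.
  have [[_ _ sf _ _] _ _] := invs n.
  have oI : open (interior (s n).2 `&` M) by apply: openI => //; exact: open_interior.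
  apply: (smooth_ext oI _ (smooth_sub _ (sf j))); last by move=> t [].
  by move=> t [/interior_subset Lt _]; rewrite (FE n).
- move=> j; apply: smooth_local => y My; have [n ny] := inG y My.
  set B := [set y | _] in ny.
  exists (interior B `&` M); first by [].
  have [[_ _ _ sg _] _ _] := invs n.
  have oI : open (interior B `&` M) by apply: openI => //; exact: open_interior.
  apply: (smooth_ext oI _ (smooth_sub _ (sg j))); last by move=> t [].
  by move=> t [/interior_subset[Mt Lt] _]; rewrite (GE n).
- move=> x Nx u v; have [n nx] := inL x Nx.
  have [[_ _ _ _ om] _ _] := invs n.
  have E : \near x, F x = (s n).1.1 x by apply: filterS nx => t; exact: FE.
  by rewrite !(near_eq_derive _ E) om//; exact: NM.
Qed.

End Swallow.


(** * Perturbations of the identity of the line *)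

Section OneVariable.
Context {R : realType}.

Lemma strict_incr (h dh : R -> R) (s t : R) : s < t ->
  (forall x : R, s <= x <= t -> is_derive x 1 h (dh x)) ->
  (forall x, s < x < t -> 0 < dh x) -> h s < h t.
Proof.
move=> st dhE dh0.
have [x xst E] : exists2 c, c \in `]s, t[ & h t - h s = dh c * (t - s).
  apply: MVT => //.
    by move=> x; rewrite in_itv/= => /andP[/ltW sx /ltW xt]; apply: dhE; rewrite sx.
  apply: derivable_within_continuous => x; rewrite in_itv/= => xst.
  exact: (@ex_derive _ _ _ _ _ _ _ (dhE x xst)).
rewrite -subr_gt0 E mulr_gt0 ?subr_gt0//; apply: dh0; move: xst; rewrite in_itv/=.
by [].
Qed.

Lemma is_derive_smooth (U : set R) (h : R -> R) x : smooth U h -> U x -> is_derive x 1 h ('D_1 h x).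
Proof. by move=> sh Ux; apply: DeriveDef => //; exact: smooth_derivable sh Ux. Qed.

Lemma perturb_incr (k : R -> R) a : smooth setT k ->
  (forall s, `|a * 'D_1 k s| <= 1 / 2) ->
  forall s t, s < t -> s + a * k s < t + a * k t.
Proof.
move=> sk ak s t st.
apply: (strict_incr (h := fun s => s + a * k s) (dh := fun s => 1 + a * 'D_1 k s)) => //.
  move=> x _; have dk := is_derive_smooth sk (I : setT x).
  have := is_deriveD (is_derive_id x 1) (is_deriveZ a dk).
  exact.
by move=> x _; have := ak x; rewrite ler_norml => /andP[? _]; lra.
Qed.

Lemma perturb_solve (k : R -> R) a b C : smooth setT k -> (forall s, `|k s| <= C) ->
  exists s, s + a * k s = b.
Proof.
move=> sk kC; pose d := `|a| * C.
have ak s : `|a * k s| <= d by rewrite normrM ler_wpM2l.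
have d0 : 0 <= d by rewrite (le_trans _ (ak 0)).
have [|||c _ cE] := @IVT R (fun s => s + a * k s) (b - d) (b + d) b.
- by lra.
- apply: continuous_subspaceT => x.
  refine (@smooth_continuous R _ setT (fun s => s + a * k s) x _ I).
  exact: (smoothD openT (@smooth_id R setT)
    (smoothM openT (smooth_cst setT a) sk)).
- rewrite ge_min le_max.
  have := ak (b - d); have := ak (b + d); rewrite !ler_norml => /andP[u1 _] /andP[_ u2].
  by apply/andP; split; apply/orP; [left|right]; lra.
by exists c.
Qed.

Lemma derive_snd (V : normedModType R) (F : V * R -> R) z s :
  'D_((0, 1) : V * R) F (z, s) = 'D_1 (fun t => F (z, t)) s.
Proof.
have E : (fun h : R => h^-1 *: (F (h *: ((0, 1) : V * R) + (z, s)) - F (z, s))) =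
    (fun h : R => h^-1 *: (F (z, h *: 1 + s) - F (z, s))).
  rewrite funeqE => h; congr (_ *: (F _ - _)).
  by apply/pair_equal_spec; split=> //=; rewrite scaler0 add0r.
by rewrite /derive /= E.
Qed.

(** For smooth bounded [k] a root exists, so the default of [xget] is not resorted to; the bound
    [1 / 2] on [a * 'D_1 k] in the lemmas below makes the root unique and smooth in the
    parameters. *)
Definition psol (k : R -> R) (ab : R * R) : R := xget 0 [set s | s + ab.1 * k s = ab.2].

Lemma psolE (k : R -> R) a b C : smooth setT k -> (forall s, `|k s| <= C) ->
  psol k (a, b) + a * k (psol k (a, b)) = b.
Proof.
by move=> sk kC; exact: (xgetPex 0 (@perturb_solve k a b C sk kC)).
Qed.

Lemma psol_uniq (k : R -> R) a b s C : smooth setT k -> (forall s, `|k s| <= C) ->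
  (forall s, `|a * 'D_1 k s| <= 1 / 2) -> s + a * k s = b -> psol k (a, b) = s.
Proof.
move=> sk kC ak sE; have E := psolE a b sk kC.
by have [/(perturb_incr sk ak)|/(perturb_incr sk ak)|//] := ltgtP (psol k (a, b)) s;
  rewrite E sE ltxx.
Qed.

Lemma smooth_psol (V : normedModType R) (U : set V) (k : R -> R) (a b : V -> R) C :
  open U -> smooth setT k -> (forall s, `|k s| <= C) ->
  smooth U a -> smooth U b ->
  (forall z s, U z -> `|a z * 'D_1 k s| <= 1 / 2) ->
  smooth U (fun z => psol k (a z, b z)).
Proof.
move=> oU sk kC sa sb ak; pose F (q : V * R) := q.2 + a q.1 * k q.2 - b q.1.
have oW : open [set q : V * R | U q.1 /\ setT q.2].
  exact: openI (open_comp (fun q _ => cvg_fst) oU) (open_comp (fun q _ => cvg_snd) openT).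
have sF : smooth [set q : V * R | U q.1 /\ setT q.2] F.
  apply: smoothB => //; last by apply: (smooth_fst oW _ sb) => q [].
  apply: smoothD => //; first exact: smooth_snd.
  apply: smoothM => //; first by apply: (smooth_fst oW _ sa) => q [].
  by apply: (smooth_comp1 oW _ sk (@smooth_snd R V _)).
apply: (smooth_implicit oU openT sF) => //.
- by move=> z Uz; rewrite /F/= (psolE _ _ sk kC) subrr.
- move=> z s t Uz _ _ st; rewrite /F/= ltrD2r; apply: perturb_incr => // u; exact: ak.
- move=> z Uz; set s := psol _ _.
  have H : is_derive s 1 (fun t => F (z, t)) (1 + a z * 'D_1 k s).
    have dk := is_derive_smooth sk (I : setT s).
    have := is_deriveB (is_deriveD (is_derive_id s 1) (is_deriveZ (a z) dk)) (is_derive_cst (b z) s 1).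
    by rewrite subr0.
  rewrite derive_snd (@derive_val _ _ _ _ _ _ _ H).
  by have := ak z s Uz; rewrite ler_norml => /andP[? _]; lra.
Qed.

End OneVariable.


Lemma smooth_fun {R : realType} (V : normedModType R) (U : set V) (h : R -> R) (f : V -> R) :
  open U -> smooth setT h -> smooth U f -> smooth U (fun z => h (f z)).
Proof. by move=> oU sh sf; exact: (smooth_comp1 oU _ sh sf). Qed.

Lemma smooth_derive1 {R : realType} (h : R -> R) : smooth setT h -> smooth setT ('D_1 h).
Proof. by move=> sh; exact: smooth_derive. Qed.

Lemma der_eq {R : realType} (z v : 'rV[R]_(2 + 2)) f g a b :
  f =1 g -> der z v f a -> der z v g b -> a = b.
Proof. by move=> /funext -> df dg; exact: der_uniq df dg. Qed.

(** Smoothness by the shape of the term: each clause strips the outermost operation, and the last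
    two use smoothness hypotheses on one-variable functions in the context. *)
Ltac smo := first
  [ assumption | exact: openT | exact: smooth_cst
  | exact: smooth_X1 | exact: smooth_X2 | exact: smooth_Y1 | exact: smooth_Y2
  | exact: smooth_id
  | apply: smoothD; smo | apply: smoothB; smo | apply: smoothN; smo
  | apply: smoothX; smo | apply: smoothM; smo
  | apply: (smooth_fun _ (@smooth_sin _ setT)); smo
  | apply: (smooth_fun _ (@smooth_cos _ setT)); smo
  | match goal with H : smooth setT ?h |- smooth _ (fun z => ?h _) =>
      apply: (smooth_fun _ H); smo end
  | match goal with H : smooth setT ?h |- smooth _ (fun z => 'D_1 ?h _) =>
      apply: (smooth_fun _ (smooth_derive1 H)); smo end ].

(** * Pushing along a slit *)

Section Rotation.
Context {R : realType}.

(** Rotating [(a, b)] by an angle with differential [f] adds [(a da + b db) /\ f] to [da /\ db],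
    which is half of [ds /\ f] for [s = a^2 + b^2]. *)
Lemma rot_form (C S a b au bu av bv fu fv : R) : C ^+ 2 + S ^+ 2 = 1 ->
  (C * au - S * bu - (a * S + b * C) * fu) * (S * av + C * bv + (a * C - b * S) * fv) -
  (S * au + C * bu + (a * C - b * S) * fu) * (C * av - S * bv - (a * S + b * C) * fv) =
  au * bv - bu * av + ((a * au + b * bu) * fv - (a * av + b * bv) * fu).
Proof.
move=> CS; set rhs := RHS; rewrite -[RHS]mul1r -CS /rhs; ring.
Qed.

Lemma rot_norm (C S a b : R) : C ^+ 2 + S ^+ 2 = 1 ->
  (a * C - b * S) ^+ 2 + (a * S + b * C) ^+ 2 = a ^+ 2 + b ^+ 2.
Proof. by move=> CS; rewrite -[RHS]mul1r -CS; ring. Qed.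

End Rotation.

Section Push.
Context {R : realType}.
Notation R4 := 'rV[R]_(2 + 2).
Variables (q1 q2 : R) (f th be : R -> R) (Cf Ct : R).
Hypotheses (sf : smooth setT f) (sth : smooth setT th) (sbe : smooth setT be).
Hypotheses (fC : forall x, `|f x| <= Cf) (tC : forall x, `|th x| <= Ct).
Hypothesis small : forall s x y, `|be s * 'D_1 f x * 'D_1 th y| <= 1 / 2.

Let s (z : R4) := (X2 z - q1) ^+ 2 + (Y2 z - q2) ^+ 2.
Let c z := be (s z).
Let Xf z := psol f (c z * 'D_1 th (Y1 z), X1 z).
Let Yf z := Y1 z + c z * 'D_1 f (Xf z) * th (Y1 z).
Let ph z : R := 2 * 'D_1 be (s z) * (f (Xf z) * th (Y1 z)).
(* [push] is generated by [S(X, y) = X y + be(|p|^2) f(X) th(y)], [p] being the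
   second coordinate pair relative to [q]: here [x = dS/dy] and [Y = dS/dX],
   while [p] is rotated by the angle [2 be' f th]. *)
Definition push z :=
  mk (Xf z) (q1 + ((X2 z - q1) * cos (ph z) - (Y2 z - q2) * sin (ph z)))
     (Yf z) (q2 + ((X2 z - q1) * sin (ph z) + (Y2 z - q2) * cos (ph z))).

(** For the inverse, the generating function is symmetric under exchange of [(X, f)] and [(y, th)],
    so [(X, Y)] determines [y] by an equation of the same kind. *)
Let Yb z := psol th (c z * 'D_1 f (X1 z), Y1 z).
Let Xb z := X1 z + c z * 'D_1 th (Yb z) * f (X1 z).
Let phb z : R := 2 * 'D_1 be (s z) * (f (X1 z) * th (Yb z)).
Definition pushb z :=
  mk (Xb z) (q1 + ((X2 z - q1) * cos (phb z) + (Y2 z - q2) * sin (phb z)))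
     (Yb z) (q2 + (- ((X2 z - q1) * sin (phb z)) + (Y2 z - q2) * cos (phb z))).

Let XfE z : Xf z + c z * 'D_1 th (Y1 z) * f (Xf z) = X1 z.
Proof. exact: psolE fC. Qed.

Let YbE z : Yb z + c z * 'D_1 f (X1 z) * th (Yb z) = Y1 z.
Proof. exact: psolE tC. Qed.

Let Xf_uniq z t : t + c z * 'D_1 th (Y1 z) * f t = X1 z -> Xf z = t.
Proof.
apply: (@psol_uniq R f _ _ t Cf) => // x.
by rewrite mulrAC; exact: small.
Qed.

Let Yb_uniq z t : t + c z * 'D_1 f (X1 z) * th t = Y1 z -> Yb z = t.
Proof. by apply: (@psol_uniq R th _ _ t Ct) => // x; exact: small. Qed.

Let sXf : smooth setT Xf.
Proof.
apply: (smooth_psol openT sf fC) => [||z t _]; [by rewrite /c /s; smo|by smo|].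
by rewrite mulrAC; exact: small.
Qed.

Let sYb : smooth setT Yb.
Proof.
by apply: (smooth_psol openT sth tC) => [||z t _]; [rewrite /c /s; smo|smo|exact: small].
Qed.

Let s_push z : s (push z) = s z.
Proof.
rewrite /s /push !mkE ![q1 + _]addrC ![q2 + _]addrC !addrK; apply: rot_norm.
exact: cos2Dsin2.
Qed.

Let s_pushb z : s (pushb z) = s z.
Proof.
rewrite /s /pushb !mkE ![q1 + _]addrC ![q2 + _]addrC !addrK.
rewrite -[RHS](rot_norm (C := cos (phb z)) (S := - sin (phb z))); last first.
  by rewrite sqrrN cos2Dsin2.
by rewrite !mulrN opprK.
Qed.

Let pushK z : pushb (push z) = z.
Proof.
have cE : c (push z) = c z by rewrite /c s_push.
have yE : Yb (push z) = Y1 z by apply: Yb_uniq; rewrite cE /push !mkE.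
have xE : Xb (push z) = X1 z.
  have X1p : X1 (push z) = Xf z by rewrite /push mkE.
  by rewrite /Xb cE yE X1p XfE.
have pE : phb (push z) = ph z by rewrite /phb yE s_push /push mkE.
rewrite /pushb xE yE pE; apply: mk_ext; rewrite !mkE //.
- rewrite ![q1 + _]addrC ![q2 + _]addrC !addrK.
  have CS := cos2Dsin2 (ph z); set C := cos _ in CS *; set S := sin _ in CS *.
  rewrite -[RHS](subrK q1); congr (_ + _); rewrite -[RHS]mul1r -CS; ring.
- rewrite ![q1 + _]addrC ![q2 + _]addrC !addrK.
  have CS := cos2Dsin2 (ph z); set C := cos _ in CS *; set S := sin _ in CS *.
  rewrite -[RHS](subrK q2); congr (_ + _); rewrite -[RHS]mul1r -CS; ring.
Qed.

Let pushbK z : push (pushb z) = z.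
Proof.
have cE : c (pushb z) = c z by rewrite /c s_pushb.
have xE : Xf (pushb z) = X1 z by apply: Xf_uniq; rewrite cE /pushb !mkE.
have yE : Yf (pushb z) = Y1 z.
  by rewrite /Yf cE xE /pushb !mkE YbE.
have pE : ph (pushb z) = phb z by rewrite /ph xE s_pushb /pushb mkE.
rewrite /push xE yE pE; apply: mk_ext; rewrite !mkE //.
- rewrite ![q1 + _]addrC ![q2 + _]addrC !addrK.
  have CS := cos2Dsin2 (phb z); set C := cos _ in CS *; set S := sin _ in CS *.
  rewrite -[RHS](subrK q1); congr (_ + _); rewrite -[RHS]mul1r -CS; ring.
- rewrite ![q1 + _]addrC ![q2 + _]addrC !addrK.
  have CS := cos2Dsin2 (phb z); set C := cos _ in CS *; set S := sin _ in CS *.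
  rewrite -[RHS](subrK q2); congr (_ + _); rewrite -[RHS]mul1r -CS; ring.
Qed.

Let der_s z u : der z u s (2 * (X2 z - q1) * X2 u + 2 * (Y2 z - q2) * Y2 u).
Proof.
have := derD (der_sqr (derB (derX2 z u) (der_cst z u q1)))
  (der_sqr (derB (derY2 z u) (der_cst z u q2))).
by rewrite !subr0.
Qed.

Let dsm (h : R -> R) (x : R) : smooth setT h -> is_derive x 1 h ('D_1 h x).
Proof. by move=> sh; exact: is_derive_smooth sh I. Qed.

(** Because [c = be(s)] varies with the second plane, the first plane contributes the defect
    [- dc /\ d(f th)]. The rotation contributes [ds /\ d(be' f th)], which equals [dc /\ d(f th)]
    since the terms in [ds /\ ds] vanish. *)
Lemma push_sympl z u v : omega ('D_u push z) ('D_v push z) = omega u v.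
Proof.
pose e w := 2 * (X2 z - q1) * X2 w + 2 * (Y2 z - q2) * Y2 w.
pose B1 := 'D_1 be (s z).
have dc w : der z w c (B1 * e w) by apply: (der_comp (dsm _ sbe)); exact: der_s.
pose X w := 'D_w Xf z.
have dX w : der z w Xf (X w) by exact: der_smooth sXf I.
pose F0 := f (Xf z); pose F1 := 'D_1 f (Xf z); pose F2 := 'D_1 ('D_1 f) (Xf z).
pose T0 := th (Y1 z); pose T1 := 'D_1 th (Y1 z); pose T2 := 'D_1 ('D_1 th) (Y1 z).
have dT0 w : der z w (fun z => th (Y1 z)) (T1 * Y1 w) by apply: (der_comp (dsm _ sth)); exact: derY1.
have dT1 w : der z w (fun z => 'D_1 th (Y1 z)) (T2 * Y1 w).
  by apply: (der_comp (dsm _ (smooth_derive1 sth))); exact: derY1.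
have dF0 w : der z w (fun z => f (Xf z)) (F1 * X w) by apply: (der_comp (dsm _ sf)).
have dF1 w : der z w (fun z => 'D_1 f (Xf z)) (F2 * X w).
  by apply: (der_comp (dsm _ (smooth_derive1 sf))).
(* Differentiating the implicit equation expresses the old coordinate through the derivative of the
   new one, so no quotient enters the computation. *)
have Xeq w : X1 w = X w + (c z * T1 * (F1 * X w) + F0 * (c z * (T2 * Y1 w) + T1 * (B1 * e w))).
  apply: (der_eq _ (derX1 z w) (derD (dX w) (derM (derM (dc w) (dT1 w)) (dF0 w)))).
  by move=> t; rewrite XfE.
have dY w := derD (derY1 z w) (derM (derM (dc w) (dF1 w)) (dT0 w)).
have dB1 w : der z w (fun z => 'D_1 be (s z)) ('D_1 ('D_1 be) (s z) * e w).
  by apply: (der_comp (dsm _ (smooth_derive1 sbe))); exact: der_s.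
have dph w := derM (derM (der_cst z w 2) (dB1 w)) (derM (dF0 w) (dT0 w)).
have dcos w := der_comp (is_derive_cos (ph z)) (dph w).
have dsin w := der_comp (is_derive_sin (ph z)) (dph w).
have da w := derB (derX2 z w) (der_cst z w q1).
have db w := derB (derY2 z w) (der_cst z w q2).
have dX2 w := derD (der_cst z w q1) (derB (derM (da w) (dcos w)) (derM (db w) (dsin w))).
have dY2 w := derD (der_cst z w q2) (derD (derM (da w) (dsin w)) (derM (db w) (dcos w))).
rewrite (derive_mk (dX u) (dX2 u) (dY u) (dY2 u)) (derive_mk (dX v) (dX2 v) (dY v) (dY2 v)).
rewrite !omegaE !mkE (Xeq u) (Xeq v).
have := cos2Dsin2 (ph z).
set C := cos (ph z); set S := sin (ph z).
rewrite -/F0 -/F1 -/T0 -/T1 -/B1 !subr0 !add0r => CS.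
set B2 := 'D_1 ('D_1 be) (s z).
pose fw w := 2 * B1 * (F0 * (T1 * Y1 w) + T0 * (F1 * X w)) + F0 * T0 * (2 * (B2 * e w)).
have /eqP := rot_form (X2 z - q1) (Y2 z - q2) (X2 u) (Y2 u) (X2 v) (Y2 v) (fw u) (fw v) CS.
rewrite -subr_eq0 => /eqP rot.
apply: subr0_eq; rewrite -[RHS]rot /fw /e.
clear rot; clearbody F0 F1 F2 T0 T1 T2 B2 B1 C S X.
move: (c z) (X u) (X v) (X1 u) (X1 v) (X2 u) (X2 v) (Y1 u) (Y1 v)
  (Y2 u) (Y2 v) (X2 z) (Y2 z) => *; ring.
Qed.

Lemma push_pair : sympl_pair setT setT push pushb.
Proof.
split=> //; [| |by move=> x _ u v; exact: push_sympl].
- by apply: smooth_mk; rewrite /Yf /ph /c /s; smo.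
- by apply: smooth_mk; rewrite /Xb /phb /c /s; smo.
Qed.

(** On the slit [f] vanishes, so there is no rotation and [X] stays 0, while the slope 1 of [f]
    turns [c * th] into a pure gain of height. *)
Lemma push_slit z : f 0 = 0 -> 'D_1 f 0 = 1 -> X1 z = 0 ->
  push z = mk 0 (X2 z) (Y1 z + c z * th (Y1 z)) (Y2 z).
Proof.
move=> f0 f1 x0; have xE : Xf z = 0 by apply: Xf_uniq; rewrite f0 mulr0 addr0.
have pE : ph z = 0 by rewrite /ph xE f0 mul0r mulr0.
rewrite /push pE /Yf xE f1 cos0 sin0 !mulr1 !mulr0 subr0 add0r.
by rewrite ![_ + (_ - _)]addrC !subrK.
Qed.

Lemma push_id z :
  [\/ be (s z) = 0 /\ 'D_1 be (s z) = 0, th (Y1 z) = 0 /\ 'D_1 th (Y1 z) = 0 |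
      f (X1 z) = 0 /\ 'D_1 f (X1 z) = 0] -> push z = z.
Proof.
move=> H; have xE : Xf z = X1 z.
  by apply: Xf_uniq; rewrite /c; case: H => -[e1 e2]; rewrite ?e1 ?e2 ?mul0r ?mulr0 ?mul0r ?addr0.
have pE : ph z = 0.
  by rewrite /ph xE; case: H => -[e1 e2]; rewrite ?e1 ?e2 ?mul0r ?mulr0 ?mul0r ?mulr0.
have yE : Yf z = Y1 z.
  by rewrite /Yf xE /c; case: H => -[e1 e2]; rewrite ?e1 ?e2 ?mul0r ?mulr0 ?mul0r ?addr0.
rewrite /push pE xE yE cos0 sin0 !mulr1 !mulr0 subr0 add0r.
by rewrite ![_ + (_ - _)]addrC !subrK mk_eta.
Qed.

End Push.


Section Slit.
Context {R : realType}.
Notation R4 := 'rV[R]_(2 + 2).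

Lemma derive_zero_near (h : R -> R) (x : R) (W : set R) : open W -> W x ->
  (forall y, W y -> h y = 0) -> h x = 0 /\ 'D_1 h x = 0.
Proof.
move=> oW Wx hW; split; first exact: hW.
by apply: (@derive_flat_region _ _ 0); apply: filterS (open_nbhs_nbhs (conj oW Wx)).
Qed.

Lemma open_out (a b : R) : open [set x : R | x < a \/ b < x].
Proof.
rewrite (_ : [set x : R | x < a \/ b < x] = [set x | x < a] `|` [set x | b < x])//.
by apply: openU; [exact: open_lt|exact: open_gt].
Qed.

Lemma sympl_pair_iter (M : set R4) P P' n : open M -> sympl_pair M M P P' ->
  sympl_pair M M (iter n P) (iter n P').
Proof.
move=> oM PP; elim: n => [|n IH]; first exact: sympl_pair_id.
have -> : iter n.+1 P' = iter n P' \o P' by rewrite funeqE => z; rewrite iterSr.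
exact: sympl_pair_trans IH PP.
Qed.

(** The smallness condition limits what a single push can gain, but the gain is the same all along
    the inner part of the box; iteration carries the slit through a box of any length. *)
Lemma push_box (q1 q2 A B r : R) : 0 < r ->
  exists P P', [/\ sympl_pair (@setT R4) setT P P',
    forall z, ~ [/\ `|X1 z| < r, A < Y1 z < B &
                    (X2 z - q1) ^+ 2 + (Y2 z - q2) ^+ 2 < r ^+ 2] -> P z = z,
    forall z, X1 z = 0 -> [/\ X1 (P z) = 0, X2 (P z) = X2 z, Y2 (P z) = Y2 z &
                              Y1 z <= Y1 (P z)] &
    forall z, X1 z = 0 -> (X2 z - q1) ^+ 2 + (Y2 z - q2) ^+ 2 <= r ^+ 2 / 2 ->
      A + r <= Y1 z -> B - r < Y1 (P z)].
Proof.
move=> r0; have rn0 : r != 0 by rewrite gt_eqF.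
have r20 : 0 < r ^+ 2 by rewrite exprn_gt0.
have ss := @smooth_step R.
(* The argument of [step] is at least 1 for squares up to [r ^+ 2 / 2] and at most 0 from
   [3 / 4 * r ^+ 2] on; [be] has the same thresholds. The plateau of [t0] reaches from
   [A + 3 / 4 * r] to [B - 3 / 4 * r]. *)
pose f x := x * step (3 - 4 / r ^+ 2 * x ^+ 2) : R.
pose t0 y := step (2 / r * (y - A) - 1 / 2) * step (2 / r * (B - y) - 1 / 2) : R.
pose be s := step (3 - 4 / r ^+ 2 * s) : R.
have sf : smooth setT f by rewrite /f; smo.
have st0 : smooth setT t0 by rewrite /t0; smo.
have sbe : smooth setT be by rewrite /be; smo.
have fzero x : r ^+ 2 * 3 / 4 <= x ^+ 2 -> f x = 0.
  move=> H; rewrite /f step0 ?mulr0//.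
  by rewrite subr_le0 -ler_pdivrMl ?divr_gt0// invf_div; lra.
have tzero y : y <= A + r / 4 \/ B - r / 4 <= y -> t0 y = 0.
  case=> H; rewrite /t0.
    rewrite step0 ?mul0r// subr_le0 -ler_pdivlMl ?divr_gt0// invf_div; lra.
  rewrite mulrC step0 ?mul0r// subr_le0 -ler_pdivlMl ?divr_gt0// invf_div; lra.
have bzero s : r ^+ 2 * 3 / 4 <= s -> be s = 0.
  by move=> H; rewrite /be step0// subr_le0 -ler_pdivrMl ?divr_gt0// invf_div; lra.
have fout x : x < - r \/ r < x -> f x = 0.
  move=> H; apply: fzero; have : r ^+ 2 <= x ^+ 2 by case: H => H; nra.
  lra.
have fb : f 0 = 0 by rewrite /f mul0r.
have f1b : 'D_1 f 0 = 1.
  rewrite (near_eq_derive _ (g := id)) ?derive_id//.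
  have : nbhs (0 : R) [set x : R | x ^+ 2 < r ^+ 2 / 2].
    apply: open_nbhs_nbhs; split; last by rewrite /= expr0n/= divr_gt0.
    apply: (@open_comp _ _ (fun x : R => x ^+ 2) [set x : R | x < r ^+ 2 / 2]); last exact: open_lt.
    move=> x _; exact: exprn_continuous.
  apply: filterS => x /= H; rewrite /f step1 ?mulr1//.
  rewrite -lerBlDr opprK -lerBrDl -ler_pdivlMl ?divr_gt0// invf_div; lra.
have [Cf Cf0 fC] := smooth_bounded sf fout.
have [Cf' Cf'0 f'C] : exists2 C : R, 0 < C & forall x : R, `|'D_1 f x| <= C.
  apply: (@smooth_bounded _ _ (- r) r); first exact: smooth_derive.
  move=> x H; apply: (proj2 (@derive_zero_near f x [set x | x < - r \/ r < x] _ H _)).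
    exact: open_out.
  by move=> y; exact: fout.
have tout y : y < A \/ B < y -> t0 y = 0 by move=> H; apply: tzero; lra.
have [Ct Ct0 tC] := smooth_bounded st0 tout.
have [Ct' Ct'0 t'C] : exists2 C : R, 0 < C & forall x : R, `|'D_1 t0 x| <= C.
  apply: (@smooth_bounded _ _ A B); first exact: smooth_derive.
  move=> x H; apply: (proj2 (@derive_zero_near t0 x [set x | x < A \/ B < x] _ H _)).
    exact: open_out.
  by move=> y; exact: tout.
(* The largest factor for which these bounds, together with [|be| <= 1], give the bound [1 / 2] on
   [be * f' * th']. *)
pose tau := (2 * Cf' * Ct')^-1.
have tau0 : 0 < tau by rewrite invr_gt0 !mulr_gt0.
pose th y := tau * t0 y.
have sth : smooth setT th by rewrite /th; smo.
have thD y : 'D_1 th y = tau * 'D_1 t0 y.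
  have dt := is_derive_smooth st0 (I : setT y).
  exact: (@derive_val _ _ _ _ _ _ _ (is_deriveZ tau dt)).
have thC y : `|th y| <= tau * Ct by rewrite normrM gtr0_norm// ler_pM2l.
have bele s : `|be s| <= 1 by rewrite ger0_norm ?step_ge0 ?step_le1.
have small (s x y : R) : `|be s * 'D_1 f x * 'D_1 th y| <= 1 / 2.
  rewrite thD (normrM (be s * _)) (normrM (be s)) (normrM tau) (gtr0_norm tau0).
  have -> : 1 / 2 = 1 * Cf' * (tau * Ct') :> R.
    rewrite /tau !invfM; field; rewrite ?gt_eqF//.
  have a1 : `|be s| * `|'D_1 f x| <= 1 * Cf' by apply: ler_pM.
  have a2 : tau * `|'D_1 t0 y| <= tau * Ct' by rewrite ler_pM2l.
  by apply: ler_pM a1 a2; [exact: mulr_ge0|apply: mulr_ge0 => //; exact: ltW].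
pose kap := push q1 q2 f th be; pose kap' := pushb q1 q2 f th be.
have kp : sympl_pair setT setT kap kap' by exact: push_pair fC thC small.
have kslit z : X1 z = 0 -> kap z = mk 0 (X2 z)
   (Y1 z + be ((X2 z - q1) ^+ 2 + (Y2 z - q2) ^+ 2) * th (Y1 z)) (Y2 z).
  by move=> x0; exact: push_slit fC small _ _ _ _.
have th0 y : 0 <= th y by rewrite mulr_ge0 ?(ltW tau0)// mulr_ge0 ?step_ge0.
have kid z : ~ [/\ `|X1 z| < r, A < Y1 z < B &
                    (X2 z - q1) ^+ 2 + (Y2 z - q2) ^+ 2 < r ^+ 2] -> kap z = z.
  move=> H; apply: (push_id sf fC small).
  have [xr|xr] := ltP `|X1 z| r; last first.
    constructor 3; apply: (@derive_zero_near f _ [set x | r ^+ 2 * 3 / 4 < x ^+ 2]).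
    - apply: (@open_comp _ _ (fun x : R => x ^+ 2) [set x : R | r ^+ 2 * 3 / 4 < x]); last exact: open_gt.
      move=> x _; exact: exprn_continuous.
    - rewrite /= -(real_normK (num_real (X1 z))).
      by have : r ^+ 2 <= `|X1 z| ^+ 2 by [nra]; lra.
    - by move=> y /ltW; exact: fzero.
  have [yr|yr] := boolP (A < Y1 z < B); last first.
    constructor 2; apply: (@derive_zero_near th _ [set y | y < A + r / 4 \/ B - r / 4 < y]).
    - exact: open_out.
    - by move: yr; rewrite negb_and -!leNgt => /orP[?|?]; [left|right] => /=; lra.
    - by move=> y H'; rewrite /th tzero ?mulr0//; case: H' => /ltW; [left|right].
  have [sr|sr] := ltP ((X2 z - q1) ^+ 2 + (Y2 z - q2) ^+ 2) (r ^+ 2); first by case: H.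
  constructor 1; apply: (@derive_zero_near be _ [set s | r ^+ 2 * 3 / 4 < s]).
  - exact: open_gt.
  - by rewrite /=; lra.
  - by move=> y /ltW; exact: bzero.
(* Up to height [B - r] each push over the inner disc gains exactly [tau], so this number of pushes
   would gain more than [B - A]. *)
pose n := (Num.truncn ((B - A) / tau)).+1.
exists (iter n kap), (iter n kap'); split.
- by apply: sympl_pair_iter => //; exact: openT.
- by move=> z /kid E; elim: (n) => [//|m IH]; rewrite iterS IH.
- move=> z x0; elim: (n) => [|m [e1 e2 e3 e4]] //=.
  rewrite kslit// !mkE; split=> //; rewrite (le_trans e4)// lerDl mulr_ge0//.
  exact: step_ge0.
- move=> z x0 sz yz.
  have be1 : be ((X2 z - q1) ^+ 2 + (Y2 z - q2) ^+ 2) = 1.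
    rewrite /be step1//.
    rewrite -lerBlDr opprK -lerBrDl -ler_pdivlMl ?divr_gt0// invf_div; lra.
  have H m : [/\ X1 (iter m kap z) = 0, X2 (iter m kap z) = X2 z,
      Y2 (iter m kap z) = Y2 z, A + r <= Y1 (iter m kap z) &
      (B - r < Y1 (iter m kap z)) || (A + r + m%:R * tau <= Y1 (iter m kap z))].
    elim: m => [|m [e1 e2 e3 e4 e5]]; first by rewrite mul0r addr0 yz orbT.
    rewrite iterS kslit// !mkE e2 e3 be1 mul1r; set y := Y1 _ in e4 e5 *.
    have ty := th0 y; split=> //; first by lra.
    case/orP: e5 => [?|ym]; first by apply/orP; left; lra.
    have [?|yB] := ltP (B - r) y; first by apply/orP; left; lra.
    apply/orP; right.
    have -> : th y = tau.
      rewrite /th /t0 !step1 ?mulr1// lerBrDr -ler_pdivrMl ?divr_gt0// invf_div; lra.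
    by rewrite -[m.+1]addn1 natrD mulrDl mul1r addrA lerD2r.
  have [_ _ _ _ /orP[//|]] := H n; apply: lt_le_trans.
  have : (B - A) / tau < n%:R by rewrite truncnS_gt.
  rewrite ltr_pdivrMr// => ?; lra.
Qed.

End Slit.


(** * Removing a slit from an open set *)

Section SlitRemoval.
Context {R : realType}.
Notation R4 := 'rV[R]_(2 + 2).

Lemma lebesgue_number (V : normedModType R) (C U : set V) : compact C -> open U -> C `<=` U ->
  exists2 e : R, 0 < e & forall x w, C x -> `|x - w| < e -> U w.
Proof.
move=> cC oU CU.
have /compact_near_coveringP := cC => /(_ R (0 : R)^'+
  (fun e x => forall w, `|x - w| < e -> U w) _) [].
  move=> x Cx; have /nbhs_ballP[e /= e0 eU] := open_nbhs_nbhs (conj oU (CU x Cx)).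
  have e2 : 0 < e / 2 by rewrite divr_gt0.
  exists (ball x (e / 2), [set d : R | d < e / 2]).
    split=> /=; first exact: nbhsx_ballx.
    exact: nbhs_right_lt.
  move=> [y d] /= [xy de] w yw; apply: eU; rewrite -ball_normE/=.
  rewrite -ball_normE/= in xy.
  have := ler_normD (x - y) (y - w); rewrite addrA subrK; lra.
move=> e /= e0 H; exists (e / 2); first by rewrite divr_gt0.
move=> x w Cx; apply: (H (e / 2)) => //=; last by rewrite divr_gt0.
by rewrite sub0r normrN gtr0_norm ?divr_gt0//; lra.
Qed.

Lemma norm_mk_lt (z w : R4) e : 0 < e -> `|X1 z - X1 w| < e -> `|X2 z - X2 w| < e ->
  `|Y1 z - Y1 w| < e -> `|Y2 z - Y2 w| < e -> `|z - w| < e.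
Proof.
move=> e0 h1 h2 h3 h4; rewrite [ltLHS]/Num.Def.normr/= mx_normrE.
apply: bigmax_lt => // -[i j] _ /=; rewrite !mxE ord1.
have [[_ jE]|[_ jE]|[_ jE]|[_ jE]] := coordE (0 : R4) j; rewrite jE.
- by move: h1; rewrite X1E.
- by move: h2; rewrite X2E.
- by move: h3; rewrite Y1E.
- by move: h4; rewrite Y2E.
Qed.

Lemma continuous_X1 : continuous (@X1 R).
Proof. by move=> z; exact: (smooth_continuous (@smooth_X1 R setT)). Qed.
Lemma continuous_X2 : continuous (@X2 R).
Proof. by move=> z; exact: (smooth_continuous (@smooth_X2 R setT)). Qed.
Lemma continuous_Y1 : continuous (@Y1 R).
Proof. by move=> z; exact: (smooth_continuous (@smooth_Y1 R setT)). Qed.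
Lemma continuous_Y2 : continuous (@Y2 R).
Proof. by move=> z; exact: (smooth_continuous (@smooth_Y2 R setT)). Qed.

Lemma continuous_subX2 b : continuous (fun z : R4 => X2 z - b).
Proof. by move=> z; apply: (smooth_continuous (U := setT)) => //; smo. Qed.
Lemma continuous_subY2 b : continuous (fun z : R4 => Y2 z - b).
Proof. by move=> z; apply: (smooth_continuous (U := setT)) => //; smo. Qed.

Lemma continuous_abs (h : R4 -> R) : continuous h -> continuous (fun z => `|h z|).
Proof.
move=> ch z; apply: (@continuous_comp _ _ _ h (fun x : R => `|x|)); first exact: ch.
exact: norm_continuous.
Qed.

Lemma continuous_ge (h k : R4 -> R) : continuous h -> continuous k ->
  closed [set z | h z <= k z].
Proof.
move=> ch ck; rewrite (_ : [set z | h z <= k z] = (fun z => k z - h z) @^-1` [set x | 0 <= x]).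
  apply: closed_comp; last exact: closed_ge.
  move=> z _; exact: (@cvgB _ R _ (nbhs z) _ k h _ _ (ck z) (ch z)).
by apply/seteqP; split=> z /=; rewrite subr_ge0.
Qed.

Lemma continuous_lt (h k : R4 -> R) : continuous h -> continuous k ->
  open [set z | h z < k z].
Proof.
move=> ch ck; rewrite (_ : [set z | h z < k z] = ~` [set z | k z <= h z]).
  by rewrite openC; exact: continuous_ge.
by apply/seteqP; split=> z /=; rewrite ltNge => /negP.
Qed.

Lemma continuous_eq (h k : R4 -> R) : continuous h -> continuous k ->
  closed [set z | h z = k z].
Proof.
move=> ch ck; rewrite (_ : [set z | h z = k z] = [set z | h z <= k z] `&` [set z | k z <= h z]).
  by apply: closedI; exact: continuous_ge.
apply/seteqP; split=> z /= => [->//|[h1 h2]].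
by apply/eqP; rewrite eq_le h1.
Qed.

Lemma sympl_pair_restrict (M : set R4) P P' : sympl_pair setT setT P P' ->
  (forall z, ~ M z -> P z = z) -> sympl_pair M M P P'.
Proof.
move=> PP PM; have [fg gf _ _ _] := PP.
have P'M z : ~ M z -> P' z = z by move=> /PM {1}<-; exact: (fg z I).2.
apply: (sympl_pair_sub PP) => // z Mz; apply: contrapT => nM; apply: (nM).
  by have := P'M _ nM; rewrite (fg z I).2 => <-.
by have := PM _ nM; rewrite (gf z I).2 => <-.
Qed.

Section Slit.
Variables (M : set R4) (r : R -> R -> R).
Hypothesis oM : open M.
Hypothesis cr : continuous (fun z : R4 => r (X2 z) (Y2 z)).
(** Each leaf of the slit meets [M] in an initial piece, so the compact segments along which points
    are to be pushed have neighbourhoods inside [M]. *)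
Hypothesis leafM : forall z y, M z -> X1 z = 0 -> r (X2 z) (Y2 z) <= y <= Y1 z ->
  M (mk 0 (X2 z) y (Y2 z)).

Let Sg : set R4 := [set z | X1 z = 0 /\ r (X2 z) (Y2 z) <= Y1 z].

Let closed_Sg : closed Sg.
Proof.
rewrite (_ : Sg = [set z | X1 z = 0] `&` [set z | r (X2 z) (Y2 z) <= Y1 z])//.
apply: closedI; first by apply: continuous_eq; [exact: continuous_X1|exact: cst_continuous].
by apply: continuous_ge => //; exact: continuous_Y1.
Qed.

(** Slit points keep their base and are never lowered; this makes the effects of several pushes
    cumulative. *)
Let up (L : set R4) (P P' : R4 -> R4) := [/\ sympl_pair M M P P', forall x, L x -> P x = x &
  forall z, X1 z = 0 -> [/\ X1 (P z) = 0, X2 (P z) = X2 z, Y2 (P z) = Y2 z & Y1 z <= Y1 (P z)]].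

Let near_box (a : R4) (e : R) : set R4 := [set z | `|X2 z - X2 a| < e /\ `|Y2 z - Y2 a| < e].

Let open_near_box a e : open (near_box a e).
Proof.
rewrite (_ : near_box a e = [set z | `|X2 z - X2 a| < e] `&` [set z | `|Y2 z - Y2 a| < e])//.
apply: openI; apply: continuous_lt; try by exact: cst_continuous.
- exact: continuous_abs (@continuous_subX2 _).
- exact: continuous_abs (@continuous_subY2 _).
Qed.

(** Let [s0] be the top of [K] on the leaf through [a]. Over bases near [a] the slit is pushed above
    [s0 + r0], while compactness keeps the slit points of [K] below that height. *)
Let local_push (K L : set R4) (a : R4) : compact K -> compact L -> K `<=` M ->
  L `<=` M `&` ~` Sg -> K a -> Sg a ->
  exists e s P P', [/\ 0 < e, up L P P',
    forall z, K z -> Sg z -> near_box a e z -> Y1 z <= s &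
    forall z, M z -> Sg z -> near_box a e z -> s < Y1 (P z)].
Proof.
move=> cK cL KM LN Ka Sa; have [xa ra] := Sa.
have cA : compact (K `&` Sg) by apply: compact_closedI.
pose A0 := (K `&` Sg) `&` ([set z | X2 z = X2 a] `&` [set z | Y2 z = Y2 a]).
have cA0 : compact A0.
  apply: compact_closedI => //; apply: closedI; apply: continuous_eq;
    by [exact: continuous_X2|exact: continuous_Y2|exact: cst_continuous].
have [z0 /set_mem A0z0 z0max] : exists2 z0, z0 \in A0 & forall z, z \in A0 -> Y1 z <= Y1 z0.
  apply: EVT_max_rV => //; first by exists a.
  by apply: continuous_subspaceT; exact: continuous_Y1.
have [[Kz0 [xz0 rz0]] [e2z0 e4z0]] := A0z0; rewrite /= in e2z0 e4z0.
pose s0 := Y1 z0; pose ra0 := r (X2 a) (Y2 a).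
have rs0 : ra0 <= s0 by rewrite /ra0 -e2z0 -e4z0.
pose seg y := mk 0 (X2 a) y (Y2 a).
have cseg : continuous seg.
  move=> y; apply: continuous_rV => j.
  have [[_ jE]|[_ jE]|[_ jE]|[_ jE]] := coordE (0 : R4) j; rewrite jE.
  - rewrite (_ : (fun _ => _) = fun=> 0); first exact: cvg_cst.
    by rewrite funeqE => t; rewrite -[LHS](congr1 (@^~ _) X1E) X1_mk.
  - rewrite (_ : (fun _ => _) = fun=> X2 a); first exact: cvg_cst.
    by rewrite funeqE => t; rewrite -[LHS](congr1 (@^~ _) X2E) X2_mk.
  - rewrite (_ : (fun _ => _) = id); first exact: cvg_id.
    by rewrite funeqE => t; rewrite -[LHS](congr1 (@^~ _) Y1E) Y1_mk.
  - rewrite (_ : (fun _ => _) = fun=> Y2 a); first exact: cvg_cst.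
    by rewrite funeqE => t; rewrite -[LHS](congr1 (@^~ _) Y2E) Y2_mk.
have cC : compact (seg @` `[ra0, s0]%classic).
  apply: continuous_compact; last exact: segment_compact.
  by apply: continuous_subspaceT.
have oU : open (M `&` ~` L).
  apply: openI => //; rewrite openC; apply: compact_closed => //; exact: norm_hausdorff.
have CU : seg @` `[ra0, s0]%classic `<=` M `&` ~` L.
  move=> _ [y /= + <-]; rewrite in_itv/= => /andP[ry ys]; split.
    rewrite /seg -e2z0 -e4z0; apply: leafM => //; first exact: KM.
    by rewrite e2z0 e4z0 ry.
  by move=> /LN[_]; apply; rewrite /Sg/= /seg !mkE.
have [rho rho0 Hrho] := lebesgue_number cC oU CU.
pose r0 := rho / 2; have r00 : 0 < r0 by rewrite divr_gt0.
have [P [P' [PP Pid Pup Ppush]]] := @push_box R (X2 a) (Y2 a) (ra0 - 2 * r0) (s0 + 2 * r0) r0 r00.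
have boxU z : [/\ `|X1 z| < r0, ra0 - 2 * r0 < Y1 z < s0 + 2 * r0 &
    (X2 z - X2 a) ^+ 2 + (Y2 z - Y2 a) ^+ 2 < r0 ^+ 2] -> (M `&` ~` L) z.
  move=> [zx /andP[zy1 zy2] zs].
  have sq (x y : R) : x ^+ 2 + y ^+ 2 < r0 ^+ 2 -> `|x| < r0.
    move=> H; rewrite -(ltr_pXn2r (n := 2)) ?nnegrE ?(ltW r00)// real_normK ?num_real//.
    by have := sqr_ge0 y; lra.
  have zX2 := sq _ _ zs; rewrite addrC in zs; have zY2 := sq _ _ zs.
  (* The height on the segment nearest to [Y1 z]; the box exceeds the segment by [2 * r0 = rho] at
     either end. *)
  pose y := Num.max ra0 (Num.min s0 (Y1 z)).
  have yr : ra0 <= y <= s0 by rewrite /y le_max lexx/= ge_max rs0 ge_min lexx.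
  apply: (Hrho (seg y)); first by exists y => //=; rewrite in_itv.
  apply: norm_mk_lt => //; rewrite /seg !mkE.
  - by rewrite sub0r normrN; rewrite /r0 in zx; lra.
  - by rewrite distrC; rewrite /r0 in zX2; lra.
  - rewrite /y /r0 in zy1 zy2 *; rewrite ltr_norml.
    by case: (leP s0 (Y1 z)) => ?; [case: (leP ra0 s0) => ?|case: (leP ra0 (Y1 z)) => ?];
      apply/andP; split; lra.
  - by rewrite distrC; rewrite /r0 in zY2; lra.
have upP : up L P P'.
  split=> //.
    by apply: sympl_pair_restrict => // z nM; apply: Pid => /boxU[].
  by move=> z Lz; apply: Pid => /boxU[_]; apply.
have [d1 d10 Hd1] : exists2 e : R, 0 < e & forall z, near_box a e z ->
    ra0 - r0 <= r (X2 z) (Y2 z).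
  have cra : (fun z : R4 => r (X2 z) (Y2 z)) z @[z --> a] --> r (X2 a) (Y2 a) by exact: (@cr a).
  have /cvgrPdist_lt/(_ _ r00)/nbhs_ballP[e /= e0 He] := cra.
  exists e => // z [h1 h2]; have := He (mk (X1 a) (X2 z) (Y1 a) (Y2 z)).
  rewrite -ball_normE/= !mkE => H.
  have : `|ra0 - r (X2 z) (Y2 z)| < r0.
    apply: H; apply: norm_mk_lt => //; rewrite !mkE ?subrr ?normr0// distrC//.
  by rewrite ltr_norml => /andP[]; lra.
have [d2 d20 Hd2] : exists2 e : R, 0 < e & forall z, K z -> Sg z -> near_box a e z ->
    Y1 z <= s0 + r0.
  (* The slit points of [K] that are too high form a compact set missing the leaf of [a], so their
     distance to this leaf, measured in the base, has a positive minimum. *)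
  pose D := (K `&` Sg) `&` [set z | s0 + r0 <= Y1 z].
  have cD : compact D.
    apply: compact_closedI => //; apply: continuous_ge; last exact: continuous_Y1.
    by exact: cst_continuous.
  have [D0|/set0P D0] := eqVneq D set0.
    exists 1 => // z Kz Sz _; rewrite leNgt; apply/negP => H.
    have : D z by split=> //; exact: ltW.
    by rewrite D0.
  pose d z := `|X2 z - X2 a| + `|Y2 z - Y2 a|.
  have [c /set_mem [[Kc Sc] /= sc] dmin] : exists2 c, c \in D & forall t, t \in D -> d c <= d t.
    have cd : continuous d.
      move=> z; apply: (@cvgD _ R _ (nbhs z) _ (fun z => `|X2 z - X2 a|) (fun z => `|Y2 z - Y2 a|)).
        exact: (@continuous_abs _ (@continuous_subX2 (X2 a)) z).
      exact: (@continuous_abs _ (@continuous_subY2 (Y2 a)) z).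
    by apply: EVT_min_rV => //; exact: continuous_subspaceT.
  have dc0 : 0 < d c.
    rewrite lt_neqAle addr_ge0// andbT eq_sym paddr_eq0// !normr_eq0 !subr_eq0.
    apply/negP => /andP[/eqP e1 /eqP e2].
    have : c \in A0 by rewrite inE.
    by move=> /z0max; rewrite -/s0; lra.
  exists (d c / 2); first by rewrite divr_gt0.
  move=> z Kz Sz [h1 h2]; rewrite leNgt; apply/negP => H.
  have : z \in D by rewrite inE; split=> //; exact: ltW.
  by move=> /dmin; rewrite {2}/d; lra.
pose e := Num.min (r0 / 2) (Num.min d1 d2).
have [e1 e2 e3] : [/\ e <= r0 / 2, e <= d1 & e <= d2].
  by rewrite /e !ge_min !lexx !orbT.
have e0 : 0 < e by rewrite !lt_min d10 d20 divr_gt0.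
have near_le d : e <= d -> near_box a e `<=` near_box a d.
  by move=> ed z [h1 h2]; split; [exact: lt_le_trans h1 ed|exact: lt_le_trans h2 ed].
exists e, (s0 + r0), P, P'; split=> //.
  by move=> z Kz Sz nz; apply: Hd2 => //; exact: near_le nz.
move=> z Mz [xz rz] nz.
have -> : s0 + r0 = s0 + 2 * r0 - r0 by ring.
apply: Ppush => //.
  have [h1 h2] := near_le _ e1 _ nz.
  have sq (x : R) : `|x| < r0 / 2 -> x ^+ 2 <= r0 ^+ 2 / 4.
    move=> H; rewrite -(real_normK (num_real x)).
    by have := normr_ge0 x; nra.
  by have := sq _ h1; have := sq _ h2; lra.
by have := Hd1 z (near_le _ e2 _ nz); lra.
Qed.

(** If [P' y] were a slit point for some [y] in [K], then [y = P (P' y)] would be a slit point of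
    [K] over the same base, lifted above the bound that [K] obeys there. Finitely many local pushes
    suffice by compactness. *)
Theorem slit_removal : symp (M `&` ~` Sg) M.
Proof.
have oN : open (M `&` ~` Sg) by apply: openI => //; rewrite openC.
apply: (swallow oM oN); first by move=> z [].
move=> K L cK cL KM LN.
have cA : compact (K `&` Sg) by apply: compact_closedI.
have /choice[D DP] (a : R4) : exists D : R * R * (R4 -> R4) * (R4 -> R4),
    K a -> Sg a -> [/\ 0 < D.1.1.1, up L D.1.2 D.2,
    forall z, K z -> Sg z -> near_box a D.1.1.1 z -> Y1 z <= D.1.1.2 &
    forall z, M z -> Sg z -> near_box a D.1.1.1 z -> D.1.1.2 < Y1 (D.1.2 z)].
  have [[Ka Sa]|nKS] := pselect (K a /\ Sg a).
    have [e [s [P [P' H]]]] := local_push cK cL KM LN Ka Sa.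
    by exists (e, s, P, P').
  by exists (0, 0, id, id) => Ka Sa; case: nKS; split.
have [F FA Fcov] : finite_subset_cover (K `&` Sg) (fun a => near_box a (D a).1.1.1) (K `&` Sg).
  move: cA; rewrite compact_cover => cA; apply: cA => //.
  move=> a [Ka Sa]; exists a => //.
  by have [e0 _ _ _] := DP a Ka Sa; split; rewrite subrr normr0.
suff [P [P' [[PP PL Pup] PF]]] : exists P P', up L P P' /\
    forall a z, a \in finmap.enum_fset F -> M z -> Sg z -> near_box a (D a).1.1.1 z -> (D a).1.1.2 < Y1 (P z).
  exists P, P'; split=> // y Ky.
  have [fg gf _ _ _] := PP; have [MP' Py] := gf y (KM _ Ky).
  split=> // SP'; have [xP rP] := SP'.
  have [x1 x2 y2 y1] := Pup _ xP; rewrite Py in x1 x2 y2 y1.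
  have Sy : Sg y by split=> //; rewrite x2 y2 (le_trans rP).
  have [a aF nay] := Fcov y (conj Ky Sy).
  have [Ka Sa] : (K `&` Sg) a by apply: set_mem; exact: FA.
  have [_ _ H _] := DP a Ka Sa.
  have nP : near_box a (D a).1.1.1 (P' y) by rewrite /near_box/= -x2 -y2.
  have := PF a (P' y) aF MP' SP' nP; rewrite Py ltNge.
  by rewrite H.
have : {subset finmap.enum_fset F <= K `&` Sg} by move=> x /FA.
(* Composition in any order works: a later push finds the slit point over the same base and at least
   as high, and it does not lower what earlier pushes have lifted. *)
move: (finmap.enum_fset F) => l; elim: l => [_|a l IH sub].
  exists id, id; split=> //; split=> //; exact: sympl_pair_id.
have [|P [P' [[PP PL Pup] Pl]]] := IH.
  by move=> x xl; apply: sub; rewrite inE xl orbT.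
have [Ka Sa] : (K `&` Sg) a by apply: set_mem; apply: sub; rewrite inE eqxx.
have [_ [QP QL Qup] _ Q] := DP a Ka Sa.
exists ((D a).1.2 \o P), (P' \o (D a).2); split.
  split; first exact: sympl_pair_trans PP QP.
    by move=> x Lx; rewrite /= PL// QL.
  move=> z xz; have [x1 x2 y2 y1] := Pup z xz.
  have [x1' x2' y2' y1'] := Qup _ x1.
  by rewrite /= x1' x2' y2' x2 y2; split=> //; exact: le_trans y1'.
move=> b z + Mz Sz nbz; have [xz rz] := Sz.
have [x1 x2 y2 y1] := Pup z xz.
rewrite inE => /predU1P[bE|bl].
  rewrite bE in nbz *; apply: Q.
  - by have [fg _ _ _ _] := PP; exact: (fg z Mz).1.
  - by split=> //; rewrite x2 y2; exact: le_trans rz y1.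
  - by rewrite /near_box/= x2 y2.
have [_ _ _ y1'] := Qup _ x1.
by apply: lt_le_trans y1'; exact: Pl.
Qed.

End Slit.
End SlitRemoval.


Section Swap.
Context {R : realType}.
Notation R4 := 'rV[R]_(2 + 2).

Definition swap (z : R4) := mk (X2 z) (X1 z) (Y2 z) (Y1 z).

Lemma swapK z : swap (swap z) = z.
Proof. by apply: mk_ext; rewrite /swap !mkE. Qed.

Lemma swap_pair : sympl_pair setT setT swap swap.
Proof.
have s : smooth_rV setT swap by apply: smooth_mk; smo.
split=> //; try by move=> z _; rewrite swapK.
move=> z _ u v.
have D w := derive_mk (derX2 z w) (derX1 z w) (derY2 z w) (derY1 z w).
by rewrite !D !omegaE !mkE addrC.
Qed.

Lemma symp_swap U : open U -> symp U [set z | U (swap z)].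
Proof.
move=> oU; have [_ _ ss _ _] := swap_pair; split=> //.
  apply: (@open_comp _ _ swap U) => // z _; apply: differentiable_continuous.
  exact: smooth_rV_diff ss I.
exists swap, swap; apply: (sympl_pair_sub swap_pair) => // z Uz.
by rewrite /= swapK.
Qed.

End Swap.

(** * Polar coordinates and Lambert's projection *)

Section Charts.
Context {R : realType}.
Notation R4 := 'rV[R]_(2 + 2).
Local Notation pi := (@pi R).

Lemma smooth_sqrtf (V : normedModType R) (U : set V) (f : V -> R) : open U ->
  (forall x, U x -> 0 < f x) -> smooth U f -> smooth U (fun x => Num.sqrt (f x)).
Proof. by move=> oU f0 sf; exact: (smooth_comp1 oU f0 (@smooth_sqrt R) sf). Qed.

Lemma smooth_atanf (V : normedModType R) (U : set V) (f : V -> R) : open U ->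
  smooth U f -> smooth U (fun x => atan (f x)).
Proof. by move=> oU sf; exact: (smooth_fun oU (@smooth_atan R setT) sf). Qed.

Lemma der_sqrt (z v : R4) f a : 0 < f z -> der z v f a ->
  der z v (fun z => Num.sqrt (f z)) ((2 * Num.sqrt (f z))^-1 * a).
Proof. by move=> f0; apply: der_comp; exact: is_derive1_sqrt. Qed.

Definition pol_r (y : R) := Num.sqrt (y * pi^-1).
(** Half-angle formula: if [(u, v)] is [r] times the sine and cosine of [2 pi x], then
    [tan (pi x - pi / 2) = - u / (r - v)]. A single [atan] covers the plane minus the ray [u = 0],
    [0 <= v]. *)
Definition ang (u v : R) :=
  1 / 2 + atan (- u * (Num.sqrt (u ^+ 2 + v ^+ 2) - v)^-1) * pi^-1.

Let pi0 : 0 < pi. Proof. exact: pi_gt0. Qed.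
Let pin0 : pi != 0. Proof. by rewrite gt_eqF. Qed.

Lemma pol_r_gt0 y : 0 < y -> 0 < pol_r y.
Proof. by move=> y0; rewrite sqrtr_gt0 mulr_gt0// invr_gt0. Qed.

Lemma pol_r_sqr y : 0 <= y -> pi * pol_r y ^+ 2 = y.
Proof.
move=> y0; rewrite sqr_sqrtr; last by rewrite mulr_ge0// invr_ge0 ltW.
by rewrite mulrCA mulfV// mulr1.
Qed.

Let half_inv (p x : R) : p != 0 -> 1 / 2 + (p * x - p / 2) * p^-1 = x.
Proof. by move=> p0; field. Qed.
Let half_inv2 (p t : R) : p != 0 -> 1 / 2 + t * p^-1 = (p / 2 + t) * p^-1.
Proof. by move=> p0; field. Qed.
Let half_inv3 (p t : R) : p != 0 -> p * (1 / 2 + t * p^-1) - p / 2 = t.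
Proof. by move=> p0; field. Qed.

Lemma sin2pi_half (x : R) : sin (2 * pi * x) = - (2 * sin (pi * x - pi / 2) * cos (pi * x - pi / 2)).
Proof.
have -> : 2 * pi * x = (pi * x - pi / 2) *+ 2 + pi by rewrite mulr2n; field.
by rewrite sinDpi sin_mulr2n mulr2n; ring.
Qed.

Lemma cos2pi_half (x : R) : cos (2 * pi * x) = 1 - 2 * cos (pi * x - pi / 2) ^+ 2.
Proof.
have -> : 2 * pi * x = (pi * x - pi / 2) *+ 2 + pi by rewrite mulr2n; field.
by rewrite cosDpi cos_mulr2n mulr2n; ring.
Qed.

Lemma half_range (x : R) : 0 < x < 1 -> - (pi / 2) < pi * x - pi / 2 < pi / 2.
Proof.
move=> /andP[x0 x1]; have h1 : 0 < pi * x by rewrite mulr_gt0.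
have h2 : pi * x < pi by rewrite gtr_pMr.
by apply/andP; split; lra.
Qed.

Lemma pol_slit r x : 0 < r -> 0 < x < 1 ->
  ~ (r * sin (2 * pi * x) = 0 /\ 0 <= r * cos (2 * pi * x)).
Proof.
move=> r0 /half_range hx; have c0 := cos_gt0_pihalf hx.
rewrite sin2pi_half cos2pi_half; set h := pi * x - _ in c0 *.
case=> /eqP; rewrite mulf_eq0 gt_eqF//= oppr_eq0 !mulf_eq0 pnatr_eq0/= (gt_eqF c0) orbF => /eqP s0.
by have := cos2Dsin2 h; rewrite s0 expr0n/= addr0 => ->; rewrite pmulr_rge0//; lra.
Qed.

Lemma ang_pol r x : 0 < r -> 0 < x < 1 ->
  ang (r * sin (2 * pi * x)) (r * cos (2 * pi * x)) = x.
Proof.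
move=> r0 x01; have hx := half_range x01; have c0 := cos_gt0_pihalf hx.
rewrite /ang (_ : (r * sin _) ^+ 2 + _ = r ^+ 2); last first.
  by rewrite !exprMn -mulrDr addrC cos2Dsin2 mulr1.
rewrite sqrtr_sqr gtr0_norm// sin2pi_half cos2pi_half.
set h := pi * x - pi / 2 in hx c0 *.
rewrite (_ : - _ * _ = tan h).
  by rewrite tanK ?in_itv//= /h half_inv.
rewrite /tan; field; rewrite ?gt_eqF//=.
rewrite (_ : r - r * (1 - 2 * cos h ^+ 2) = 2 * r * cos h ^+ 2); last by ring.
by rewrite !mulr_gt0 ?exprn_gt0.
Qed.

Lemma ang_range (u v : R) : 0 < ang u v < 1.
Proof.
rewrite /ang; set t := atan _.
have t1 : - (pi / 2) < t by exact: atan_gtNpi2.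
have t2 : t < pi / 2 by exact: atan_ltpi2.
rewrite -[X in _ < _ < X](mulfK pin0) -[X in X < _ < _](mul0r pi^-1).
rewrite half_inv2//.
by rewrite !ltr_pM2r ?invr_gt0//; apply/andP; split; lra.
Qed.

Lemma pol_ang_aux (u v : R) : ~ (u = 0 /\ 0 <= v) ->
  [/\ 0 < u ^+ 2 + v ^+ 2, 0 < Num.sqrt (u ^+ 2 + v ^+ 2) &
      0 < Num.sqrt (u ^+ 2 + v ^+ 2) - v].
Proof.
move=> uv.
have p0 : 0 < u ^+ 2 + v ^+ 2.
  rewrite lt_neqAle addr_ge0 ?sqr_ge0// andbT eq_sym paddr_eq0 ?sqr_ge0// !expf_eq0/=.
  by apply/negP => /andP[/eqP u0 /eqP v0]; apply: uv; rewrite u0 v0.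
have r0 : 0 < Num.sqrt (u ^+ 2 + v ^+ 2) by rewrite sqrtr_gt0.
split=> //; rewrite subr_gt0.
have [v0|v0] := ltP v 0; first exact: lt_trans v0 r0.
rewrite -(ltr_pXn2r (n := 2)) ?nnegrE ?(ltW r0)// sqr_sqrtr ?(ltW p0)//.
rewrite ltrDr lt_neqAle sqr_ge0 andbT eq_sym expf_eq0/=.
by apply/negP => /eqP u0; apply: uv.
Qed.

Lemma pol_ang (u v : R) : ~ (u = 0 /\ 0 <= v) ->
  let r := Num.sqrt (u ^+ 2 + v ^+ 2) in
  r * sin (2 * pi * ang u v) = u /\ r * cos (2 * pi * ang u v) = v.
Proof.
move=> /pol_ang_aux [p0 r0 rv] r; rewrite -/r in r0 rv.
have r2 : r ^+ 2 = u ^+ 2 + v ^+ 2 by rewrite sqr_sqrtr// ltW.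
rewrite sin2pi_half cos2pi_half /ang -/r.
set t := - u * (r - v)^-1; set h := pi * _ - _.
have hE : h = atan t by rewrite /h half_inv3.
have t1 : 1 + t ^+ 2 = 2 * r / (r - v).
  have u2 : u ^+ 2 = (r - v) * (r + v) by rewrite -subr_sqr r2 addrK.
  by rewrite /t exprMn sqrrN u2; field; rewrite gt_eqF.
have c2 : cos h ^+ 2 = (r - v) / (2 * r).
  rewrite hE cos_atan exprVn sqr_sqrtr ?addr_ge0 ?sqr_ge0// t1 invf_div//.
have cn0 : cos h != 0.
  by rewrite hE cos_atan invr_eq0 sqrtr_eq0 -ltNge ltr_pwDl// sqr_ge0.
have sE : sin h = t * cos h.
  by rewrite -[t]atanK -hE /tan divfK.
split.
  rewrite sE (_ : - _ = - (2 * t * cos h ^+ 2)); last by ring.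
  by rewrite c2 /t; field; rewrite !gt_eqF.
by rewrite c2; field; rewrite gt_eqF.
Qed.

(** With [dr = k dy], the relation [2 p r k = 1] says that [p r^2] has differential [dy]: the
    momentum is the enclosed area and the angle is [2 p x]. *)
Lemma polar_form (p C S r k xu yu xv yv : R) : C ^+ 2 + S ^+ 2 = 1 -> 2 * p * r * k = 1 ->
  (r * (C * (2 * p * xu)) + S * (k * yu)) * (r * (- S * (2 * p * xv)) + C * (k * yv)) -
  (r * (- S * (2 * p * xu)) + C * (k * yu)) * (r * (C * (2 * p * xv)) + S * (k * yv)) =
  xu * yv - yu * xv.
Proof.
move=> CS rk; transitivity ((C ^+ 2 + S ^+ 2) * (2 * p * r * k) * (xu * yv - yu * xv)).
  by ring.
by rewrite CS rk !mul1r.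
Qed.

(** The ball in action-angle coordinates: [Y1], [Y2] are areas, [X1], [X2] are angles in units of a
    full turn. *)
Definition corner_simplex : set R4 :=
  [set z | [/\ 0 < X1 z < 1, 0 < X2 z < 1, 0 < Y1 z, 0 < Y2 z & Y1 z + Y2 z < 1]].

Definition pball : set R4 :=
  [set z | pi * (X1 z ^+ 2 + Y1 z ^+ 2) + pi * (X2 z ^+ 2 + Y2 z ^+ 2) < 1].

Definition slit1 : set R4 := [set z | X1 z = 0 /\ 0 <= Y1 z].
Definition slit2 : set R4 := [set z | X2 z = 0 /\ 0 <= Y2 z].

Lemma smooth_cont (f : R4 -> R) : smooth setT f -> continuous f.
Proof. by move=> sf z; exact: (smooth_continuous sf). Qed.

Lemma open_smooth_lt (f g : R4 -> R) : smooth setT f -> smooth setT g -> open [set z | f z < g z].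
Proof. by move=> sf sg; apply: continuous_lt; exact: smooth_cont. Qed.

Lemma open_corner_simplex : open corner_simplex.
Proof.
rewrite (_ : corner_simplex = ([set z | 0 < X1 z] `&` [set z | X1 z < 1]) `&`
  ([set z | 0 < X2 z] `&` [set z | X2 z < 1]) `&` [set z | 0 < Y1 z] `&`
  [set z | 0 < Y2 z] `&` [set z | Y1 z + Y2 z < 1]); last first.
  apply/seteqP; split=> z.
    by move=> [/andP[? ?] /andP[? ?] ? ? ?]; do !split.
  by move=> [[[[[? ?] [? ?]] ?] ?] ?]; split=> //; apply/andP.
by repeat apply: openI; apply: open_smooth_lt; smo.
Qed.

Lemma open_pball : open pball.
Proof. by apply: open_smooth_lt; smo. Qed.

Lemma closed_slit1 : closed slit1.
Proof.
rewrite (_ : slit1 = [set z | X1 z = 0] `&` [set z | 0 <= Y1 z])//.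
apply: closedI; first by apply: continuous_eq; [exact: continuous_X1|exact: cst_continuous].
by apply: continuous_ge; [exact: cst_continuous|exact: continuous_Y1].
Qed.

Lemma closed_slit2 : closed slit2.
Proof.
rewrite (_ : slit2 = [set z | X2 z = 0] `&` [set z | 0 <= Y2 z])//.
apply: closedI; first by apply: continuous_eq; [exact: continuous_X2|exact: cst_continuous].
by apply: continuous_ge; [exact: cst_continuous|exact: continuous_Y2].
Qed.

Let slit_ball : set R4 := (pball `&` ~` slit2) `&` ~` slit1.

Let open_slit_ball : open slit_ball.
Proof.
apply: openI; last by rewrite openC; exact: closed_slit1.
by apply: openI; [exact: open_pball|rewrite openC; exact: closed_slit2].
Qed.

Lemma corner_simplex_slit_ball : symp corner_simplex slit_ball.
Proof.
have oC := open_corner_simplex; have oS := open_slit_ball.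
split=> //.
pose f (z : R4) := mk (pol_r (Y1 z) * sin (2 * pi * X1 z)) (pol_r (Y2 z) * sin (2 * pi * X2 z))
  (pol_r (Y1 z) * cos (2 * pi * X1 z)) (pol_r (Y2 z) * cos (2 * pi * X2 z)).
pose g (z : R4) := mk (ang (X1 z) (Y1 z)) (ang (X2 z) (Y2 z))
  (pi * (X1 z ^+ 2 + Y1 z ^+ 2)) (pi * (X2 z ^+ 2 + Y2 z ^+ 2)).
have polN y x : 0 < y -> pi * ((pol_r y * sin (2 * pi * x)) ^+ 2 + (pol_r y * cos (2 * pi * x)) ^+ 2) = y.
  move=> y0; rewrite !exprMn -mulrDr addrC cos2Dsin2 mulr1 pol_r_sqr//; exact: ltW.
have nslit z : slit_ball z -> ~ (X1 z = 0 /\ 0 <= Y1 z) /\ ~ (X2 z = 0 /\ 0 <= Y2 z).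
  by move=> [[_ s2] s1].
have rE u v : Num.sqrt (u ^+ 2 + v ^+ 2) = pol_r (pi * (u ^+ 2 + v ^+ 2)).
  by rewrite /pol_r mulrAC mulfV// mul1r.
exists f, g; split.
- move=> z [x1 x2 y1 y2 y12]; split.
    split; last by rewrite /slit1/= /f !mkE; apply: pol_slit => //; exact: pol_r_gt0.
    split; last by rewrite /slit2/= /f !mkE; apply: pol_slit => //; exact: pol_r_gt0.
    by rewrite /pball/= /f !mkE !polN.
  apply: mk_ext; rewrite /g /f ?mkE ?polN// ang_pol//; exact: pol_r_gt0.
- move=> z Sz; have [s1 s2] := nslit z Sz; have [[Bz _] _] := Sz.
  have [p1 _ _] := pol_ang_aux s1; have [p2 _ _] := pol_ang_aux s2.
  have [e1 e1'] := pol_ang s1; have [e2 e2'] := pol_ang s2.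
  split; first by split; rewrite /g !mkE ?ang_range ?mulr_gt0//; exact: Bz.
  by apply: mk_ext; rewrite /f /g ?mkE -?rE.
- have sr (h : R4 -> R) : smooth corner_simplex h -> (forall z, corner_simplex z -> 0 < h z) ->
      smooth corner_simplex (fun z => pol_r (h z)).
    move=> sh h0; apply: smooth_sqrtf => // [z /h0 hz|]; first by rewrite mulr_gt0// invr_gt0.
    by apply: smoothM => //; exact: smooth_cst.
  have r1 : smooth corner_simplex (fun z => pol_r (Y1 z)).
    by apply: sr; [exact: smooth_Y1|move=> z []].
  have r2 : smooth corner_simplex (fun z => pol_r (Y2 z)).
    by apply: sr; [exact: smooth_Y2|move=> z []].
  by apply: smooth_mk; smo.
- have sa (u v : R4 -> R) : smooth slit_ball u -> smooth slit_ball v ->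
      (forall z, slit_ball z -> ~ (u z = 0 /\ 0 <= v z)) ->
      smooth slit_ball (fun z => ang (u z) (v z)).
    move=> su sv uv; have sq : smooth slit_ball (fun z => Num.sqrt (u z ^+ 2 + v z ^+ 2)).
      by apply: smooth_sqrtf => // [z /uv/pol_ang_aux[]//|]; smo.
    have sd : smooth slit_ball (fun z => (Num.sqrt (u z ^+ 2 + v z ^+ 2) - v z)^-1).
      apply: smoothV => // [z /uv/pol_ang_aux[_ _ h]|]; first by rewrite gt_eqF.
      by smo.
    rewrite /ang; apply: smoothD => //; first by smo.
    apply: smoothM => //; last by smo.
    by apply: smooth_atanf => //; smo.
  have a1 : smooth slit_ball (fun z => ang (X1 z) (Y1 z)).
    by apply: sa; [exact: smooth_X1|exact: smooth_Y1|move=> z /nslit[]].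
  have a2 : smooth slit_ball (fun z => ang (X2 z) (Y2 z)).
    by apply: sa; [exact: smooth_X2|exact: smooth_Y2|move=> z /nslit[]].
  by apply: smooth_mk; smo.
- move=> z [x1 x2 y1 y2 y12] u v.
  have dr (y : R4 -> R) w a : 0 < y z -> der z w y a ->
      der z w (fun z => pol_r (y z)) ((2 * pi * pol_r (y z))^-1 * a).
    move=> y0 dy; have := der_sqrt (_ : 0 < y z * pi^-1) (derM dy (der_cst z w pi^-1)).
    rewrite mulr0 add0r => /(_ (mulr_gt0 y0 _)); rewrite invr_gt0 => /(_ pi0).
    by rewrite mulrA -/(pol_r (y z)) -invfM mulrAC.
  have dS (x : R4 -> R) w a : der z w x a ->
      der z w (fun z => sin (2 * pi * x z)) (cos (2 * pi * x z) * (2 * pi * a)).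
    move=> dx; have := @der_comp _ _ z w _ (fun z => 2 * pi * x z) _ _ (is_derive_sin _) (derM (der_cst z w (2 * pi)) dx).
    by rewrite mulr0 addr0.
  have dC (x : R4 -> R) w a : der z w x a ->
      der z w (fun z => cos (2 * pi * x z)) (- sin (2 * pi * x z) * (2 * pi * a)).
    move=> dx; have := @der_comp _ _ z w _ (fun z => 2 * pi * x z) _ _ (is_derive_cos _) (derM (der_cst z w (2 * pi)) dx).
    by rewrite mulr0 addr0.
  have D w := derive_mk
    (derM (dr _ w _ y1 (derY1 z w)) (dS _ w _ (derX1 z w)))
    (derM (dr _ w _ y2 (derY2 z w)) (dS _ w _ (derX2 z w)))
    (derM (dr _ w _ y1 (derY1 z w)) (dC _ w _ (derX1 z w)))
    (derM (dr _ w _ y2 (derY2 z w)) (dC _ w _ (derX2 z w))).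
  rewrite !D !omegaE !mkE.
  have k1 (y : R) : 0 < y -> 2 * pi * pol_r y * (2 * pi * pol_r y)^-1 = 1.
    by move=> y0; rewrite mulfV// !mulf_neq0// gt_eqF// pol_r_gt0.
  by rewrite !polar_form ?cos2Dsin2 ?k1.
Qed.

Theorem corner_simplex_ball : symp corner_simplex pball.
Proof.
apply: (symp_trans corner_simplex_slit_ball).
have oB := open_pball.
have o2 : open (pball `&` ~` slit2) by apply: openI => //; rewrite openC; exact: closed_slit2.
(* The slits are removed one after the other, the exchange of the two planes bringing the second
   into position. Moving down a leaf towards its end shrinks the radius, so leaves do not leave the
   ball. *)
have H1 : symp ((pball `&` ~` slit2) `&` ~` slit1) (pball `&` ~` slit2).
  apply: (slit_removal (r := fun _ _ => 0) o2); first exact: cst_continuous.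
  move=> z y [Bz s2] x1 /andP[y0 yY]; split; last by rewrite /slit2/= !mkE.
  rewrite /pball/= !mkE; apply: le_lt_trans Bz; rewrite lerD2r ler_pM2l// x1 lerD2l.
  by rewrite lerXn2r// nnegrE//; exact: le_trans yY.
apply: (symp_trans H1).
apply: (symp_trans (symp_swap o2)).
have -> : [set z | (pball `&` ~` slit2) (swap z)] = pball `&` ~` slit1.
  by apply/seteqP; split=> z; rewrite /pball /slit1 /slit2 /swap/= !mkE [X in X < 1]addrC.
apply: (slit_removal (r := fun _ _ => 0) oB); first exact: cst_continuous.
move=> z y Bz x1 /andP[y0 yY].
rewrite /pball/= !mkE; apply: le_lt_trans Bz; rewrite lerD2r ler_pM2l// x1 lerD2l.
by rewrite lerXn2r// nnegrE//; exact: le_trans yY.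
Qed.

End Charts.


(** * Lambert's equal-area projection *)

Section Lambert.
Context {R : realType}.
Notation R4 := 'rV[R]_(2 + 2).
Local Notation pi := (@pi R).

Let pi0 : 0 < pi. Proof. exact: pi_gt0. Qed.
Let pin0 : pi != 0. Proof. by rewrite gt_eqF. Qed.

Let half_inv (p x : R) : p != 0 -> 1 / 2 + (p * x - p / 2) * p^-1 = x.
Proof. by move=> p0; field. Qed.
Let half_inv3 (p t : R) : p != 0 -> p * (1 / 2 + t * p^-1) - p / 2 = t.
Proof. by move=> p0; field. Qed.

Let q (y : R) := Num.sqrt (1 - (2 * y - 1) ^+ 2).
Let th (x : R) := pi * x - pi / 2.
Let ht (x y : R) := q y * cos (th x).
Let kk (c : R) := Num.sqrt ((pi * (1 + c))^-1).

Let q_gt0 y : 0 < y < 1 -> 0 < q y.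
Proof. by move=> /andP[y0 y1]; rewrite sqrtr_gt0; nra. Qed.

Let q_sqr y : 0 < y < 1 -> q y ^+ 2 = 1 - (2 * y - 1) ^+ 2.
Proof. by move=> /andP[y0 y1]; rewrite sqr_sqrtr//; nra. Qed.

Let cos_th x : 0 < x < 1 -> 0 < cos (th x).
Proof. by move=> /half_range; exact: cos_gt0_pihalf. Qed.

Let ht_gt0 x y : 0 < x < 1 -> 0 < y < 1 -> 0 < ht x y.
Proof. by move=> x01 y01; rewrite mulr_gt0 ?q_gt0 ?cos_th. Qed.

Let kk_gt0 c : 0 < c -> 0 < kk c.
Proof. by move=> c0; rewrite sqrtr_gt0 invr_gt0 mulr_gt0// ltr_pwDl// ltW. Qed.

Let kk_sqr c : 0 < c -> kk c ^+ 2 * (pi * (1 + c)) = 1.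
Proof.
move=> c0; have h : 0 < pi * (1 + c) by rewrite mulr_gt0//; lra.
by rewrite sqr_sqrtr ?mulVf ?gt_eqF// invr_ge0 ltW.
Qed.

Let sphere x y : 0 < y < 1 ->
  (q y * sin (th x)) ^+ 2 + (2 * y - 1) ^+ 2 + ht x y ^+ 2 = 1.
Proof.
move=> y01; rewrite /ht !exprMn addrAC -mulrDr [sin _ ^+ 2 + _]addrC cos2Dsin2 mulr1.
by rewrite q_sqr// subrK.
Qed.

Definition square2 : set R4 := [set z | 0 < X2 z < 1 /\ 0 < Y2 z < 1].
Definition disc2 : set R4 := [set z | pi * (X2 z ^+ 2 + Y2 z ^+ 2) < 1].

(* The square parametrizes a hemisphere by the longitude [th] and the height
   [2 y - 1]; [ht] is the distance to the boundary plane of the hemisphere, and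
   the factor [kk] makes the projection to the equatorial disc area-preserving. *)
Definition lambert (z : R4) : R4 := let k := kk (ht (X2 z) (Y2 z)) in
  mk (X1 z) (k * (q (Y2 z) * sin (th (X2 z)))) (Y1 z) (k * (2 * Y2 z - 1)).

Let hc (z : R4) := 1 - pi * (X2 z ^+ 2 + Y2 z ^+ 2).

Definition lambert_inv (z : R4) : R4 := let k := (kk (hc z))^-1 in
  mk (X1 z) (1 / 2 + atan (X2 z * k * (hc z)^-1) * pi^-1) (Y1 z) (1 / 2 * (1 + Y2 z * k)).

Lemma open_square2 : open square2.
Proof.
rewrite (_ : square2 = ([set z | 0 < X2 z] `&` [set z | X2 z < 1]) `&`
  ([set z | 0 < Y2 z] `&` [set z | Y2 z < 1])); last first.
  apply/seteqP; split=> z.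
    by move=> [/andP[? ?] /andP[? ?]]; do !split.
  by move=> [[? ?] [? ?]]; split=> //; apply/andP.
by repeat apply: openI; apply: open_smooth_lt; smo.
Qed.

Lemma open_disc2 : open disc2.
Proof. by apply: open_smooth_lt; smo. Qed.

Let hc_gt0 z : disc2 z -> 0 < hc z.
Proof. by rewrite /disc2/= /hc subr_gt0. Qed.

(* The height over the equatorial disc is recovered from the distance to the centre. *)
Lemma lambert_height z : square2 z -> hc (lambert z) = ht (X2 z) (Y2 z).
Proof.
move=> [x01 y01]; rewrite /hc /lambert !mkE; set c := ht _ _.
have c0 : 0 < c by exact: ht_gt0.
have S := sphere (X2 z) y01; rewrite -/c in S.
have K := kk_sqr c0; set k := kk c in K *.
rewrite !exprMn -mulrDr (_ : (q _ ^+ 2 * _ + _) = 1 - c ^+ 2); last first.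
  by apply: (canRL (addrK _)); rewrite -exprMn.
have -> : pi * (k ^+ 2 * (1 - c ^+ 2)) = (k ^+ 2 * (pi * (1 + c))) * (1 - c) by ring.
by rewrite K; ring.
Qed.

Let lambertK z : square2 z -> disc2 (lambert z) /\ lambert_inv (lambert z) = z.
Proof.
move=> Sz; have hE := lambert_height Sz; have [x01 y01] := Sz.
have c0 : 0 < ht (X2 z) (Y2 z) by exact: ht_gt0.
split; first by rewrite /disc2/= -subr_gt0 -/(hc _) hE.
have k0 := kk_gt0 c0.
rewrite /lambert_inv hE; set k := kk _ in k0 *.
have cn0 : cos (th (X2 z)) != 0 by rewrite gt_eqF// cos_th.
have qn0 : q (Y2 z) != 0 by rewrite gt_eqF// q_gt0.
apply: mk_ext; rewrite !mkE //.
- rewrite -/k (_ : _ * k^-1 * _ = tan (th (X2 z))).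
    rewrite tanK ?in_itv/= ?half_range// /th.
    by rewrite half_inv.
  by rewrite /tan /ht; field; rewrite qn0 cn0 gt_eqF.
- by rewrite -/k; field; rewrite gt_eqF.
Qed.


Let lambert_invK z : disc2 z -> square2 (lambert_inv z) /\ lambert (lambert_inv z) = z.
Proof.
move=> Dz; have c0 := hc_gt0 Dz; have k0 := kk_gt0 c0; have K := kk_sqr c0.
set c := hc z in c0 k0 K *; set k := kk c in k0 K *.
pose w := X2 z * k^-1; pose ze := Y2 z * k^-1.
have kn0 : k != 0 by rewrite gt_eqF.
have wz : w ^+ 2 + ze ^+ 2 = 1 - c ^+ 2.
  have E : pi * (X2 z ^+ 2 + Y2 z ^+ 2) = 1 - c by rewrite /c /hc; ring.
  rewrite /w /ze !exprMn -mulrDl exprVn.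
  apply: (mulIf (x := k ^+ 2)); first by rewrite expf_neq0.
  rewrite divfK ?expf_neq0//.
  apply: (mulfI (x := pi)); first exact: pin0.
  rewrite E -[LHS]mul1r -[X in X * _ = _]K; ring.
have x2 : X2 (lambert_inv z) = 1 / 2 + atan (w * c^-1) * pi^-1 by rewrite /lambert_inv mkE.
have y2 : Y2 (lambert_inv z) = 1 / 2 * (1 + ze) by rewrite /lambert_inv mkE.
have zr : -1 < ze < 1.
  have c2 : 0 < c ^+ 2 by rewrite exprn_gt0.
  by have := sqr_ge0 w => w2; apply/andP; split; nra.
have y01 : 0 < Y2 (lambert_inv z) < 1.
  by rewrite y2; case/andP: zr => ? ?; apply/andP; split; lra.
have x01 : 0 < X2 (lambert_inv z) < 1.
  rewrite x2; set t := atan _.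
  have t1 : - (pi / 2) < t by exact: atan_gtNpi2.
  have t2 : t < pi / 2 by exact: atan_ltpi2.
  rewrite -[X in _ < _ < X](mulfK pin0) -[X in X < _ < _](mul0r pi^-1).
  rewrite (_ : 1 / 2 + t * pi^-1 = (1 / 2 * pi + t) * pi^-1); last by rewrite mulrDl mulfK.
  by rewrite !ltr_pM2r ?invr_gt0//; apply/andP; split; lra.
split; first by [].
have thE : th (X2 (lambert_inv z)) = atan (w * c^-1) by rewrite x2 /th half_inv3.
have zeE : 2 * Y2 (lambert_inv z) - 1 = ze by rewrite y2; field.
have q2 : q (Y2 (lambert_inv z)) ^+ 2 = c ^+ 2 + w ^+ 2 by rewrite q_sqr// zeE; nra.
have q0 := q_gt0 y01.
set Q := q _ in q2 q0 *.
have cE : Q * cos (th (X2 (lambert_inv z))) = c.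
  rewrite thE cos_atan (_ : 1 + (w * c^-1) ^+ 2 = (Q / c) ^+ 2).
    by rewrite sqrtr_sqr gtr0_norm ?divr_gt0// invf_div mulrCA mulfV ?mulr1// gt_eqF.
  by rewrite exprMn exprVn [RHS]exprMn exprVn q2 mulrDl mulfV ?expf_neq0 ?gt_eqF.
have sE : Q * sin (th (X2 (lambert_inv z))) = w.
  have cn0 : cos (th (X2 (lambert_inv z))) != 0 by rewrite gt_eqF// cos_th.
  have -> : sin (th (X2 (lambert_inv z))) = w * c^-1 * cos (th (X2 (lambert_inv z))).
    by rewrite -[w * c^-1]atanK -thE /tan divfK.
  by rewrite mulrCA cE divfK// gt_eqF.
rewrite /lambert /ht -/Q cE -/k sE zeE; apply: mk_ext; rewrite !mkE //.
- by rewrite /w mulrC divfK.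
- by rewrite /ze mulrC divfK.
Qed.

Let smooth_kk (U : set R4) (c : R4 -> R) : open U -> smooth U c -> (forall z, U z -> 0 < c z) ->
  smooth U (fun z => kk (c z)).
Proof.
move=> oU sc c0; have p0 z : U z -> 0 < pi * (1 + c z).
  by move=> /c0 h; rewrite mulr_gt0//; lra.
apply: smooth_sqrtf => // [z /p0|]; first by rewrite invr_gt0.
by apply: smoothV => // [z /p0 h|]; [rewrite gt_eqF|smo].
Qed.

Let smooth_lambert : smooth_rV square2 lambert.
Proof.
have oS := open_square2.
have sq : smooth square2 (fun z => q (Y2 z)).
  apply: smooth_sqrtf => // [z [_ /andP[? ?]]|]; [nra|smo].
have sth : smooth square2 (fun z => th (X2 z)) by rewrite /th; smo.
have sht : smooth square2 (fun z => ht (X2 z) (Y2 z)).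
  by apply: smoothM => //; exact: smooth_fun oS (@smooth_cos R setT) sth.
have sk : smooth square2 (fun z => kk (ht (X2 z) (Y2 z))).
  by apply: smooth_kk => // z [x01 y01]; exact: ht_gt0.
have ssn : smooth square2 (fun z => sin (th (X2 z))).
  exact: smooth_fun oS (@smooth_sin R setT) sth.
by apply: smooth_mk; smo.
Qed.

Let smooth_lambert_inv : smooth_rV disc2 lambert_inv.
Proof.
have oD := open_disc2.
have sh : smooth disc2 hc by rewrite /hc; smo.
have sk : smooth disc2 (fun z => (kk (hc z))^-1).
  apply: smoothV => // [z Dz|]; first by rewrite gt_eqF// kk_gt0// hc_gt0.
  by apply: smooth_kk => // z; exact: hc_gt0.
have sv : smooth disc2 (fun z => (hc z)^-1).
  by apply: smoothV => // z Dz; rewrite gt_eqF// hc_gt0.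
have sa : smooth disc2 (fun z => atan (X2 z * (kk (hc z))^-1 * (hc z)^-1)).
  by apply: smooth_atanf => //; smo.
by apply: smooth_mk; smo.
Qed.

(** [da], [dc], [dk] are the differentials of [Q * S], [c] and [k]. The minors [e1], [e2], [e3] are,
    up to sign, [2 * p] times the components of the normal vector [(Q S, ze, c)] of the unit sphere;
    the choice of [k] makes the remaining factor 1. *)
Let lambert_form (p k Q C S ze c tu yu tv yv : R) :
  C ^+ 2 + S ^+ 2 = 1 -> Q ^+ 2 + ze ^+ 2 = 1 -> Q * C = c -> c != 0 -> Q != 0 -> 1 + c != 0 ->
  k ^+ 2 * (p * (1 + c)) = 1 -> p != 0 ->
  let da t y := - (ze / Q) * (2 * y) * S + Q * (C * (p * t)) in
  let dc t y := - (ze / Q) * (2 * y) * C - Q * (S * (p * t)) in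
  let dk t y := - (1 / 2 * k / (1 + c)) * dc t y in
  (k * da tu yu + Q * S * dk tu yu) * (k * (2 * yv) + ze * dk tv yv) -
  (k * (2 * yu) + ze * dk tu yu) * (k * da tv yv + Q * S * dk tv yv) = tu * yv - yu * tv.
Proof.
move=> CS QZ QC cn0 Qn0 dn0 kE pn0 da dc dk.
pose W := tu * yv - yu * tv.
have e1 : da tu yu * (2 * yv) - 2 * yu * da tv yv = 2 * p * c * W.
  by rewrite /da -QC /W; ring.
have e2 : dc tu yu * (2 * yv) - 2 * yu * dc tv yv = - (2 * p * (Q * S) * W).
  by rewrite /dc /W; ring.
have e3 : da tu yu * dc tv yv - dc tu yu * da tv yv = - (2 * p * ze * W).
  rewrite /da /dc /W -[RHS]mul1r -[X in _ = X * _]CS; field; exact: Qn0.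
have -> : (k * da tu yu + Q * S * dk tu yu) * (k * (2 * yv) + ze * dk tv yv) -
  (k * (2 * yu) + ze * dk tu yu) * (k * da tv yv + Q * S * dk tv yv) =
  k ^+ 2 * ((da tu yu * (2 * yv) - 2 * yu * da tv yv)
   - 1 / 2 / (1 + c) * (ze * (da tu yu * dc tv yv - dc tu yu * da tv yv)
     + Q * S * (dc tu yu * (2 * yv) - 2 * yu * dc tv yv))).
  rewrite /dk; move: (da tu yu) (da tv yv) (dc tu yu) (dc tv yv) => *; field; exact: dn0.
rewrite e1 e2 e3.
have s2 : ze ^+ 2 + (Q * S) ^+ 2 = 1 - c ^+ 2.
  rewrite -QC -QZ !exprMn; transitivity (ze ^+ 2 + Q ^+ 2 * (C ^+ 2 + S ^+ 2) - Q ^+ 2 * C ^+ 2).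
    by ring.
  by rewrite CS; ring.
have -> : 2 * p * c * W - 1 / 2 / (1 + c) *
    (ze * - (2 * p * ze * W) + Q * S * - (2 * p * (Q * S) * W)) =
    p * W * (2 * c + (ze ^+ 2 + (Q * S) ^+ 2) / (1 + c)) by field; exact: dn0.
rewrite s2 -[RHS]mul1r -[X in _ = X * _]kE /W; field; exact: dn0.
Qed.

Let kk_form (p k c x : R) : k ^+ 2 * (p * (1 + c)) = 1 -> p != 0 -> k != 0 -> 1 + c != 0 ->
  (2 * k)^-1 * (- (p * (1 + c))^-1 ^+ 2 * (p * x)) = - (1 / 2 * k / (1 + c)) * x.
Proof.
move=> kE p0 k0 c0; rewrite -[(p * (1 + c))^-1]mul1r -[X in X / (p * _)]kE mulfK ?mulf_neq0//.
rewrite -[RHS]mul1r -[X in _ = X * _]kE; field; exact/andP.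
Qed.

Let lambert_sympl z : square2 z -> forall u v, omega ('D_u lambert z) ('D_v lambert z) = omega u v.
Proof.
move=> [x01 y01] u v.
have Q0 := q_gt0 y01; have c0 := ht_gt0 x01 y01; have k0 := kk_gt0 c0.
have kE := kk_sqr c0.
set Q := q (Y2 z) in Q0; set c := ht _ _ in c0 k0 kE; set k := kk c in k0 kE.
pose ze := 2 * Y2 z - 1; pose C := cos (th (X2 z)); pose S := sin (th (X2 z)).
have dz w : der z w (fun z => 2 * Y2 z - 1) (2 * Y2 w).
  have := derB (derM (der_cst z w 2) (derY2 z w)) (der_cst z w 1).
  by rewrite mulr0 addr0 subr0.
have dq w : der z w (fun z => q (Y2 z)) (- (ze / Q) * (2 * Y2 w)).
  have h0 : 0 < 1 - (2 * Y2 z - 1) ^+ 2 by case/andP: y01 => *; nra.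
  have := der_sqrt h0 (derB (der_cst z w 1) (der_sqr (dz w))).
  rewrite -/(q (Y2 z)) -/Q -/ze sub0r; congr der.
  by field; rewrite gt_eqF.
have dth w : der z w (fun z => th (X2 z)) (pi * X2 w).
  have := derB (derM (der_cst z w pi) (derX2 z w)) (der_cst z w (pi / 2)).
  by rewrite mulr0 addr0 subr0.
have dS w : der z w (fun z => sin (th (X2 z))) (C * (pi * X2 w)) by apply: der_comp.
have dC w : der z w (fun z => cos (th (X2 z))) (- S * (pi * X2 w)) by apply: der_comp.
have da w := derM (dq w) (dS w).
have dht w : der z w (fun z => ht (X2 z) (Y2 z)) (- (ze / Q) * (2 * Y2 w) * C - Q * (S * (pi * X2 w))).
  have := derM (dq w) (dC w); congr der; rewrite -/C -/Q; ring.
have dk w : der z w (fun z => kk (ht (X2 z) (Y2 z)))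
    (- (1 / 2 * k / (1 + c)) * (- (ze / Q) * (2 * Y2 w) * C - Q * (S * (pi * X2 w)))).
  have h0 : 0 < pi * (1 + c) by rewrite mulr_gt0//; lra.
  have h1 : 0 < (pi * (1 + c))^-1 by rewrite invr_gt0.
  have := derM (der_cst z w pi) (derD (der_cst z w 1) (dht w)).
  move=> /(@derV _ _ z w (fun z => pi * (1 + ht (X2 z) (Y2 z))) _ (lt0r_neq0 h0)).
  move=> /(@der_sqrt _ z w (fun z => (pi * (1 + ht (X2 z) (Y2 z)))^-1) _ h1); rewrite -/(kk c) -/k mulr0 addr0 add0r.
  by rewrite -/c kk_form// gt_eqF//; lra.
have D w := derive_mk (derX1 z w) (derM (dk w) (da w)) (derY1 z w) (derM (dk w) (dz w)).
rewrite !D !omegaE !mkE; congr (_ + _).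
rewrite -/C -/S -/Q -/ze -/c -/k.
have := @lambert_form pi k Q C S ze c (X2 u) (Y2 u) (X2 v) (Y2 v).
rewrite cos2Dsin2 q_sqr// subrK => /(_ erefl erefl erefl).
rewrite !gt_eqF//; last by lra.
move=> /(_ isT isT isT kE isT) /= <-.
have e w : Q * (C * (pi * X2 w)) + S * (- (ze / Q) * (2 * Y2 w)) =
  - (ze / Q) * (2 * Y2 w) * S + Q * (C * (pi * X2 w)) by rewrite addrC [S * _]mulrC.
by rewrite !e.
Qed.

Lemma lambert_pair : sympl_pair square2 disc2 lambert lambert_inv.
Proof.
by split; [exact: lambertK|exact: lambert_invK|exact: smooth_lambert|
  exact: smooth_lambert_inv|exact: lambert_sympl].
Qed.

(** The left side is [ht ^+ 2], and [ht] is [q] times a cosine, where [q ^+ 2 = 4 y (1 - y)]. A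
    radial function is thereby bounded by a function of [y] alone, which is how a radial width fits
    under a profile. *)
Lemma lambert_inv_height z : disc2 z -> (1 - pi * (X2 z ^+ 2 + Y2 z ^+ 2)) ^+ 2 <=
  4 * (Y2 (lambert_inv z) * (1 - Y2 (lambert_inv z))).
Proof.
move=> /lambert_invK[Sw e]; rewrite -[X in (1 - pi * (X2 X ^+ 2 + _)) ^+ 2]e -[X in (1 - pi * (_ + Y2 X ^+ 2)) ^+ 2]e.
set w := lambert_inv z in Sw *; rewrite -/(hc (lambert w)) lambert_height//.
have [x01 y01] := Sw; have := cos2Dsin2 (th (X2 w)) => CS.
have s0 := sqr_ge0 (sin (th (X2 w))); have q0 := sqr_ge0 (q (Y2 w)).
rewrite /ht exprMn; apply: le_trans (_ : q (Y2 w) ^+ 2 * 1 <= _).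
  by apply: ler_wpM2l => //; lra.
by rewrite mulr1 q_sqr//; nra.
Qed.

Lemma lambert_inv_base z w : X2 z = X2 w -> Y2 z = Y2 w -> Y2 (lambert_inv z) = Y2 (lambert_inv w).
Proof. by move=> x y; rewrite /lambert_inv !mkE /hc x y. Qed.

Lemma lambert_passive z : [/\ X1 (lambert z) = X1 z, Y1 (lambert z) = Y1 z,
  X1 (lambert_inv z) = X1 z & Y1 (lambert_inv z) = Y1 z].
Proof. by rewrite /lambert /lambert_inv !mkE. Qed.

End Lambert.


(** * Folding the half strip *)

Section Cutoffs.
Context {R : realType}.

Lemma near_lt (c x : R) : x < c -> \near x, x < c.
Proof. exact: lt_nbhsl. Qed.

Lemma near_gt (c x : R) : c < x -> \near x, c < x.
Proof. exact: lt_nbhsr. Qed.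

Lemma smooth_bounded_on (h : R -> R) a b : smooth setT h ->
  exists2 C : R, 0 < C & forall x, a <= x <= b -> `|h x| <= C.
Proof.
move=> sh; have [ab|ba] := leP a b; last first.
  by exists 1 => // x /andP[xa xb]; lra.
have ch : {within `[a, b], continuous (fun x => `|h x|)}.
  apply: continuous_subspaceT => x; apply: cvg_norm.
  exact: (smooth_continuous sh).
have [c cab cM] := EVT_max ab ch.
exists (`|h c| + 1) => [|x xab]; first by rewrite ltr_wpDl.
by rewrite (le_trans (cM x _)) ?lerDl.
Qed.

Lemma der_var (x : R) : der x 1 (fun x => x) 1.
Proof. by split; [exact: smooth_diff (@smooth_id R setT) I|exact: derive_id]. Qed.

Lemma slow_cutoff : exists lam : R -> R, exists2 L : R, 1 <= L &
  [/\ smooth setT lam, forall x, `|lam x| <= 1, forall x, `|'D_1 lam x| <= 1 / 4,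
   forall x, x <= 1 -> lam x = 1 /\ 'D_1 lam x = 0 &
   forall x, L <= x -> lam x = 0 /\ 'D_1 lam x = 0].
Proof.
have [C C0 CE] := smooth_bounded_on 0 1 (smooth_derive1 (@smooth_step R)).
have DC x : `|'D_1 (@step R) x| <= C.
  have [x0|x0] := ltP x 0.
    rewrite (@derive_flat_region R _ 0) ?normr0 ?ltW//.
    by near=> y; rewrite step0// ltW//; near: y; exact: near_lt.
  have [x1|x1] := ltP 1 x.
    rewrite (@derive_flat_region R _ 1) ?normr0 ?ltW//.
    by near=> y; rewrite step1// ltW//; near: y; exact: near_gt.
  by apply: CE; rewrite x0.
pose l := 4 * C; have l0 : 0 < l by rewrite mulr_gt0.
pose lam x := 1 - step ((x - 2) * l^-1).
exists lam, (l + 3); first lra.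
have slam : smooth setT lam.
  by apply: smoothB; [exact: openT|smo|apply: (smooth_fun openT (@smooth_step R)); smo].
have lam1 x : x < 2 -> lam x = 1.
  by move=> x2; rewrite /lam step0 ?subr0// mulr_le0_ge0 ?invr_ge0 ?ltW//; lra.
have lam0 x : l + 2 < x -> lam x = 0.
  by move=> x2; rewrite /lam step1 ?subrr// ler_pdivlMr// mul1r; lra.
split=> //.
- move=> x; rewrite /lam; have := step_ge0 ((x - 2) * l^-1); have := step_le1 ((x - 2) * l^-1).
  by move=> h1 h2; rewrite ler_norml; apply/andP; split; lra.
- move=> x; pose t := (x - 2) * l^-1.
  have d0 : der x 1 (fun x : R => (x - 2) * l^-1) l^-1.
    have := derM (derB (der_var x) (der_cst x 1 2)) (der_cst x 1 l^-1).
    by rewrite mulr0 add0r subr0 mulr1.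
  have := derB (der_cst x 1 1) (@der_comp _ _ x 1 step
    (fun x => (x - 2) * l^-1) _ _ (is_derive_smooth (@smooth_step R) (I : setT t)) d0).
  move=> [_ ->]; rewrite sub0r normrN normrM [`|l^-1|]gtr0_norm ?invr_gt0//.
  by rewrite ler_pdivrMr// /l; have := DC t; lra.
- move=> x x1; rewrite lam1; last lra.
  split=> //; apply: (@derive_flat_region R _ 1).
  by near=> y; apply: lam1; near: y; apply: near_lt; lra.
- move=> x x1; rewrite lam0; last lra.
  split=> //; apply: (@derive_flat_region R _ 0).
  by near=> y; apply: lam0; near: y; apply: near_gt; lra.
Unshelve. all: by end_near. Qed.

(** [E] measures the failure of [N] to be homogeneous of degree 2. It vanishes where [N] is
    [t ^+ 2 / 2] and where [N] is 0, so it is bounded together with its derivative, and [k] is taken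
    small against all the bounds. *)
Lemma fold_profile : exists N : R -> R, exists2 k : R, 0 < k <= 1 / 8 &
  let E := fun t => 2 * N t - t * 'D_1 N t in
  [/\ smooth setT N, forall t, 0 <= t -> N t = 0 /\ 'D_1 N t = 0,
   forall t, t <= -1 -> N t = t ^+ 2 / 2 /\ 'D_1 N t = t,
   forall t, k * `|E t| <= 1 / 8 /\ k * `|'D_1 E t| <= 1 / 8 &
   forall t, -1 <= t -> k * `|'D_1 N t| <= 1 / 8].
Proof.
pose N (t : R) := t ^+ 2 / 2 * (1 - step (4 * t + 2)).
have sN : smooth setT N.
  apply: smoothM; [exact: openT|smo|apply: smoothB; [exact: openT|smo|]].
  by apply: (smooth_fun openT (@smooth_step R)); smo.
pose E := fun t => 2 * N t - t * 'D_1 N t.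
have sE : smooth setT E by rewrite /E; smo.
have N0 t : - (1 / 4) < t -> N t = 0.
  by move=> t0; rewrite /N step1 ?subrr ?mulr0//; lra.
have N1 t : t < - (1 / 2) -> N t = t ^+ 2 / 2.
  by move=> t0; rewrite /N step0 ?subr0 ?mulr1//; lra.
have DN0 t : - (1 / 4) < t -> 'D_1 N t = 0.
  move=> t0; apply: (@derive_flat_region R _ 0).
  by near=> y; apply: N0; near: y; exact: near_gt.
have DN1 (t : R) : t < - (1 / 2) -> 'D_1 N t = t.
  move=> t0; rewrite (near_eq_derive _ (g := fun t : R => t ^+ 2 / 2)); last first.
    by near=> y; apply: N1; near: y; exact: near_lt.
  have := derM (der_sqr (der_var t)) (der_cst t 1 2^-1).
  by move=> [_ ->]; field.
have E0 t : - (1 / 4) < t -> E t = 0 by move=> t0; rewrite /E N0// DN0// !mulr0 subrr.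
have E1 t : t < - (1 / 2) -> E t = 0 by move=> t0; rewrite /E N1// DN1//; field.
have Ez t : t < -1 \/ 0 < t -> E t = 0 /\ 'D_1 E t = 0.
  move=> [t0|t0]; (split; [(apply: E1; lra) || (apply: E0; lra)|apply: (@derive_flat_region R _ 0)]).
    by near=> y; apply: E1; near: y; apply: near_lt; lra.
  by near=> y; apply: E0; near: y; apply: near_gt; lra.
have [C1 C10 C1E] := smooth_bounded_on (-1) 0 sE.
have [C2 C20 C2E] := smooth_bounded_on (-1) 0 (smooth_derive1 sE).
have [C3 C30 C3E] := smooth_bounded_on (-1) 0 (smooth_derive1 sN).
pose C := 1 + C1 + C2 + C3; have C0 : 0 < C by rewrite /C; lra.
have kE x : 0 <= x -> x <= C -> (8 * C)^-1 * x <= 1 / 8.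
  by move=> x0 xC; rewrite mulrC ler_pdivrMr ?mulr_gt0//; lra.
exists N, (8 * C)^-1.
  by rewrite invr_gt0 mulr_gt0//= -[leLHS]mulr1; apply: kE; rewrite /C; lra.
split=> //.
- by move=> t t0; split; [apply: N0|apply: DN0]; lra.
- by move=> t t0; split; [apply: N1|apply: DN1]; lra.
- move=> t; rewrite -/(E t) -/E; have [t0|t0] := ltP t (-1).
    by have [-> ->] := Ez t (or_introl t0); rewrite normr0 mulr0; split; lra.
  have [t1|t1] := ltP 0 t.
    by have [-> ->] := Ez t (or_intror t1); rewrite normr0 mulr0; split; lra.
  by split; apply: kE => //; [have := C1E t|have := C2E t]; rewrite t0 t1 => /(_ isT);
    rewrite /C; lra.
- move=> t t0; have [t1|t1] := ltP 0 t; first by rewrite DN0 ?normr0 ?mulr0; lra.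
  by apply: kE => //; have := C3E t; rewrite t0 t1 => /(_ isT); rewrite /C; lra.
Unshelve. all: by end_near. Qed.

End Cutoffs.


(** * The generating function of the fold *)

Section Fold.
Context {R : realType}.
Notation R4 := 'rV[R]_(2 + 2).

Definition half_strip : set R4 := [set z | 0 < X1 z < 1 /\ 0 < Y1 z].

Lemma open_half_strip : open half_strip.
Proof.
rewrite (_ : half_strip = ([set z | 0 < X1 z] `&` [set z | X1 z < 1]) `&` [set z | 0 < Y1 z]).
  by repeat apply: openI; apply: open_smooth_lt; smo.
apply/seteqP; split=> z; first by move=> [/andP[? ?] ?]; do !split.
by move=> [[? ?] ?]; split=> //; apply/andP.
Qed.

Variables (lam N : R -> R) (L k : R).
Hypotheses (L1 : 1 <= L) (k01 : 0 < k <= 1 / 8).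
Hypotheses (slam : smooth setT lam) (lam_le : forall x, `|lam x| <= 1).
Hypothesis dlam_le : forall x, `|'D_1 lam x| <= 1 / 4.
Hypothesis lam_low : forall x, x <= 1 -> lam x = 1 /\ 'D_1 lam x = 0.
Hypothesis lam_high : forall x, L <= x -> lam x = 0 /\ 'D_1 lam x = 0.
Let E (t : R) : R := 2 * N t - t * 'D_1 N t.
Hypothesis sN : smooth setT N.
Hypothesis N_high : forall t, 0 <= t -> N t = 0 /\ 'D_1 N t = 0.
Hypothesis N_low : forall t, t <= -1 -> N t = t ^+ 2 / 2 /\ 'D_1 N t = t.
Hypothesis E_le : forall t, k * `|E t| <= 1 / 8 /\ k * `|'D_1 E t| <= 1 / 8.
Hypothesis dN_le : forall t, -1 <= t -> k * `|'D_1 N t| <= 1 / 8.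

(** The width vanishes at [x = 0] and [x = 1], so that the interpolation displaces [X] from [x] only
    by a fraction of [x * (1 - x)] and cannot leave the strip. *)
Let w (x : R) : R := k * (x * (1 - x)).
Let dw (x : R) : R := k * (1 - 2 * x).
Let tt (x q : R) : R := (q - 1) * (w x)^-1.
(* [S] generates [(x, y) |-> (X, Y)] through [y = dS/dx], [X = dS/dq] and
   [q = X + Y].  For [q <= 1 - w x] it gives [(X, Y) = (y, 1 - x)], for [L <= q]
   the identity; [N] glues the two regimes with the width [w] so small that
   [Sxq = d^2 S / dx dq] stays positive. *)
Let S (x q : R) : R := x * q - x ^+ 2 / 2 + lam q * (x ^+ 2 - x) + w x ^+ 2 * N (tt x q).
Let Sx (x q : R) : R := q - x + lam q * (2 * x - 1) + w x * dw x * E (tt x q).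
Let Sq (x q : R) : R := x + 'D_1 lam q * (x ^+ 2 - x) + w x * 'D_1 N (tt x q).
Let Sxx (x q : R) : R := 2 * lam q - 1 + (dw x ^+ 2 - 2 * k * w x) * E (tt x q)
  - dw x ^+ 2 * tt x q * 'D_1 E (tt x q).
Let Sxq (x q : R) : R := 1 + 'D_1 lam q * (2 * x - 1) + dw x * 'D_1 E (tt x q).
Let Sqq (x q : R) : R := 'D_1 ('D_1 lam) q * (x ^+ 2 - x) + 'D_1 ('D_1 N) (tt x q).

Let sE : smooth setT E. Proof. by rewrite /E; smo. Qed.
Let k0 : 0 < k. Proof. by case/andP: k01. Qed.

Let dE (t : R) : 'D_1 E t = 'D_1 N t - t * 'D_1 ('D_1 N) t.
Proof.
have d1 : der t 1 N ('D_1 N t) by apply: der_smooth sN I.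
have d2 : der t 1 ('D_1 N) ('D_1 ('D_1 N) t) by apply: (der_smooth _ (smooth_derive1 sN) I).
have [_ ->] := derB (derM (der_cst t 1 2) d1) (derM (der_var t) d2).
by rewrite mulr0 addr0 mulr1; ring.
Qed.

Let w_gt0 x : 0 < x < 1 -> 0 < w x.
Proof. by move=> /andP[x0 x1]; rewrite mulr_gt0// mulr_gt0//; lra. Qed.

Let w_le x : 0 < x < 1 -> w x <= x * (1 - x) / 8.
Proof.
move=> /andP[x0 x1]; rewrite /w mulrC ler_wpM2l//; first by nra.
by case/andP: k01; lra.
Qed.

Section Derivatives.
Context {V : normedModType R} (z v : V) (x q : V -> R) (a b : R).
Hypotheses (x01 : 0 < x z < 1) (dx : der z v x a) (dq : der z v q b).

Let wn0 : w (x z) != 0. Proof. by rewrite gt_eqF// w_gt0. Qed.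

Let der_w : der z v (fun z => w (x z)) (dw (x z) * a).
Proof.
have := derM (der_cst z v k) (derM dx (derB (der_cst z v 1) dx)).
by congr der; rewrite /dw; ring.
Qed.

Let der_dw : der z v (fun z => dw (x z)) (- (2 * k) * a).
Proof.
have := derM (der_cst z v k) (derB (der_cst z v 1) (derM (der_cst z v 2) dx)).
by congr der; ring.
Qed.

Let der_tt : der z v (fun z => tt (x z) (q z)) ((w (x z))^-1 * (b - tt (x z) (q z) * dw (x z) * a)).
Proof.
have := derM (derB dq (der_cst z v 1)) (@derV _ _ z v (fun z => w (x z)) _ wn0 der_w).
by congr der; rewrite /tt; field.
Qed.

Let der_fun (h : R -> R) (f : V -> R) c : smooth setT h -> der z v f c ->
  der z v (fun z => h (f z)) ('D_1 h (f z) * c).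
Proof. by move=> sh df; apply: (@der_comp _ _ z v h f _ _ (is_derive_smooth sh I) df). Qed.

Let dquad : der z v (fun z => x z ^+ 2 - x z) ((2 * x z - 1) * a).
Proof. by have := derB (der_sqr dx) dx; congr der; ring. Qed.

Lemma der_S : der z v (fun z => S (x z) (q z)) (Sx (x z) (q z) * a + Sq (x z) (q z) * b).
Proof.
have := derD (derD (derB (derM dx dq) (derM (der_sqr dx) (der_cst z v 2^-1)))
  (derM (der_fun slam dq) dquad)) (derM (der_sqr der_w) (der_fun sN der_tt)).
congr der; rewrite /Sx /Sq /E; move: wn0 (tt _ _) => w0 t; field; exact: w0.
Qed.

Lemma der_Sx : der z v (fun z => Sx (x z) (q z)) (Sxx (x z) (q z) * a + Sxq (x z) (q z) * b).
Proof.
have := derD (derD (derB dq dx)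
  (derM (der_fun slam dq) (derB (derM (der_cst z v 2) dx) (der_cst z v 1))))
  (derM (derM der_w der_dw) (der_fun sE der_tt)).
congr der; rewrite /Sxx /Sxq; move: wn0 (tt _ _) => w0 t; field; exact: w0.
Qed.

Lemma der_Sq : der z v (fun z => Sq (x z) (q z)) (Sxq (x z) (q z) * a + Sqq (x z) (q z) * b).
Proof.
have := derD (derD dx (derM (der_fun (smooth_derive1 slam) dq) dquad))
  (derM der_w (der_fun (smooth_derive1 sN) der_tt)).
congr der; rewrite /Sxq /Sqq dE; move: (tt _ _) => t; move: (w _) wn0 => y w0.
move: (x z) (q z) ('D_1 lam _) ('D_1 ('D_1 lam) _) ('D_1 N _) ('D_1 ('D_1 N) _) (dw _) => *.
field; exact: w0.
Qed.

End Derivatives.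

(** The bounds on ['D_1 lam] and [k * 'D_1 E] leave at least [5 / 8]. Positivity makes [Sx]
    increasing in [q] and [Sq] increasing in [x], which inverts the generating relations in both
    directions. *)
Let Sxq_gt0 (x q : R) : 0 < x < 1 -> 0 < Sxq x q.
Proof.
move=> /andP[x0 x1].
have h1 : `|'D_1 lam q * (2 * x - 1)| <= 1 / 4.
  rewrite -[leRHS]mulr1 normrM ler_pM//.
  by rewrite ler_norml; apply/andP; split; lra.
have h2 : `|dw x * 'D_1 E (tt x q)| <= 1 / 8.
  have [_ h] := E_le (tt x q); apply: le_trans h.
  rewrite normrM ler_wpM2r// /dw normrM (gtr0_norm k0) -[leRHS]mulr1 ler_wpM2l ?(ltW k0)//.
  by rewrite ler_norml; apply/andP; split; lra.
by move: h1 h2; rewrite !ler_norml /Sxq => /andP[? ?] /andP[? ?]; lra.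
Qed.

Let der_is_derive (f : R -> R) (x a : R) : der x 1 f a -> is_derive x 1 f a.
Proof. by move=> [df <-]; apply: DeriveDef => //; exact: diff_derivable. Qed.

Let is_derive_Sx (x q : R) : 0 < x < 1 -> is_derive q 1 (Sx x) (Sxq x q).
Proof.
move=> x01; apply: der_is_derive.
have := @der_Sx R q 1 (fun=> x) (fun q => q) 0 1 x01 (der_cst q 1 x) (der_var q).
by rewrite mulr0 add0r mulr1.
Qed.

Let is_derive_Sq (x q : R) : 0 < x < 1 -> is_derive x 1 (fun x => Sq x q) (Sxq x q).
Proof.
move=> x01; apply: der_is_derive.
have := @der_Sq R x 1 (fun x => x) (fun=> q) 1 0 x01 (der_var x) (der_cst x 1 q).
by rewrite mulr0 addr0 mulr1.
Qed.

Let Sx_incr (x q q' : R) : 0 < x < 1 -> q < q' -> Sx x q < Sx x q'.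
Proof.
move=> x01 qq'; apply: (@strict_incr R (Sx x) (Sxq x) q q' qq') => t _.
  exact: is_derive_Sx.
exact: Sxq_gt0.
Qed.

Let Sq_incr (q x x' : R) : 0 < x -> x' < 1 -> x < x' -> Sq x q < Sq x' q.
Proof.
move=> x0 x1 xx'.
apply: (@strict_incr R (fun x => Sq x q) (fun x => Sxq x q) x x' xx') => t /andP[? ?].
  by apply: is_derive_Sq; apply/andP; split; lra.
by apply: Sxq_gt0; apply/andP; split; lra.
Qed.

Let Sx_inj (x q q' : R) : 0 < x < 1 -> Sx x q = Sx x q' -> q = q'.
Proof.
by move=> x01 e; have [/(Sx_incr x01)|/(Sx_incr x01)|//] := ltgtP q q'; rewrite e ltxx.
Qed.

Let Sq_inj (q x x' : R) : 0 < x < 1 -> 0 < x' < 1 -> Sq x q = Sq x' q -> x = x'.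
Proof.
move=> /andP[x0 x1] /andP[x0' x1'] e.
by have [/(@Sq_incr q _ _ x0 x1')|/(@Sq_incr q _ _ x0' x1)|//] := ltgtP x x'; rewrite e ltxx.
Qed.

(** For [tt <= -1] the term [w ^+ 2 * N tt] is [(q - 1) ^+ 2 / 2], from which the width has dropped
    out. *)
Let low (x q : R) : 0 < x < 1 -> q <= 1 - w x ->
  [/\ Sx x q = q + x - 1, Sq x q = q + x - 1 & S x q = x * q + x ^+ 2 / 2 - x + (q - 1) ^+ 2 / 2].
Proof.
move=> x01 ql; have w0 := w_gt0 x01; have wn0 : w x != 0 by rewrite gt_eqF.
have t1 : tt x q <= -1 by rewrite /tt ler_pdivrMr//; lra.
have [l1 l2] : lam q = 1 /\ 'D_1 lam q = 0 by apply: lam_low; lra.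
have [n1 n2] := N_low t1.
rewrite /Sx /Sq /S /E n1 n2 l1 l2 /tt; move: (w x) wn0 => y y0.
by split; field.
Qed.

Let high (x q : R) : 0 < x < 1 -> L <= q -> Sx x q = q - x /\ Sq x q = x.
Proof.
move=> x01 qL; have w0 := w_gt0 x01.
have t1 : 0 <= tt x q by apply: divr_ge0; [have := L1; lra|exact: ltW].
have [l1 l2] := lam_high qL; have [n1 n2] := N_high t1.
by rewrite /Sx /Sq /E n1 n2 l1 l2; split; ring.
Qed.

Let middle (x q : R) : 0 < x < 1 -> 1 - w x <= q -> `|Sq x q - x| <= 3 / 8 * (x * (1 - x)).
Proof.
move=> x01 ql; have w0 := w_gt0 x01; case/andP: (x01) => x0 x1.
have xx0 : 0 <= x * (1 - x) by nra.
have t1 : -1 <= tt x q by rewrite /tt ler_pdivlMr//; lra.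
have h1 : `|'D_1 lam q * (x ^+ 2 - x)| <= 1 / 4 * (x * (1 - x)).
  rewrite normrM ler_pM//.
  by rewrite ler0_norm; nra.
have h2 : `|w x * 'D_1 N (tt x q)| <= 1 / 8 * (x * (1 - x)).
  rewrite normrM (gtr0_norm w0) /w mulrAC ler_wpM2r//; exact: dN_le.
have -> : Sq x q - x = 'D_1 lam q * (x ^+ 2 - x) + w x * 'D_1 N (tt x q) by rewrite /Sq; ring.
by apply: le_trans (ler_normD _ _) _; lra.
Qed.

Let Sx_solve (x y : R) : 0 < x < 1 -> exists q, Sx x q = y.
Proof.
move=> x01; case/andP: (x01) => x0 x1.
have B q : q - 4 <= Sx x q <= q + 4.
  have h1 : `|lam q * (2 * x - 1)| <= 1.
    rewrite -[leRHS]mulr1 normrM ler_pM//.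
    by rewrite ler_norml; apply/andP; split; lra.
  have h2 : `|w x * dw x * E (tt x q)| <= 1.
    have [h _] := E_le (tt x q).
    have wl := w_le x01; have w0 := w_gt0 x01; have kk := k01.
    have e : `|w x * dw x| <= k.
      rewrite normrM (gtr0_norm w0) /dw normrM (gtr0_norm k0).
      rewrite -[leRHS]mul1r; apply: ler_pM; [exact: ltW|by rewrite mulr_ge0// ltW|nra|].
      by rewrite -[leRHS]mulr1 ler_wpM2l ?(ltW k0)// ler_norml; apply/andP; split; lra.
    rewrite normrM; apply: le_trans (ler_wpM2r _ e) _ => //; lra.
  by move: h1 h2; rewrite /Sx !ler_norml => /andP[? ?] /andP[? ?]; apply/andP; split; lra.
have [|||c _ cE] := @IVT R (Sx x) (y - 4) (y + 4) y.
- by lra.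
- apply: derivable_within_continuous => q _.
  exact: (@ex_derive _ _ _ _ _ _ _ (is_derive_Sx q x01)).
- rewrite ge_min le_max; have /andP[? ?] := B (y - 4); have /andP[? ?] := B (y + 4).
  by apply/andP; split; apply/orP; [left|right]; lra.
by exists c.
Qed.

Let Sq_solve (X H : R) : 0 < X < 1 -> 0 < H -> exists2 x, 0 < x < 1 & Sq x (X + H) = X.
Proof.
move=> /andP[X0 X1] H0; set q := X + H; have qE : q = X + H by [].
have lo : 0 < X / 2 < 1 /\ Sq (X / 2) q <= X.
  have a01 : 0 < X / 2 < 1 by apply/andP; split; lra.
  split=> //; have [ql|ql] := leP q (1 - w (X / 2)).
    by have [_ -> _] := low a01 ql; have := w_gt0 a01; lra.
  have := middle a01 (ltW ql); rewrite ler_norml => /andP[_ ?]; nra.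
have [b [ab b01 hi]] : exists b, [/\ X / 2 <= b, 0 < b < 1 & X <= Sq b q].
  have [q1|q1] := leP 1 q.
    (* The solution of [X = b - (1 - b) / 4]; the slope bound [1 / 4] gives
       [Sq b q >= b - b * (1 - b) / 4], which is no smaller. *)
    exists ((4 * X + 1) / 5); have b01 : 0 < (4 * X + 1) / 5 < 1 by apply/andP; split; lra.
    split=> //; [by lra|set b := _ / 5 in b01 *].
    have w0 := w_gt0 b01.
    have t1 : 0 <= tt b q by apply: divr_ge0; [lra|exact: ltW].
    have [_ n2] := N_high t1; rewrite /Sq n2 mulr0 addr0.
    have := dlam_le q; rewrite ler_norml => /andP[d1 d2].
    have eb : X = (5 * b - 1) / 4 by rewrite /b; field.
    case/andP: b01 => b0 b1.
    have h1 : 0 <= (1 / 4 - 'D_1 lam q) * (b - b ^+ 2) by apply: mulr_ge0; [lra|nra].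
    have h2 := sqr_ge0 (b - 1).
    by rewrite eb; move: ('D_1 lam q) h1 h2 => D h1 h2; lra.
  (* In the regime of [low], [Sq b q = X + H + b - 1], so [1 - H <= b] is what has to hold; [q <= b]
     ensures this regime because [w b <= 1 - b]. *)
  pose b := Num.max (1 - H) q; have [m1 m2] : 1 - H <= b /\ q <= b by rewrite !le_max !lexx orbT.
  have b1 : b < 1 by rewrite gt_max; apply/andP; split; lra.
  have b01 : 0 < b < 1 by rewrite b1 andbT; lra.
  exists b; split=> //; first by lra.
  have ql : q <= 1 - w b by have := w_le b01; nra.
  by have [_ -> _] := low b01 ql; lra.
have [a01 lo1] := lo; case/andP: b01 => b0 b1.
have [||c] := @IVT R (fun x => Sq x q) (X / 2) b X ab.
- apply: derivable_within_continuous => x; rewrite in_itv/= => /andP[x0 x1].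
  have x01 : 0 < x < 1 by case/andP: a01 => ? ?; apply/andP; split; lra.
  exact: (@ex_derive _ _ _ _ _ _ _ (is_derive_Sq q x01)).
- by rewrite ge_min le_max lo1 hi orbT.
rewrite in_itv/= => /andP[c0 c1] cE; exists c => //.
by case/andP: a01 => ? ?; apply/andP; split; lra.
Qed.


Let smooth_w (V : normedModType R) (U : set V) (x : V -> R) : open U -> smooth U x ->
  smooth U (fun z => w (x z)).
Proof. by move=> oU sx; rewrite /w; smo. Qed.

Let smooth_tt (V : normedModType R) (U : set V) (x q : V -> R) : open U ->
  smooth U x -> smooth U q -> (forall z, U z -> 0 < x z < 1) -> smooth U (fun z => tt (x z) (q z)).
Proof.
move=> oU sx sq x01; apply: smoothM => //; first by smo.
by apply: smoothV => //; [move=> z /x01 /w_gt0 /lt0r_neq0|exact: smooth_w].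
Qed.

Let smooth_S (V : normedModType R) (U : set V) (x q : V -> R) : open U ->
  smooth U x -> smooth U q -> (forall z, U z -> 0 < x z < 1) ->
  [/\ smooth U (fun z => S (x z) (q z)), smooth U (fun z => Sx (x z) (q z)) &
      smooth U (fun z => Sq (x z) (q z))].
Proof.
move=> oU sx sq x01; have st := smooth_tt oU sx sq x01; have sw := smooth_w oU sx.
have sdw : smooth U (fun z => dw (x z)) by rewrite /dw; smo.
have s1 : smooth U (fun z => lam (q z)) by smo.
have s2 : smooth U (fun z => 'D_1 lam (q z)) by smo.
have s3 : smooth U (fun z => N (tt (x z) (q z))) by apply: (smooth_fun oU sN).
have s4 : smooth U (fun z => 'D_1 N (tt (x z) (q z))).
  by apply: (smooth_fun oU (smooth_derive1 sN)).
have s5 : smooth U (fun z => E (tt (x z) (q z))) by apply: (smooth_fun oU sE).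
by split; rewrite /S /Sx /Sq; smo.
Qed.

Let qq (x y : R) : R := xget 0 [set q | Sx x q = y].
Let xx (X q : R) : R := xget 0 [set x | 0 < x < 1 /\ Sq x q = X].

Let qqE (x y : R) : 0 < x < 1 -> Sx x (qq x y) = y.
Proof. by move=> x01; exact: (xgetPex 0 (Sx_solve y x01)). Qed.

Let qq_uniq (x y q : R) : 0 < x < 1 -> Sx x q = y -> qq x y = q.
Proof. by move=> x01 <-; apply: (Sx_inj x01); exact: qqE. Qed.

Let xxE (X H : R) : 0 < X < 1 -> 0 < H ->
  0 < xx X (X + H) < 1 /\ Sq (xx X (X + H)) (X + H) = X.
Proof.
move=> X01 H0; have [x x01 xE] := Sq_solve X01 H0.
by apply: (@xgetPex _ 0 [set x | 0 < x < 1 /\ Sq x (X + H) = X]); exists x.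
Qed.

Let xx_uniq (x q : R) : 0 < x < 1 -> xx (Sq x q) q = x.
Proof.
move=> x01; have [] // := @xgetPex _ 0 [set t | 0 < t < 1 /\ Sq t q = Sq x q].
  by exists x.
by move=> h1 h2; exact: Sq_inj h1 x01 h2.
Qed.

(** In the regime of [low] the quantities [y] and [X] coincide and [Y = 1 - x]; beyond it [X] is
    close to [x]. With [backward] this shows that the half strip is mapped onto itself. *)
Let forward (x q : R) : 0 < x < 1 -> 0 < Sx x q -> 0 < Sq x q < 1 /\ 0 < q - Sq x q.
Proof.
move=> x01 y0; have w0 := w_gt0 x01; have wl := w_le x01; case/andP: (x01) => x0 x1.
have [ql|ql] := leP q (1 - w x).
  have [e1 e2 _] := low x01 ql; rewrite e2; rewrite e1 in y0.
  by split; [apply/andP; split|]; lra.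
have := middle x01 (ltW ql); rewrite ler_norml => /andP[h1 h2].
by split; [apply/andP; split|]; nra.
Qed.

Let backward (x q : R) : 0 < x < 1 -> 0 < Sq x q -> 0 < Sx x q.
Proof.
move=> x01 X0; have w0 := w_gt0 x01; have wl := w_le x01; case/andP: (x01) => x0 x1.
have [ql|ql] := leP q (1 - w x).
  by have [-> e2 _] := low x01 ql; rewrite e2 in X0.
have := Sx_incr x01 ql; have [-> _ _] := low x01 (lexx (1 - w x)); nra.
Qed.

Let bound (x q : R) : 0 < x < 1 -> 0 < Sq x q -> (Sx x q < L) = (q - Sq x q < L).
Proof.
move=> x01 X0; have [qL|qL] := leP L q; first by have [-> ->] := high x01 qL.
have h1 : Sx x q < L.
  have := Sx_incr x01 qL; have [-> _] := high x01 (lexx L); case/andP: x01 => *; lra.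
have h2 : q - Sq x q < L by lra.
by rewrite h1 h2.
Qed.

Let far (x y : R) : 0 < x < 1 -> L <= y ->
  [/\ qq x y = x + y, Sq x (x + y) = x & S x (x + y) = x * (x + y) - x ^+ 2 / 2].
Proof.
move=> x01 yL; case/andP: (x01) => x0 x1; have w0 := w_gt0 x01.
have qL : L <= x + y by lra.
have [e1 e2] := high x01 qL; split=> //.
  by apply: qq_uniq; rewrite // e1 addrC addKr.
have t1 : 0 <= tt x (x + y) by apply: divr_ge0; [have := L1; lra|exact: ltW].
have [l1 _] := lam_high qL; have [n1 _] := N_high t1.
by rewrite /S l1 n1; ring.
Qed.

(** Heights below [x / 2] fall into the regime of [low], since [w x <= x / 2], and there the map is
    exactly a quarter turn. The two sides of a kink are glued in this region. *)
Let door (x y : R) : 0 < x < 1 -> 0 < y < x / 2 ->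
  [/\ qq x y = y + 1 - x, Sq x (y + 1 - x) = y &
      S x (y + 1 - x) = y ^+ 2 / 2].
Proof.
move=> x01 /andP[y0 yx]; have wl := w_le x01; case/andP: (x01) => x0 x1.
have ql : y + 1 - x <= 1 - w x by nra.
have [e1 e2 e3] := low x01 ql; split.
- by apply: qq_uniq => //; rewrite e1; ring.
- by rewrite e2; ring.
- by rewrite e3; field.
Qed.

Let fq z := qq (X1 z) (Y1 z).
Let fx z := Sq (X1 z) (fq z).
Let fy z := fq z - fx z.
Let bq (z : R4) := X1 z + Y1 z.
Let bx z := xx (X1 z) (bq z).
Let by_ z := Sx (bx z) (bq z).

Let fold z := mk (fx z) (X2 z) (fy z) (Y2 z).
Let unfold z := mk (bx z) (X2 z) (by_ z) (Y2 z).
(* The primitive of [y dx - Y dX]. *)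
Let act z := S (X1 z) (fq z) - fq z * fx z + fx z ^+ 2 / 2.

Let sfq : smooth half_strip fq.
Proof.
have oW : open [set p : R4 * R | half_strip p.1 /\ setT p.2].
  exact: openI (open_comp (fun q _ => cvg_fst) open_half_strip) (open_comp (fun q _ => cvg_snd) openT).
apply: (@smooth_implicit R R4 _ setT (fun p => Sx (X1 p.1) p.2 - Y1 p.1) _ open_half_strip openT) => //.
- apply: smoothB => //; last first.
    by apply: (smooth_fst oW _ (@smooth_Y1 R half_strip)) => p [].
  have sX1 : smooth [set p : R4 * R | half_strip p.1 /\ setT p.2] (fun p => X1 p.1).
    by apply: (smooth_fst oW _ (@smooth_X1 R half_strip)) => p [].
  by have [p [[]]|] := smooth_S oW sX1 (@smooth_snd R R4 _).
- by move=> z [x01 _] /=; rewrite qqE// subrr.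
- by move=> z s t [x01 _] _ _ st /=; rewrite ltrD2r; exact: Sx_incr.
- move=> z [x01 _]; rewrite derive_snd/=.
  have H := is_deriveB (is_derive_Sx (fq z) x01) (is_derive_cst (Y1 z) (fq z) 1).
  by rewrite (@derive_val _ _ _ _ _ _ _ H) subr0; exact: Sxq_gt0.
Qed.

Let sbx : smooth half_strip bx.
Proof.
have oI : open [set x : R | 0 < x < 1].
  by have := @interval_open R (BRight 0) (BLeft 1); rewrite set_itvE; apply.
have oW : open [set p : R4 * R | half_strip p.1 /\ [set x : R | 0 < x < 1] p.2].
  exact: openI (open_comp (fun q _ => cvg_fst) open_half_strip) (open_comp (fun q _ => cvg_snd) oI).
apply: (@smooth_implicit R R4 _ _ (fun p => Sq p.2 (bq p.1) - X1 p.1) _ open_half_strip oI) => //.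
- apply: smoothB => //; last first.
    by apply: (smooth_fst oW _ (@smooth_X1 R half_strip)) => p [].
  have sb : smooth half_strip bq by apply: smoothD; [exact: open_half_strip|smo|smo].
  have sb' : smooth [set p : R4 * R | half_strip p.1 /\ [set x : R | 0 < x < 1] p.2] (fun p => bq p.1).
    by apply: (smooth_fst oW _ sb) => p [].
  by have [p []|] := smooth_S oW (@smooth_snd R R4 _) sb'.
- by move=> z [x01 y0]; have [] := xxE x01 y0.
- by move=> z [x01 y0] /=; have [_ ->] := xxE x01 y0; rewrite subrr.
- move=> z s t [x01 _] /andP[s0 s1] /andP[t0 t1] st /=; rewrite ltrD2r; exact: Sq_incr.
- move=> z [x01 y0]; rewrite derive_snd/=; have [b01 _] := xxE x01 y0.
  have H := is_deriveB (is_derive_Sq (bq z) b01) (is_derive_cst (X1 z) (bx z) 1).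
  by rewrite (@derive_val _ _ _ _ _ _ _ H) subr0; exact: Sxq_gt0.
Qed.

Let foldK z : half_strip z -> half_strip (fold z) /\ unfold (fold z) = z.
Proof.
move=> [x01 y0]; have e := qqE (Y1 z) x01.
have [X01 H0] : 0 < fx z < 1 /\ 0 < fy z by apply: forward => //; rewrite /fq e.
split; first by rewrite /half_strip/= /fold !mkE.
have bE : bq (fold z) = fq z by rewrite /bq /fold !mkE /fy addrC subrK.
have xE : bx (fold z) = X1 z by rewrite /bx bE /fold mkE; exact: xx_uniq.
by rewrite /unfold /by_ bE xE; apply: mk_ext; rewrite !mkE//; exact: e.
Qed.

Let unfoldK z : half_strip z -> half_strip (unfold z) /\ fold (unfold z) = z.
Proof.
move=> [X01 H0]; have [x01 e] := xxE X01 H0.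
have y0 : 0 < by_ z by apply: backward => //; rewrite /bx /bq e; case/andP: X01.
split; first by rewrite /half_strip/= /unfold !mkE.
have qE : fq (unfold z) = bq z by rewrite /fq /unfold !mkE; apply: qq_uniq.
have xE : fx (unfold z) = X1 z by rewrite /fx qE /unfold mkE.
by apply: mk_ext; rewrite /fold !mkE ?xE /fy ?qE ?xE ?[bq z]addrC ?addrK// /unfold mkE.
Qed.

Let sfx : smooth half_strip fx.
Proof.
by have [z []|_ _ h] := smooth_S open_half_strip (@smooth_X1 R half_strip) sfq.
Qed.

Let fold_derive z u : half_strip z -> [/\ 'D_u fold z = mk ('D_u fx z) (X2 u) ('D_u fq z - 'D_u fx z) (Y2 u),
  Y1 u = Sxx (X1 z) (fq z) * X1 u + Sxq (X1 z) (fq z) * 'D_u fq z,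
  'D_u fx z = Sxq (X1 z) (fq z) * X1 u + Sqq (X1 z) (fq z) * 'D_u fq z &
  'D_u act z = Y1 z * X1 u - fy z * 'D_u fx z].
Proof.
move=> sz; have [x01 y0] := sz.
have dq : der z u fq ('D_u fq z) by apply: der_smooth sfq sz.
have dx : der z u fx ('D_u fx z) by apply: der_smooth sfx sz.
have dX := derX1 z u.
have e := qqE (Y1 z) x01.
split.
- exact: (derive_mk dx (derX2 z u) (derB dq dx) (derY2 z u)).
- apply: (@der_ext _ _ z u Y1 (fun z => Sx (X1 z) (fq z)) _ _ _ (derY1 z u) (der_Sx x01 dX dq)).
  apply: filterS (open_nbhs_nbhs (conj open_half_strip sz)) => t [t01 _].
  by rewrite /fq qqE.
- exact: der_uniq dx (der_Sq x01 dX dq).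
- have [_ ->] := derD (derB (der_S x01 dX dq) (derM dq dx)) (derM (der_sqr dx) (der_cst z u 2^-1)).
  by rewrite -/(fx z) /fq e -/(fq z) /fy; field.
Qed.

Let fold_pair : sympl_pair half_strip half_strip fold unfold.
Proof.
have oS := open_half_strip; have sb : smooth half_strip bq by smo.
split; [exact: foldK|exact: unfoldK| | |].
- by apply: smooth_mk; rewrite /fy; smo.
- apply: smooth_mk; try smo.
  have [|_ sx _] := smooth_S oS sbx sb; last exact: sx.
  by move=> z [x01 y0]; have [] := xxE x01 y0.
- move=> z sz u v; have [-> yu xu _] := fold_derive u sz; have [-> yv xv _] := fold_derive v sz.
  rewrite !omegaE !mkE yu yv xu xv.
  move: (Sxx _ _) (Sxq _ _) (Sqq _ _) ('D_u fq z) ('D_v fq z) => a b c p q.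
  by move: (X1 u) (X1 v) (X2 u) (X2 v) (Y2 u) (Y2 v) => *; ring.
Qed.

Lemma fold_of_profiles : exists T Ti (G : R4 -> R),
  [/\ sympl_pair half_strip half_strip T Ti, smooth half_strip G,
      forall z u, half_strip z -> 'D_u G z = Y1 z * X1 u - Y1 (T z) * X1 ('D_u T z),
      forall z, [/\ X2 (T z) = X2 z, Y2 (T z) = Y2 z, X2 (Ti z) = X2 z & Y2 (Ti z) = Y2 z] &
      forall z, half_strip z -> [/\ (Y1 z < L) = (Y1 (T z) < L), L <= Y1 z -> T z = z /\ G z = 0 &
        Y1 z < X1 z / 2 ->
          [/\ X1 (T z) = Y1 z, Y1 (T z) = 1 - X1 z & G z = - (Y1 z * (1 - X1 z))]]].
Proof.
exists fold, unfold, act; split.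
- exact: fold_pair.
- have oS := open_half_strip; have [|sS _ _] := smooth_S oS (@smooth_X1 R half_strip) sfq.
    by move=> z [].
  by rewrite /act; smo.
- by move=> z u sz; have [-> _ _ ->] := fold_derive u sz; rewrite /fold !mkE.
- by move=> z; rewrite /fold /unfold !mkE.
- move=> z sz; have [x01 y0] := sz; have e := qqE (Y1 z) x01; split=> [|Ly|yx].
  + have [[/andP[X0 _] _] _] := foldK sz; rewrite /fold mkE in X0.
    by rewrite /fold mkE -[in LHS]e bound.
  + have [e1 e2 e3] := far x01 Ly.
    split; last by rewrite /act /fx /fq e1 e2 e3; field.
    by apply: mk_ext; rewrite /fold !mkE /fy /fx /fq ?e1 ?e2// addrC addKr.
  + have [|e1 e2 e3] := door (y := Y1 z) x01; first by rewrite y0.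
    by rewrite /fold !mkE /act /fy /fx /fq e1 e2 e3; split=> //; [ring|field].
Qed.

End Fold.

Section FoldExists.
Context {R : realType}.
Notation R4 := 'rV[R]_(2 + 2).

Lemma fold_exists : exists T Ti (G : R4 -> R) (L : R), 1 <= L /\
  [/\ sympl_pair half_strip half_strip T Ti, smooth half_strip G,
      forall z u, half_strip z -> 'D_u G z = Y1 z * X1 u - Y1 (T z) * X1 ('D_u T z),
      forall z, [/\ X2 (T z) = X2 z, Y2 (T z) = Y2 z, X2 (Ti z) = X2 z & Y2 (Ti z) = Y2 z] &
      forall z, half_strip z -> [/\ (Y1 z < L) = (Y1 (T z) < L), L <= Y1 z -> T z = z /\ G z = 0 &
        Y1 z < X1 z / 2 ->
          [/\ X1 (T z) = Y1 z, Y1 (T z) = 1 - X1 z & G z = - (Y1 z * (1 - X1 z))]]].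
Proof.
have [lam [L L1 [sl l1 l2 l3 l4]]] := @slow_cutoff R.
have [N [k k01 [sN n1 n2 n3 n4]]] := @fold_profile R.
have [T [Ti [G H]]] := fold_of_profiles L1 k01 sl l1 l2 l3 l4 sN n1 n2 n3 n4.
by exists T, Ti, G, L.
Qed.

End FoldExists.


Section VectorMaps.
Context {R : realType}.
Notation R4 := 'rV[R]_(2 + 2).
Implicit Types (U : set R4) (F : R4 -> R4).

Lemma open_preimage U F (W : set R4) : open U -> open W -> smooth_rV U F ->
  open [set z | U z /\ W (F z)].
Proof.
move=> oU oW sF; rewrite openE => z [Uz Wz].
have cF : {for z, continuous F} by apply: differentiable_continuous; exact: smooth_rV_diff sF Uz.
have n1 : nbhs z U by exact: open_nbhs_nbhs.
have n2 : nbhs z (F @^-1` W) by apply: cF; exact: open_nbhs_nbhs.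
by apply: filterS (filterI n1 n2) => t [].
Qed.

Lemma der_vec U F z u : smooth_rV U F -> U z ->
  [/\ der z u (fun z => X1 (F z)) (X1 ('D_u F z)), der z u (fun z => X2 (F z)) (X2 ('D_u F z)),
      der z u (fun z => Y1 (F z)) (Y1 ('D_u F z)) & der z u (fun z => Y2 (F z)) (Y2 ('D_u F z))].
Proof.
move=> sF Uz; have dF j := smooth_diff (sF j) Uz.
have E j : der z u (fun z => F z 0 j) ('D_u F z 0 j).
  by split; [exact: dF|rewrite derive_rV ?mxE].
by split; [rewrite X1E|rewrite X2E|rewrite Y1E|rewrite Y2E]; exact: E.
Qed.

Lemma derive_comp_scalar U F (W : set R4) (G : R4 -> R) z u : smooth_rV U F -> U z ->
  smooth W G -> W (F z) -> der z u (fun z => G (F z)) ('D_('D_u F z) G (F z)).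
Proof.
move=> sF Uz sG Wz; have dF := smooth_rV_diff sF Uz; have dG := smooth_diff sG Wz.
have dc : differentiable (G \o F) z by exact: differentiable_comp.
split=> //; by rewrite (deriveE u dc) (diff_comp dF dG) [RHS](deriveE _ dG) (deriveE u dF).
Qed.

Lemma smooth_vec U F : smooth_rV U F -> [/\ smooth U (fun z => X1 (F z)), smooth U (fun z => X2 (F z)),
  smooth U (fun z => Y1 (F z)) & smooth U (fun z => Y2 (F z))].
Proof.
by move=> sF; split; [rewrite X1E|rewrite X2E|rewrite Y1E|rewrite Y2E]; exact: sF.
Qed.

End VectorMaps.

(** * Straightening a kinked prism *)

Section Twist.
Context {R : realType}.
Notation R4 := 'rV[R]_(2 + 2).
Variables (be : R -> R) (D P P' : set R4) (T Ti : R4 -> R4) (G : R4 -> R) (ga : R).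
Let s (z : R4) := X2 z ^+ 2 + Y2 z ^+ 2.
Let c z := be (s z).
Hypotheses (sbe : smooth setT be) (oD : open D) (oP : open P) (oP' : open P').
Hypothesis D_rot : forall z w, s z = s w -> D z -> D w.
Hypothesis c_gt0 : forall z, D z -> 0 < c z.
Hypothesis ga0 : ga != 0.
Hypothesis TT : sympl_pair P P' T Ti.
Hypothesis sG : smooth P G.
Hypothesis dG : forall z u, P z -> 'D_u G z = Y1 z * X1 u - Y1 (T z) * X1 ('D_u T z).
Hypothesis T2 : forall z, [/\ X2 (T z) = X2 z, Y2 (T z) = Y2 z, X2 (Ti z) = X2 z & Y2 (Ti z) = Y2 z].

(** [T] and [G] live on the whole space; putting the second plane to 0 restricts them to the first,
    with heights in units of [ga * c]. For [flatten_out] the units are [ga] for the position and [c]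
    for the height. *)
Definition flatten_in z : R4 := mk (X1 z) 0 (Y1 z * (ga * c z)^-1) 0.
Definition flatten_out z : R4 := mk (X1 z * ga^-1) 0 (Y1 z * (c z)^-1) 0.
Let ph z : R := -2 * ga * ('D_1 be (s z) * G (flatten_in z)).
Definition twist z : R4 := let t := T (flatten_in z) in
  mk (ga * X1 t) (X2 z * cos (ph z) - Y2 z * sin (ph z))
     (c z * Y1 t) (X2 z * sin (ph z) + Y2 z * cos (ph z)).
Let phb z : R := -2 * ga * ('D_1 be (s z) * G (Ti (flatten_out z))).
Definition untwist z : R4 := let t := Ti (flatten_out z) in
  mk (X1 t) (X2 z * cos (phb z) + Y2 z * sin (phb z))
     (ga * c z * Y1 t) (- (X2 z * sin (phb z)) + Y2 z * cos (phb z)).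

Definition twist_dom : set R4 := [set z | D z /\ P (flatten_in z)].
Definition twist_cod : set R4 := [set z | D z /\ P' (flatten_out z)].

Let sc : smooth D c. Proof. by rewrite /c /s; apply: (smooth_fun oD sbe); smo. Qed.

Let s_in : smooth_rV D flatten_in.
Proof.
apply: smooth_mk; try smo; apply: smoothM => //; first smo.
by apply: smoothV => [//|z /c_gt0 h|]; [rewrite mulf_neq0// gt_eqF|smo].
Qed.

Let s_out : smooth_rV D flatten_out.
Proof.
apply: smooth_mk; try smo; apply: smoothM => //; first smo.
by apply: smoothV => [//|z /c_gt0 h|//]; rewrite gt_eqF.
Qed.

Lemma open_twist_dom : open twist_dom. Proof. exact: open_preimage. Qed.
Lemma open_twist_cod : open twist_cod. Proof. exact: open_preimage. Qed.

Lemma twist_radius z : s (twist z) = s z.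
Proof. by rewrite /s /twist !mkE; apply: rot_norm; exact: cos2Dsin2. Qed.

Lemma untwist_radius z : s (untwist z) = s z.
Proof.
rewrite /s /untwist !mkE -[RHS](rot_norm (C := cos (phb z)) (S := - sin (phb z))).
  by rewrite !mulrN opprK.
by rewrite sqrrN cos2Dsin2.
Qed.

Let flatT z w : X2 z = 0 -> Y2 z = 0 -> X1 w = X1 (T z) -> Y1 w = Y1 (T z) ->
  X2 w = 0 -> Y2 w = 0 -> w = T z.
Proof. by move=> x2 y2 e1 e3 e2 e4; have [? ? _ _] := T2 z; apply: mk_ext; congruence. Qed.

Let flatTi z w : X2 z = 0 -> Y2 z = 0 -> X1 w = X1 (Ti z) -> Y1 w = Y1 (Ti z) ->
  X2 w = 0 -> Y2 w = 0 -> w = Ti z.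
Proof. by move=> x2 y2 e1 e3 e2 e4; have [_ _ ? ?] := T2 z; apply: mk_ext; congruence. Qed.

Let out_twist z : D z -> flatten_out (twist z) = T (flatten_in z).
Proof.
move=> /c_gt0 c0; have cE : c (twist z) = c z by rewrite /c twist_radius.
rewrite /flatten_out cE; apply: flatT; rewrite !mkE // mulrC.
  by rewrite mulKf.
by rewrite mulKf// gt_eqF.
Qed.

Let in_untwist z : D z -> flatten_in (untwist z) = Ti (flatten_out z).
Proof.
move=> /c_gt0 c0; have cE : c (untwist z) = c z by rewrite /c untwist_radius.
rewrite /flatten_in cE; apply: flatTi; rewrite !mkE // mulrC.
by rewrite mulKf// mulf_neq0// gt_eqF.
Qed.

Let unrot (C S a b : R) : C ^+ 2 + S ^+ 2 = 1 ->
  [/\ (a * C - b * S) * C + (a * S + b * C) * S = a,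
      - ((a * C - b * S) * S) + (a * S + b * C) * C = b,
      (a * C + b * S) * C - (- (a * S) + b * C) * S = a &
      (a * C + b * S) * S + (- (a * S) + b * C) * C = b].
Proof.
move=> CS; split.
- by rewrite -[RHS]mulr1 -[X in _ = _ * X]CS; ring.
- by rewrite -[RHS]mulr1 -[X in _ = _ * X]CS; ring.
- by rewrite -[RHS]mulr1 -[X in _ = _ * X]CS; ring.
- by rewrite -[RHS]mulr1 -[X in _ = _ * X]CS; ring.
Qed.

Let twistK z : twist_dom z -> twist_cod (twist z) /\ untwist (twist z) = z.
Proof.
move=> [Dz Pz]; have [fg _ _ _ _] := TT; have [P'T TiT] := fg _ Pz.
have oE := out_twist Dz.
split; first by split; [apply: D_rot Dz; rewrite twist_radius|rewrite oE].
have cE : c (twist z) = c z by rewrite /c twist_radius.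
have pE : phb (twist z) = ph z by rewrite /phb twist_radius oE TiT.
have [u1 u2 _ _] := unrot (X2 z) (Y2 z) (cos2Dsin2 (ph z)).
rewrite /untwist oE TiT pE cE; apply: mk_ext; rewrite !mkE //.
rewrite mulrC divfK// mulf_neq0// gt_eqF// ?c_gt0//.
Qed.

Let untwistK z : twist_cod z -> twist_dom (untwist z) /\ twist (untwist z) = z.
Proof.
move=> [Dz Pz]; have [_ gf _ _ _] := TT; have [PTi TTi] := gf _ Pz.
have oE := in_untwist Dz.
split; first by split; [apply: D_rot Dz; rewrite untwist_radius|rewrite oE].
have cE : c (untwist z) = c z by rewrite /c untwist_radius.
have pE : ph (untwist z) = phb z by rewrite /ph untwist_radius oE.
have [_ _ u1 u2] := unrot (X2 z) (Y2 z) (cos2Dsin2 (phb z)).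
rewrite /twist oE TTi pE cE; apply: mk_ext; rewrite !mkE //.
  by rewrite mulrC divfK.
by rewrite mulrC divfK// gt_eqF// c_gt0.
Qed.

Let s_twist_smooth : smooth_rV twist_dom twist.
Proof.
have oU := open_twist_dom; have DU : twist_dom `<=` D by move=> z [].
have sF : smooth_rV twist_dom flatten_in by move=> j; exact: smooth_sub (s_in j).
have PU z : twist_dom z -> P (flatten_in z) by case.
have [_ _ sT _ _] := TT.
have [t1 _ t3 _] := smooth_vec (smooth_rV_comp oU PU sF sT).
have sg : smooth twist_dom (fun z => G (flatten_in z)) := smooth_comp_rV oU PU sG sF.
have sc' : smooth twist_dom c by exact: smooth_sub sc.
have sp : smooth twist_dom ph.
  by apply: smoothM => //; [smo|apply: smoothM => //; rewrite /s; smo].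
by apply: smooth_mk; smo.
Qed.

Let s_untwist_smooth : smooth_rV twist_cod untwist.
Proof.
have oU := open_twist_cod; have DU : twist_cod `<=` D by move=> z [].
have sF : smooth_rV twist_cod flatten_out by move=> j; exact: smooth_sub (s_out j).
have PU z : twist_cod z -> P' (flatten_out z) by case.
have [_ gf _ sTi _] := TT.
have sC := smooth_rV_comp oU PU sF sTi.
have [t1 _ t3 _] := smooth_vec sC.
have PU' z : twist_cod z -> P ((Ti \o flatten_out) z) by move=> /PU /gf[].
have sg : smooth twist_cod (fun z => G (Ti (flatten_out z))) := smooth_comp_rV oU PU' sG sC.
have sc' : smooth twist_cod c by exact: smooth_sub sc.
have sp : smooth twist_cod phb.
  by apply: smoothM => //; [smo|apply: smoothM => //; rewrite /s; smo].
by apply: smooth_mk; smo.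
Qed.

(* Up to terms in [d s /\ d s], the rotation by the angle [-2 ga be'(s) G]
   contributes [ga dG /\ dc], which cancels the defect of [(ga X, c H)]. *)
Let twist_form (C S a b g c0 h eta b1 b2 g0 : R) (xu xv hu hv Au Av Bu Bv au av bu bv : R) :
  C ^+ 2 + S ^+ 2 = 1 -> Au * Bv - Bu * Av = xu * hv - hu * xv ->
  let e p q := 2 * a * p + 2 * b * q in
  let f x A p q := -2 * g * (b1 * (eta * x - h * A) + g0 * (b2 * e p q)) in
  let y k p q := g * (c0 * k + eta * (b1 * e p q)) in
  g * Au * (c0 * Bv + h * (b1 * e av bv)) - (c0 * Bu + h * (b1 * e au bu)) * (g * Av) +
  ((C * au - S * bu - (a * S + b * C) * f xu Au au bu) *
   (S * av + C * bv + (a * C - b * S) * f xv Av av bv) -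
   (S * au + C * bu + (a * C - b * S) * f xu Au au bu) *
   (C * av - S * bv - (a * S + b * C) * f xv Av av bv)) =
  xu * y hv av bv - y hu au bu * xv + (au * bv - bu * av).
Proof.
move=> CS AB e f y; rewrite (rot_form a b au bu av bv _ _ CS).
transitivity (g * c0 * (Au * Bv - Bu * Av) + g * h * (Au * (b1 * e av bv) - b1 * e au bu * Av)
  + (au * bv - bu * av + ((a * au + b * bu) * f xv Av av bv - (a * av + b * bv) * f xu Au au bu))).
  ring.
by rewrite AB /f /y /e; ring.
Qed.

Lemma twist_sympl z u v : twist_dom z -> omega ('D_u twist z) ('D_v twist z) = omega u v.
Proof.
move=> [Dz Pz]; have c0 := c_gt0 Dz; have [_ _ sT _ om] := TT.
have sF : smooth_rV twist_dom flatten_in by move=> j; apply: smooth_sub (s_in j) => t [].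
pose e w := 2 * X2 z * X2 w + 2 * Y2 z * Y2 w.
have ds w : der z w s (e w) := derD (der_sqr (derX2 z w)) (der_sqr (derY2 z w)).
pose b1 := 'D_1 be (s z); pose b2 := 'D_1 ('D_1 be) (s z).
have dsm (h : R -> R) w : smooth setT h -> der z w (fun z => h (s z)) ('D_1 h (s z) * e w).
  by move=> sh; apply: (@der_comp _ _ z w h s _ _ (is_derive_smooth sh I) (ds w)).
have dc w : der z w c (b1 * e w) := dsm be w sbe.
pose p w := 'D_w flatten_in z.
have sTF : smooth_rV twist_dom (T \o flatten_in).
  by apply: (smooth_rV_comp open_twist_dom _ sF sT) => t [].
have DzU : twist_dom z by split.
pose A w := X1 ('D_(p w) T (flatten_in z)); pose B w := Y1 ('D_(p w) T (flatten_in z)).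
have DT w : 'D_w (T \o flatten_in) z = 'D_(p w) T (flatten_in z) by exact: derive_comp_vec sF sT DzU Pz.
have dAB w : [/\ der z w (fun z => X1 (T (flatten_in z))) (A w),
    der z w (fun z => Y1 (T (flatten_in z))) (B w) &
    X2 ('D_(p w) T (flatten_in z)) = 0 /\ Y2 ('D_(p w) T (flatten_in z)) = 0].
  have [a1 a2 a3 a4] := der_vec w sTF DzU; rewrite DT in a1 a2 a3 a4; split=> //.
  by split; [apply: (der_eq _ a2 (der_cst z w 0))|apply: (der_eq _ a4 (der_cst z w 0))] => t /=;
    have [q2 q4 _ _] := T2 (flatten_in t); rewrite ?q2 ?q4 /flatten_in mkE.
have dp w : [/\ X1 (p w) = X1 w, X2 (p w) = 0, Y2 (p w) = 0 &
    der z w (fun z => Y1 (flatten_in z)) (Y1 (p w))].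
  have [a1 a2 a3 a4] := der_vec w sF DzU; split=> //.
  - by apply: (der_eq _ a1 (derX1 z w)) => t; rewrite /flatten_in mkE.
  - by apply: (der_eq _ a2 (der_cst z w 0)) => t; rewrite /flatten_in mkE.
  - by apply: (der_eq _ a4 (der_cst z w 0)) => t; rewrite /flatten_in mkE.
pose eta := Y1 (flatten_in z).
have yE w : Y1 w = ga * (c z * Y1 (p w) + eta * (b1 * e w)).
  have [_ _ _ d] := dp w.
  have := derM (der_cst z w ga) (derM (dc w) d); rewrite mulr0 addr0.
  apply: (@der_ext _ _ z w Y1 _ _ _ _ (derY1 z w)).
  apply: filterS (open_nbhs_nbhs (conj oD Dz)) => t Dt.
  have := c_gt0 Dt => ct; rewrite /flatten_in !mkE mulrA mulrC divfK// mulf_neq0// gt_eqF//.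
have dGe w : der z w (fun z => G (flatten_in z))
    (eta * X1 w - Y1 (T (flatten_in z)) * A w).
  have := derive_comp_scalar w sF DzU sG Pz; rewrite dG//.
  by have [-> _ _ _] := dp w.
have dph w : der z w ph (-2 * ga * (b1 * (eta * X1 w - Y1 (T (flatten_in z)) * A w)
    + G (flatten_in z) * (b2 * e w))).
  have := derM (der_cst z w (-2 * ga)) (derM (dsm _ w (smooth_derive1 sbe)) (dGe w)).
  by rewrite mulr0 addr0.
clearbody eta p.
have dcos w := @der_comp _ _ z w _ ph _ _ (is_derive_cos (ph z)) (dph w).
have dsin w := @der_comp _ _ z w _ ph _ _ (is_derive_sin (ph z)) (dph w).
have D1 w : der z w (fun z => ga * X1 (T (flatten_in z))) (ga * A w).
  by have [a _ _] := dAB w; have := derM (der_cst z w ga) a; rewrite mulr0 addr0.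
have D3 w : der z w (fun z => c z * Y1 (T (flatten_in z))) (c z * B w + Y1 (T (flatten_in z)) * (b1 * e w)).
  by have [_ a _] := dAB w; exact: derM (dc w) a.
have D2 w := derB (derM (derX2 z w) (dcos w)) (derM (derY2 z w) (dsin w)).
have D4 w := derD (derM (derX2 z w) (dsin w)) (derM (derY2 z w) (dcos w)).
have form : A u * B v - B u * A v = X1 u * Y1 (p v) - Y1 (p u) * X1 v.
  have O (x y : R4) : X2 x = 0 -> Y2 x = 0 -> omega x y = X1 x * Y1 y - Y1 x * X1 y.
    by move=> e1 e2; rewrite omegaE e1 e2 !mul0r subr0 addr0.
  have [_ _ [x2 y2]] := dAB u; have [p1 p2 p4 _] := dp u; have [q1 _ _ _] := dp v.
  have e2 := O (p u) (p v) p2 p4; rewrite p1 q1 in e2.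
  exact: etrans (esym (O _ ('D_(p v) T (flatten_in z)) x2 y2)) (etrans (om _ Pz (p u) (p v)) e2).
rewrite (derive_mk (D1 u) (D2 u) (D3 u) (D4 u)) (derive_mk (D1 v) (D2 v) (D3 v) (D4 v)).
rewrite !omegaE !mkE (yE u) (yE v).
have := twist_form (X2 z) (Y2 z) ga (c z) (Y1 (T (flatten_in z))) (eta) b1 b2
  (G (flatten_in z)) (X2 u) (X2 v) (Y2 u) (Y2 v) (cos2Dsin2 (ph z)) form.
move=> /= <-; rewrite -/(e u) -/(e v).
move: (A u) (A v) (B u) (B v) (e u) (e v) (cos _) (sin _) (G _) (Y1 (T _)) => *.
move: (X1 u) (X1 v) (X2 u) (X2 v) (Y2 u) (Y2 v) (X2 z) (Y2 z) (c z) => *.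
clearbody b1 b2; ring.
Qed.

Lemma twist_pair : sympl_pair twist_dom twist_cod twist untwist.
Proof.
by split; [exact: twistK|exact: untwistK|exact: s_twist_smooth|exact: s_untwist_smooth|
  move=> z zd u v; exact: twist_sympl].
Qed.

End Twist.


(** * Gluing the two branches of the fold *)

Section Glue.
Context {R : realType}.
Notation R4 := 'rV[R]_(2 + 2).

Lemma sympl_pair_glue (U1 V1 U2 V2 : set R4) f g :
  sympl_pair U1 V1 f g -> sympl_pair U2 V2 f g -> sympl_pair (U1 `|` U2) (V1 `|` V2) f g.
Proof.
move=> [fg1 gf1 sf1 sg1 om1] [fg2 gf2 sf2 sg2 om2]; split.
- by move=> z [/fg1[]|/fg2[]] *; split=> //; [left|right].
- by move=> z [/gf1[]|/gf2[]] *; split=> //; [left|right].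
- by move=> j; apply: smooth_local => z [Uz|Uz]; [exists U1|exists U2].
- by move=> j; apply: smooth_local => z [Uz|Uz]; [exists V1|exists V2].
- by move=> z [/om1|/om2].
Qed.

End Glue.

Section UTurn.
Context {R : realType}.
Notation R4 := 'rV[R]_(2 + 2).
Variables (T Ti : R4 -> R4) (G : R4 -> R) (L : R).
Hypotheses (L1 : 1 <= L) (TT : sympl_pair half_strip half_strip T Ti).
Hypothesis sG : smooth half_strip G.
Hypothesis dG : forall z u, half_strip z -> 'D_u G z = Y1 z * X1 u - Y1 (T z) * X1 ('D_u T z).
Hypothesis T2 : forall z, [/\ X2 (T z) = X2 z, Y2 (T z) = Y2 z, X2 (Ti z) = X2 z & Y2 (Ti z) = Y2 z].
Hypothesis Tends : forall z, half_strip z -> [/\ (Y1 z < L) = (Y1 (T z) < L),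
  L <= Y1 z -> T z = z /\ G z = 0 &
  Y1 z < X1 z / 2 -> [/\ X1 (T z) = Y1 z, Y1 (T z) = 1 - X1 z & G z = - (Y1 z * (1 - X1 z))]].

Variables (be : R -> R) (D : set R4) (gap : R4 -> R) (a : R).
Let s (z : R4) := X2 z ^+ 2 + Y2 z ^+ 2.
Let c z := be (s z).
Hypotheses (sbe : smooth setT be) (oD : open D) (a01 : 0 < a < 1).
Hypothesis D_rot : forall z w, s z = s w -> D z -> D w.
Hypothesis c_gt0 : forall z, D z -> 0 < c z.
Hypothesis c_lt : forall z, D z -> L * c z < gap z.
Hypothesis gap_base : forall z w, X2 z = X2 w -> Y2 z = Y2 w -> gap z = gap w.

Section Branch.
Variable ga : R.
Hypothesis ga0 : ga != 0.
Let dom : set R4 := [set z | [/\ D z, 0 < X1 z < 1 & 0 < Y1 z * ga^-1 < gap z]].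
Let cod : set R4 := [set z | [/\ D z, 0 < X1 z * ga^-1 < 1 & 0 < Y1 z < gap z]].
Let tw := twist be T G ga.
Let utw := untwist be Ti G ga.

Let inE z : D z -> [/\ X1 (flatten_in be ga z) = X1 z,
  Y1 (flatten_in be ga z) * c z = Y1 z * ga^-1 & X2 (flatten_in be ga z) = 0 /\ Y2 (flatten_in be ga z) = 0].
Proof.
move=> /c_gt0 c0; rewrite /flatten_in !mkE -/(s z) -/(c z); split=> //.
by rewrite invfM mulrA divfK// gt_eqF.
Qed.

Let outE z : D z -> [/\ X1 (flatten_out be ga z) = X1 z * ga^-1,
  Y1 (flatten_out be ga z) * c z = Y1 z & X2 (flatten_out be ga z) = 0 /\ Y2 (flatten_out be ga z) = 0].
Proof.
move=> /c_gt0 c0; rewrite /flatten_out !mkE -/(s z) -/(c z); split=> //.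
by rewrite divfK// gt_eqF.
Qed.

Let pair := twist_pair sbe oD open_half_strip open_half_strip D_rot c_gt0 ga0 TT sG dG T2.

Let dom_sub : dom `<=` twist_dom be D half_strip ga.
Proof.
move=> z [Dz x01 /andP[y0 _]]; split=> //; have [e1 e2 _] := inE Dz.
split; first by rewrite e1.
by rewrite -(pmulr_lgt0 _ (c_gt0 Dz)) e2.
Qed.

Let cod_sub : cod `<=` twist_cod be D half_strip ga.
Proof.
move=> z [Dz x01 /andP[y0 _]]; split=> //; have [e1 e2 _] := outE Dz.
split; first by rewrite e1.
by rewrite -(pmulr_lgt0 _ (c_gt0 Dz)) e2.
Qed.

(** From height [L] on, [T] is the identity and [G] is 0, so the base does not rotate and the gap
    keeps its value. Below, heights stay under [L * c]; as [c] is invariant under rotation, this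
    lies under the gap at the rotated base too. *)
Lemma branch_pair : sympl_pair dom cod tw utw.
Proof.
have [fg gf _ _ _] := pair; have [fgT gfT _ _ _] := TT.
apply: (sympl_pair_sub pair) => //.
- move=> z dz; have [Dz x01 /andP[y0 y1]] := dz; have [_ hz] := dom_sub dz.
  have [[Dw _] _] := fg z (dom_sub dz); have c0 := c_gt0 Dz.
  have [[tx ty] _] := fgT _ hz; have [e1 e2 [e3 e4]] := inE Dz.
  have [b1 b2 _] := Tends hz.
  split=> //; rewrite /twist !mkE.
    by rewrite mulrC mulKf.
  rewrite -/(s z) -/(c z) mulr_gt0//=.
  have [Ly|Ly] := leP L (Y1 (flatten_in be ga z)).
    have [t1 t2] := b2 Ly; rewrite t1 mulrC e2.
    by rewrite (gap_base (w := z)) // /twist mkE t2 !mulr0 cos0 sin0 !mulr1 !mulr0 ?subr0 ?add0r.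
  have Lw := c_lt Dw; apply: lt_trans Lw.
  have -> : c (twist be T G ga z) = c z.
    by congr be; exact: twist_radius.
  by rewrite mulrC ltr_pM2r// -b1.
- move=> z dz; have [Dz x01 /andP[y0 y1]] := dz; have [_ hz] := cod_sub dz.
  have [[Dw _] _] := gf z (cod_sub dz); have c0 := c_gt0 Dz.
  have [[tx ty] TTi] := gfT _ hz; have [e1 e2 [e3 e4]] := outE Dz.
  have [b1 b2 _] := Tends (gfT _ hz).1.
  have E : Y1 (utw z) * ga^-1 = Y1 (Ti (flatten_out be ga z)) * c z.
    by rewrite /utw /untwist mkE -/(s z) -/(c z) -(mulrA ga) mulrC mulKf// mulrC.
  split=> //; first by rewrite /utw /untwist mkE.
  rewrite E mulr_gt0//=.
  have [Ly|Ly] := leP L (Y1 (Ti (flatten_out be ga z))).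
    have [t1 t2] := b2 Ly; rewrite -t1 TTi e2.
    by rewrite (gap_base (w := z)) // /utw /untwist mkE t2 !mulr0 cos0 sin0 !mulr1 !mulr0 ?oppr0 ?addr0 ?add0r.
  have Lw := c_lt Dw; apply: lt_trans Lw.
  have -> : c (untwist be Ti G ga z) = c z.
    by congr be; exact: untwist_radius.
  by rewrite ltr_pM2r.
Qed.

End Branch.

(* Near the kink both branches are given by the fold [(x, y) |-> (y, 1 - x)],
   for which the weight [ga] cancels; this makes the glued map smooth. *)
Let T0 (z : R4) := mk (Y1 z) (X2 z) (1 - X1 z) (Y2 z).
Let T0i (z : R4) := mk (1 - Y1 z) (X2 z) (X1 z) (Y2 z).
Let G0 (z : R4) := - (Y1 z * (1 - X1 z)).

Let dT0 z u : 'D_u T0 z = mk (Y1 u) (X2 u) (0 - X1 u) (Y2 u).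
Proof. exact: (derive_mk (derY1 z u) (derX2 z u) (derB (der_cst z u 1) (derX1 z u)) (derY2 z u)). Qed.

Let T0_pair : sympl_pair setT setT T0 T0i.
Proof.
split=> //.
- by move=> z _; split=> //; apply: mk_ext; rewrite /T0i /T0 !mkE// opprB addrC subrK.
- by move=> z _; split=> //; apply: mk_ext; rewrite /T0i /T0 !mkE// opprB addrC subrK.
- by apply: smooth_mk; smo.
- by apply: smooth_mk; smo.
- by move=> z _ u v; rewrite !dT0 !omegaE !mkE; ring.
Qed.

Let dG0 z u : setT z -> 'D_u G0 z = Y1 z * X1 u - Y1 (T0 z) * X1 ('D_u T0 z).
Proof.
move=> _; have [_ ->] := derN (derM (derY1 z u) (derB (der_cst z u 1) (derX1 z u))).
by rewrite dT0 /T0 !mkE; ring.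
Qed.

Let sG0 : smooth setT G0. Proof. by rewrite /G0; smo. Qed.

Let T02 z : [/\ X2 (T0 z) = X2 z, Y2 (T0 z) = Y2 z, X2 (T0i z) = X2 z & Y2 (T0i z) = Y2 z].
Proof. by rewrite /T0 /T0i !mkE. Qed.

Let tw0 := twist be T0 G0 1.
Let utw0 := untwist be T0i G0 1.

Let pair0 : sympl_pair D D tw0 utw0.
Proof.
have := twist_pair sbe oD openT openT D_rot c_gt0 (oner_neq0 R) T0_pair sG0 dG0 T02.
have -> : twist_dom be D setT 1 = D by apply/seteqP; split=> z // [].
by have -> : twist_cod be D setT 1 = D by apply/seteqP; split=> z // [].
Qed.

Let tw0E z : [/\ X1 (tw0 z) = Y1 z * (c z)^-1, Y1 (tw0 z) = c z * (1 - X1 z) & c (tw0 z) = c z].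
Proof.
split; last by congr be; exact: twist_radius.
  by rewrite /tw0 /twist /flatten_in /T0 !mkE !mul1r.
by rewrite /tw0 /twist /flatten_in /T0 !mkE.
Qed.

Let utw0E z : [/\ X1 (utw0 z) = 1 - Y1 z * (c z)^-1, Y1 (utw0 z) = c z * X1 z & c (utw0 z) = c z].
Proof.
split; last by congr be; exact: untwist_radius.
  by rewrite /utw0 /untwist /flatten_out /T0i !mkE.
by rewrite /utw0 /untwist /flatten_out /T0i !mkE mul1r invr1 mulr1.
Qed.

Let tw_door ga z : ga != 0 -> D z -> 0 < X1 z < 1 -> 0 < Y1 z * ga^-1 < c z * X1 z / 2 ->
  twist be T G ga z = tw0 z.
Proof.
move=> ga0 Dz x01 /andP[y0 y1]; have c0 := c_gt0 Dz.
have yE : Y1 (flatten_in be ga z) * c z = Y1 z * ga^-1.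
  by rewrite /flatten_in !mkE -/(s z) -/(c z) invfM mulrA divfK// gt_eqF.
have xE : X1 (flatten_in be ga z) = X1 z by rewrite /flatten_in mkE.
have hz : half_strip (flatten_in be ga z).
  by split; [rewrite xE|rewrite -(pmulr_lgt0 _ c0) yE].
have [_ _ []] := Tends hz.
  by rewrite xE -(ltr_pM2r c0) yE mulrAC [X1 z * _]mulrC.
rewrite xE => t1 t3 t4.
have gy : ga * Y1 (flatten_in be ga z) = Y1 z * (c z)^-1.
  by rewrite /flatten_in mkE -/(s z) -/(c z) invfM mulrCA mulVKf.
have pE : -2 * ga * ('D_1 be (s z) * G (flatten_in be ga z)) =
    -2 * 1 * ('D_1 be (s z) * G0 (flatten_in be 1 z)).
  have f1 : X1 (flatten_in be 1 z) = X1 z by rewrite /flatten_in mkE.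
  have f3 : Y1 (flatten_in be 1 z) = Y1 z * (c z)^-1 by rewrite /flatten_in mkE mul1r.
  rewrite t4 /G0 f1 f3 -gy; move: (Y1 _) ('D_1 be _) (X1 z) => *; ring.
have [e1 e2 _] := tw0E z.
rewrite /twist t1 t3 gy pE; apply: mk_ext; [by rewrite e1 mkE| |by rewrite e2 mkE|].
  by rewrite /tw0 /twist !mkE.
by rewrite /tw0 /twist !mkE.
Qed.

(** With this slope, [|Y1| < de * (c * X1)] yields [|Y1| / |ga| < c * X1 / 2] for both weights, the
    range in which the fold is exact. *)
Let de := Num.min a (1 - a) / 2.

Let de_bounds : [/\ 0 < de, de < a, de < 1 - a, 2 * de <= a & 2 * de <= 1 - a].
Proof.
have m0 : 0 < Num.min a (1 - a) by rewrite lt_min; case/andP: a01 => *; apply/andP; split; lra.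
have [m1 m2] : Num.min a (1 - a) <= a /\ Num.min a (1 - a) <= 1 - a by rewrite !ge_min !lexx orbT.
by rewrite /de; split; lra.
Qed.

Let dom0 : set R4 := [set z | [/\ D z, 0 < X1 z < 1 & `|Y1 z| < de * (c z * X1 z)]].
Let cod0 : set R4 := [set z | [/\ D z, 0 < Y1 z < c z & `|X1 z| * c z < de * (c z - Y1 z)]].

Let branch0 : sympl_pair dom0 cod0 tw0 utw0.
Proof.
have [fg gf _ _ _] := pair0.
apply: (sympl_pair_sub pair0); try by move=> z [].
- move=> z [Dz /andP[x0 x1] y]; have c0 := c_gt0 Dz; have [e1 e2 e3] := tw0E z.
  split; first exact: (fg z Dz).1.
    by rewrite e2 e3; apply/andP; split; nra.
  rewrite e1 e2 e3 normrM normfV (gtr0_norm c0) divfK ?gt_eqF//.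
  by have -> : c z - c z * (1 - X1 z) = c z * X1 z by ring.
- move=> z [Dz /andP[y0 y1] x]; have c0 := c_gt0 Dz; have [e1 e2 e3] := utw0E z.
  split; first exact: (gf z Dz).1.
    rewrite e1; apply/andP; split; first by rewrite subr_gt0 ltr_pdivrMr// mul1r.
    by rewrite ltrBlDr ltrDl divr_gt0.
  have E : c z * (1 - Y1 z * (c z)^-1) = c z - Y1 z by field; rewrite gt_eqF.
  by rewrite e1 e2 e3 normrM (gtr0_norm c0) E mulrC.
Qed.

Let glued z := if 0 < Y1 z then twist be T G (1 - a) z else
  if Y1 z < 0 then twist be T G (- a) z else tw0 z.
Let unglued z := if 0 < X1 z then untwist be Ti G (1 - a) z else
  if X1 z < 0 then untwist be Ti G (- a) z else utw0 z.

Definition kinked : set R4 :=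
  [set z | [/\ D z, 0 < X1 z < 1 & - (a * gap z) < Y1 z < (1 - a) * gap z]].
Definition straight : set R4 := [set z | [/\ D z, - a < X1 z < 1 - a & 0 < Y1 z < gap z]].
Hypotheses (oK : open kinked) (oS : open straight).

Let gap_gt z : D z -> c z < gap z.
Proof. by move=> Dz; apply: le_lt_trans (c_lt Dz); rewrite ler_peMl// ltW// c_gt0. Qed.

Let a0 : 0 < a. Proof. by case/andP: a01. Qed.
Let a1 : 0 < 1 - a. Proof. by case/andP: a01 => *; lra. Qed.

Let sc : smooth setT c. Proof. by rewrite /c /s; apply: (smooth_fun openT sbe); smo. Qed.

Let branch_up : sympl_pair (kinked `&` [set z | 0 < Y1 z]) (straight `&` [set z | 0 < X1 z])
  glued unglued.
Proof.
have := branch_pair (lt0r_neq0 a1).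
have -> : [set z | [/\ D z, 0 < X1 z < 1 & 0 < Y1 z * (1 - a)^-1 < gap z]] =
    kinked `&` [set z | 0 < Y1 z].
  apply/seteqP; split=> z.
    move=> [Dz x]; rewrite pmulr_lgt0 ?invr_gt0// ltr_pdivrMr// => /andP[y0 y1].
    split=> //; split=> //; rewrite [(1 - a) * _]mulrC y1 andbT.
    by have h := mulr_gt0 a0 (lt_trans (c_gt0 Dz) (gap_gt Dz)); lra.
  move=> [[Dz x /andP[_ y1]] y0]; split=> //.
  by rewrite pmulr_lgt0 ?invr_gt0// ltr_pdivrMr// mulrC y1 andbT.
have -> : [set z | [/\ D z, 0 < X1 z * (1 - a)^-1 < 1 & 0 < Y1 z < gap z]] =
    straight `&` [set z | 0 < X1 z].
  apply/seteqP; split=> z.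
    move=> [Dz]; rewrite pmulr_lgt0 ?invr_gt0// ltr_pdivrMr// mul1r => /andP[x0 x1] y.
    by split=> //; split=> //; rewrite x1 andbT; have := a0; lra.
  move=> [[Dz /andP[_ x1] y] x0]; split=> //.
  by rewrite pmulr_lgt0 ?invr_gt0// ltr_pdivrMr// mul1r x1 andbT.
apply: sympl_pair_ext.
- by apply: openI => //; apply: open_smooth_lt; smo.
- by apply: openI => //; apply: open_smooth_lt; smo.
- by move=> z [_ /= y0]; rewrite /glued y0.
- by move=> z [_ /= x0]; rewrite /unglued x0.
Qed.

Let branch_down : sympl_pair (kinked `&` [set z | Y1 z < 0]) (straight `&` [set z | X1 z < 0])
  glued unglued.
Proof.
have na : - a != 0 by rewrite oppr_eq0 lt0r_neq0.
have := branch_pair na; have a0' := a0.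
have dE (x : R) : x * (- a)^-1 = - x * a^-1 by rewrite invrN mulrN mulNr.
have -> : [set z | [/\ D z, 0 < X1 z < 1 & 0 < Y1 z * (- a)^-1 < gap z]] =
    kinked `&` [set z | Y1 z < 0].
  apply/seteqP; split=> z.
    move=> [Dz x]; rewrite dE pmulr_lgt0 ?invr_gt0// ltr_pdivrMr// => /andP[y0 y1].
    split; last by rewrite /= -oppr_gt0.
    split=> //; have h := mulr_gt0 a1 (lt_trans (c_gt0 Dz) (gap_gt Dz)).
    by rewrite mulrC in y1; apply/andP; split; lra.
  move=> [[Dz x /andP[y1 _]] y0]; split=> //.
  rewrite dE pmulr_lgt0 ?invr_gt0// ltr_pdivrMr// mulrC oppr_gt0 y0/=.
  by move: y1; rewrite mulrC; lra.
have -> : [set z | [/\ D z, 0 < X1 z * (- a)^-1 < 1 & 0 < Y1 z < gap z]] =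
    straight `&` [set z | X1 z < 0].
  apply/seteqP; split=> z.
    move=> [Dz]; rewrite dE pmulr_lgt0 ?invr_gt0// ltr_pdivrMr// mul1r => /andP[x0 x1] y.
    split; last by rewrite /= -oppr_gt0.
    by split=> //; have := a1 => *; apply/andP; split; lra.
  move=> [[Dz /andP[x1 _] y] x0]; split=> //.
  rewrite dE pmulr_lgt0 ?invr_gt0// ltr_pdivrMr// mul1r oppr_gt0 x0/=.
  by lra.
apply: sympl_pair_ext.
- by apply: openI => //; apply: open_smooth_lt; smo.
- by apply: openI => //; apply: open_smooth_lt; smo.
- by move=> z [_ /= y0]; rewrite /glued y0 ltNge (ltW y0).
- by move=> z [_ /= x0]; rewrite /unglued x0 ltNge (ltW x0).
Qed.

Let open_dom0 : open dom0.
Proof.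
rewrite (_ : dom0 = (D `&` [set z | 0 < X1 z]) `&` [set z | X1 z < 1] `&`
  [set z | Y1 z < de * (c z * X1 z)] `&` [set z | - Y1 z < de * (c z * X1 z)]); last first.
  apply/seteqP; split=> z.
    move=> [Dz /andP[x0 x1]]; rewrite ltr_norml => /andP[y0 y1].
    by do !split => //=; rewrite ltrNl.
  move=> [[[[Dz x0] x1] y0] y1]; split=> //; first exact/andP.
  by rewrite ltr_norml ltrNl y1.
by repeat apply: openI => //; apply: open_smooth_lt; smo.
Qed.

Let open_cod0 : open cod0.
Proof.
rewrite (_ : cod0 = (D `&` [set z | 0 < Y1 z]) `&` [set z | Y1 z < c z] `&`
  [set z | X1 z * c z < de * (c z - Y1 z)] `&` [set z | - X1 z * c z < de * (c z - Y1 z)]).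
  by repeat apply: openI => //; apply: open_smooth_lt; smo.
have nE z : D z -> `|X1 z| * c z = `|X1 z * c z|.
  by move=> Dz; rewrite normrM (gtr0_norm (c_gt0 Dz)).
apply/seteqP; split=> z.
  move=> [Dz /andP[x0 x1]]; rewrite nE// ltr_norml => /andP[y0 y1].
  by do !split => //=; rewrite mulNr ltrNl.
move=> [[[[Dz x0] x1] y0] y1]; split=> //; first exact/andP.
by rewrite nE// ltr_norml ltrNl -mulNr y1.
Qed.

Let glued0 z : dom0 z -> glued z = tw0 z.
Proof.
move=> [Dz x01 y]; have c0 := c_gt0 Dz; have [d0 _ _ d1 d2] := de_bounds.
have x0 : 0 < X1 z by case/andP: x01.
have cx0 : 0 < c z * X1 z by rewrite mulr_gt0.
rewrite /glued; case: ifPn => [y0|ny0].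
  apply: tw_door => //; first exact: lt0r_neq0.
  rewrite pmulr_lgt0 ?invr_gt0// y0/= ltr_pdivrMr//.
  by move: y; rewrite gtr0_norm// => y; apply: lt_le_trans y _; nra.
case: ifPn => // y0; apply: tw_door => //; first by rewrite oppr_eq0 lt0r_neq0.
rewrite invrN mulrN -mulNr pmulr_lgt0 ?invr_gt0// oppr_gt0 y0/= ltr_pdivrMr//.
by move: y; rewrite ltr0_norm// => y; apply: lt_le_trans y _; nra.
Qed.

Let dom0_sub : dom0 `<=` kinked.
Proof.
move=> z [Dz x01 y]; have c0 := c_gt0 Dz; have [d0 _ _ d1 d2] := de_bounds.
have g0 := gap_gt Dz; case/andP: (x01) => x0 x1; split=> //.
have cx : c z * X1 z < gap z by nra.
have cx0 : 0 < c z * X1 z by rewrite mulr_gt0.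
by move: y; rewrite ltr_norml => /andP[y0 y1]; apply/andP; split; nra.
Qed.

Let cod0_sub z : cod0 z -> straight z.
Proof.
move=> [Dz /andP[y0 y1]]; have c0 := c_gt0 Dz; have [d0 d1 d2 _ _] := de_bounds => x.
have g0 := gap_gt Dz.
have xd : `|X1 z| < de by rewrite -(ltr_pM2r c0); apply: lt_le_trans x _; nra.
move: xd; rewrite ltr_norml => /andP[? ?].
by split=> //; apply/andP; split; lra.
Qed.

Let branch_door : sympl_pair dom0 cod0 glued unglued.
Proof.
apply: (sympl_pair_ext open_dom0 open_cod0 _ _ branch0).
  by move=> z dz; rewrite glued0.
move=> z cz; have [fg gf _ _ _] := branch0; have [dz e] := gf z cz.
have [Dz /andP[y0 y1] x] := cz; have c0 := c_gt0 Dz.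
have [_ yE _] := utw0E z.
(* Off [X1 = 0] the inverse of the matching branch has no choice: [utw0 z] lies in the domain of
   that branch and is sent to [z]. *)
have [fgu _ _ _ _] := branch_up; have [fgd _ _ _ _] := branch_down.
rewrite /unglued; case: ifPn => [x0|nx0].
  have [|_] := fgu (utw0 z).
    by split; [exact: dom0_sub|rewrite /= yE mulr_gt0].
  by rewrite glued0// e /unglued x0.
case: ifPn => // x0; have [|_] := fgd (utw0 z).
  by split; [exact: dom0_sub|rewrite /= yE pmulr_rlt0].
by rewrite glued0// e /unglued x0 ltNge (ltW x0).
Qed.

Let slit : set R4 := [set z | X1 z = 0 /\ be (X2 z ^+ 2 + Y2 z ^+ 2) <= Y1 z].

(** The upper branch fills [X1 > 0], the lower one [X1 < 0], and the wall [X1 = 0] is crossed only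
    through the door, at heights below [c]. *)
Lemma kinked_slit : sympl_pair kinked (straight `&` ~` slit) glued unglued.
Proof.
have := sympl_pair_glue (sympl_pair_glue branch_up branch_down) branch_door.
have -> : kinked `&` [set z | 0 < Y1 z] `|` kinked `&` [set z | Y1 z < 0] `|` dom0 = kinked.
  apply/seteqP; split=> z; first by move=> [[[]|[]]|/dom0_sub].
  move=> kz; have [y0|y0|y0] := ltgtP (Y1 z) 0; [by left; right|by left; left|right].
  have [Dz x01 _] := kz; split=> //; have [d0 _ _ _ _] := de_bounds.
  have x0 : 0 < X1 z by case/andP: x01.
  by rewrite y0 normr0 mulr_gt0// mulr_gt0// c_gt0.
suff -> : straight `&` [set z | 0 < X1 z] `|` straight `&` [set z | X1 z < 0] `|` cod0 =
    straight `&` ~` slit by [].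
apply/seteqP; split=> z.
  move=> [[[sz x0]|[sz x0]]|cz].
  - by split=> // -[xE _]; move: x0; rewrite /= xE ltxx.
  - by split=> // -[xE _]; move: x0; rewrite /= xE ltxx.
  - by split; [exact: cod0_sub|move=> [_]; case: cz => _ /andP[_ y1] _; rewrite leNgt y1].
move=> [sz nz]; have [x0|x0|x0] := ltgtP (X1 z) 0; [by left; right|by left; left|right].
have [Dz _ /andP[y0 _]] := sz; have c0 := c_gt0 Dz; have [d0 _ _ _ _] := de_bounds.
have y1 : Y1 z < c z by rewrite ltNge; apply/negP => h; apply: nz.
by split=> //; [rewrite y0|rewrite x0 normr0 mul0r mulr_gt0// subr_gt0].
Qed.

Lemma uturn_disc : symp kinked straight.
Proof.
have S := @slit_removal R straight (fun u v => be (u ^+ 2 + v ^+ 2)) oS _ _.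
have {S} : symp (straight `&` ~` slit) straight.
  apply: S.
    by apply: smooth_cont; exact: sc.
  move=> z y [Dz x /andP[y0 y1]] xz /andP[cy yy]; split; rewrite ?mkE.
  - by apply: D_rot Dz; rewrite /s !mkE.
  - by rewrite -xz.
  - have -> : gap (mk 0 (X2 z) y (Y2 z)) = gap z by apply: gap_base; rewrite mkE.
    by apply/andP; split; [exact: lt_le_trans (c_gt0 Dz) cy|exact: le_lt_trans yy y1].
move=> [oU _ S]; apply: symp_trans (And3 oU oS S).
by split=> //; exists glued, unglued; exact: kinked_slit.
Qed.

End UTurn.


(** * From kinked prisms to the ball *)

Section Straightening.
Context {R : realType}.
Notation R4 := 'rV[R]_(2 + 2).
Local Notation pi := (@pi R).

Lemma symp_global (f g : R4 -> R4) (U V : set R4) : sympl_pair setT setT f g -> open U ->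
  (forall z, U z <-> V (f z)) -> symp U V.
Proof.
move=> fg oU UV; have [Kfg Kgf sf sg _] := fg.
have VU z : V z <-> U (g z) by rewrite UV (Kgf z I).2.
split=> //.
  rewrite (_ : V = [set z | setT z /\ U (g z)]); first exact: open_preimage openT oU sg.
  by apply/seteqP; split=> z; [move=> /VU|move=> [_ /VU]].
by exists f, g; apply: (sympl_pair_sub fg) => // z; [move=> /UV|move=> /VU].
Qed.

Lemma addE (z w : R4) : z + w = mk (X1 z + X1 w) (X2 z + X2 w) (Y1 z + Y1 w) (Y2 z + Y2 w).
Proof. by apply: mk_ext; rewrite mkE /X1 /X2 /Y1 /Y2 !mxE. Qed.

Lemma shift_pair (v : R4) : sympl_pair setT setT (fun z => z + v) (fun z => z - v).
Proof.
have sh (w : R4) : smooth_rV setT (fun z : R4 => z + w).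
  move=> j; apply: (smooth_ext openT (f := fun z : R4 => z 0 j + w 0 j)).
    by move=> z _; rewrite mxE.
  by apply: smoothD; [exact: openT|exact: smooth_coord|smo].
split=> //.
- by move=> z _; rewrite addrK.
- by move=> z _; rewrite subrK.
- move=> z _ u w; have D (x : R4) : 'D_x (fun z => z + v) z = x.
    rewrite deriveD ?derive_id ?derive_cst ?addr0//.
  by rewrite !D.
Qed.

Lemma reflect_pair : sympl_pair setT setT (fun z : R4 => mk (1 - X1 z) (X2 z) (1 - Y1 z) (Y2 z))
  (fun z : R4 => mk (1 - X1 z) (X2 z) (1 - Y1 z) (Y2 z)).
Proof.
have sm : smooth_rV setT (fun z : R4 => mk (1 - X1 z) (X2 z) (1 - Y1 z) (Y2 z)).
  by apply: smooth_mk; smo.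
have K (z : R4) : mk (1 - (1 - X1 z)) (X2 z) (1 - (1 - Y1 z)) (Y2 z) = z.
  by apply: mk_ext; rewrite !mkE// opprB addrC subrK.
split=> //; try by move=> z _; rewrite !mkE K.
move=> z _ u v; have D w := derive_mk (derB (der_cst z w 1) (derX1 z w)) (derX2 z w)
  (derB (der_cst z w 1) (derY1 z w)) (derY2 z w).
by rewrite !D !omegaE !mkE; ring.
Qed.

Definition kinked_prism a (g : R -> R) : set R4 := [set z | [/\ 0 < X1 z < 1, square2 z &
  - (a * g (Y2 z)) < Y1 z - a < (1 - a) * g (Y2 z)]].
Definition corner_prism (g : R -> R) : set R4 :=
  [set z | [/\ 0 < X1 z < 1, square2 z & 0 < Y1 z < g (Y2 z)]].

Section Prism.
Variable g : R -> R.
Hypotheses (cg : continuous g) (g_ge : forall y, 0 < y < 1 -> y * (1 - y) <= g y).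

Let cgY : continuous (fun z : R4 => g (Y2 z)).
Proof. by move=> z; apply: (@continuous_comp _ _ _ (@Y2 R) g z); [exact: continuous_Y2|exact: cg]. Qed.

Let cgM (k : R) : continuous (fun z : R4 => k * g (Y2 z)).
Proof.
by move=> z; apply: (@cvgM _ _ (nbhs z) _ (fun=> k) (fun z : R4 => g (Y2 z)));
  [exact: cst_continuous|exact: cgY].
Qed.

Let box (x0 x1 b0 b1 : R) : set R4 :=
  [set z | [/\ x0 < X1 z < x1, b0 * g (Y2 z) < Y1 z & Y1 z < b1 * g (Y2 z)]].

Let open_box (x0 x1 b0 b1 : R) : open (box x0 x1 b0 b1).
Proof.
rewrite (_ : box _ _ _ _ = ([set z : R4 | x0 < X1 z] `&` [set z : R4 | X1 z < x1]) `&`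
  ([set z : R4 | b0 * g (Y2 z) < Y1 z] `&` [set z : R4 | Y1 z < b1 * g (Y2 z)])).
  apply: openI; apply: openI.
  - by apply: open_smooth_lt; smo.
  - by apply: open_smooth_lt; smo.
  - by apply: continuous_lt; [exact: cgM|exact: continuous_Y1].
  - by apply: continuous_lt; [exact: continuous_Y1|exact: cgM].
apply/seteqP; split=> z; first by move=> [/andP[? ?] ? ?]; do !split.
by move=> [[? ?] [? ?]]; split=> //; apply/andP.
Qed.

Let lambert_box x0 x1 b0 b1 : symp [set z | square2 z /\ box x0 x1 b0 b1 z]
  [set z | disc2 z /\ box x0 x1 b0 b1 (lambert_inv z)].
Proof.
have [fg gf sf sg _] := @lambert_pair R.
split.
- by apply: openI; [exact: open_square2|exact: open_box].
- exact: (open_preimage (@open_disc2 R) (@open_box x0 x1 b0 b1) sg).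
exists lambert, lambert_inv; apply: (sympl_pair_sub (@lambert_pair R)); try by move=> z [].
- by move=> z [/fg[? e] ?]; split=> //; rewrite e.
- by move=> z [/gf[? e] ?].
Qed.

Let uturn_mid (a : R) : 0 < a < 1 -> symp (kinked_prism a g) (corner_prism g).
Proof.
move=> a01.
have [T [Ti [G [L [L1 [TT sG dG T2 Te]]]]]] := @fold_exists R.
have L0 : 0 < L by lra.
(* By [lambert_inv_height], [L * be s = (1 - pi s)^2 / 8] is at most [y * (1 - y) / 2], hence
   strictly below [g]. *)
pose be s := (8 * L)^-1 * (1 - pi * s) ^+ 2.
have sbe : smooth setT be by rewrite /be; smo.
pose s (z : R4) := X2 z ^+ 2 + Y2 z ^+ 2.
have D_rot (z w : R4) : s z = s w -> disc2 z -> disc2 w by rewrite /s /disc2/= => ->.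
have c0 z : disc2 z -> 0 < be (s z).
  rewrite /disc2/= -/(s z) => Dz; apply: mulr_gt0; first by rewrite invr_gt0 mulr_gt0.
  by apply: exprn_gt0; rewrite subr_gt0.
pose gap (z : R4) := g (Y2 (lambert_inv z)).
have gap_gt z : disc2 z -> L * be (s z) < gap z.
  move=> Dz; have := lambert_inv_height Dz; have [_ gf _ _ _] := @lambert_pair R.
  have [[_ y01] _] := gf z Dz; have := g_ge y01; rewrite -/(gap z) -/(s z).
  have -> : L * be (s z) = 1 / 8 * (1 - pi * s z) ^+ 2.
    by rewrite /be; move: (_ ^+ 2) => t; field; rewrite gt_eqF.
  have : 0 < (1 - pi * s z) ^+ 2 by rewrite exprn_gt0// subr_gt0.
  by move: (Y2 _) (_ ^+ 2) => y t; lra.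
have gap_base (z w : R4) : X2 z = X2 w -> Y2 z = Y2 w -> gap z = gap w.
  by move=> x y; rewrite /gap (lambert_inv_base x y).
have kE : kinked disc2 gap a = [set z | disc2 z /\ box 0 1 (- a) (1 - a) (lambert_inv z)].
  apply/seteqP; split=> z; have [_ _ e1 e2] := lambert_passive z; rewrite /kinked/= /box/= e1 e2 mulNr.
    by move=> [? ? /andP[? ?]].
  by move=> [? [? ? ?]]; split=> //; apply/andP.
have sE : straight disc2 gap a = [set z | disc2 z /\ box (- a) (1 - a) 0 1 (lambert_inv z)].
  apply/seteqP; split=> z; have [_ _ e1 e2] := lambert_passive z;
    rewrite /straight/= /box/= e1 e2 mul0r mul1r.
    by move=> [? ? /andP[? ?]].
  by move=> [? [? ? ?]]; split=> //; apply/andP.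
have [oK oKd LK] := lambert_box 0 1 (- a) (1 - a).
have [oS oSd LS] := lambert_box (- a) (1 - a) 0 1.
have U : symp (kinked disc2 gap a) (straight disc2 gap a).
  apply: (uturn_disc L1 TT sG dG T2 Te sbe open_disc2 a01 D_rot c0 gap_gt gap_base).
    by rewrite kE.
  by rewrite sE.
rewrite kE sE in U.
have S1 : symp [set z | square2 z /\ box 0 1 (- a) (1 - a) z] (kinked_prism a g).
  apply: (symp_global (shift_pair (mk 0 0 a 0)) oK) => z.
  have -> : z + mk 0 0 a 0 = mk (X1 z) (X2 z) (Y1 z + a) (Y2 z).
    by apply: mk_ext; rewrite addE !mkE ?addr0.
  rewrite /kinked_prism /box /square2/= !mkE addrK mulNr.
  by split=> [[? [? ? ?]]|[? ? /andP[? ?]]]; split=> //; apply/andP.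
have S2 : symp [set z | square2 z /\ box (- a) (1 - a) 0 1 z] (corner_prism g).
  apply: (symp_global (shift_pair (mk a 0 0 0)) oS) => z.
  have -> : z + mk a 0 0 0 = mk (X1 z + a) (X2 z) (Y1 z) (Y2 z).
    by apply: mk_ext; rewrite addE !mkE ?addr0.
  rewrite /corner_prism /box /square2/= !mkE mul0r mul1r.
  split=> [[? [/andP[? ?] ? ?]]|[/andP[? ?] ? /andP[? ?]]]; split=> //; try (split => //); apply/andP; split=> //; lra.
have SK := And3 oK oKd LK; have SS := And3 oS oSd LS.
exact: symp_trans (symp_sym S1) (symp_trans SK (symp_trans U (symp_trans (symp_sym SS) S2))).
Qed.

Let open_corner : open (corner_prism g).
Proof.
rewrite (_ : corner_prism g = square2 `&` box 0 1 0 1); first by apply: openI; [exact: open_square2|exact: open_box].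
apply/seteqP; split=> z; rewrite /corner_prism/box/= mul0r mul1r.
  by move=> [? ? /andP[? ?]].
by move=> [? [? ? ?]]; split=> //; apply/andP.
Qed.

(** At the ends the kink lies on the boundary: for [a = 0] the two prisms coincide, for [a = 1] a
    half turn of the first plane carries one to the other. *)
Lemma uturn (a : R) : 0 <= a <= 1 -> symp (kinked_prism a g) (corner_prism g).
Proof.
move=> /andP[a0 a1]; have [a0'|a0'] := eqVneq a 0.
  suff -> : kinked_prism a g = corner_prism g by apply: symp_refl; exact: open_corner.
  by apply/seteqP; split=> z; rewrite /kinked_prism /corner_prism/= a0' !subr0 mul0r oppr0 mul1r.
have [a1'|a1'] := eqVneq a 1.
  apply: symp_sym; apply: (symp_global reflect_pair open_corner) => z.
  rewrite /kinked_prism /corner_prism /square2/= !mkE a1' mul1r subrr mul0r.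
  by split=> -[/andP[? ?] ? /andP[? ?]]; split=> //; apply/andP; split; lra.
by apply: uturn_mid; rewrite !lt_neqAle eq_sym a0' a0 a1' a1.
Qed.

End Prism.

(* [hat b] has the value 1 at [b] and is affine on [[0, b]] and [[b, 1]]; the cases
   [b = 0] and [b = 1] are separated because of division by zero. *)
Definition hat (b y : R) : R := if b == 0 then 1 - y else if b == 1 then y
  else Num.min (y / b) ((1 - y) / (1 - b)).

Lemma continuous_hat b : continuous (hat b).
Proof.
have sc (f : R -> R) : smooth setT f -> continuous f by move=> sf y; exact: (smooth_continuous sf).
have c1 : continuous (fun y : R => 1 - y) by apply: sc; smo.
rewrite /hat; case: eqVneq => [_|b0]; first exact: c1.
case: eqVneq => [_|b1]; first by move=> y; exact: cvg_id.
have c2 : continuous (fun y : R => y / b) by apply: sc; smo.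
have c3 : continuous (fun y : R => (1 - y) / (1 - b)) by apply: sc; smo.
by move=> y; have m := continuous_min (c2 y) (c3 y); exact: m.
Qed.

(** After the first straightening the planes are exchanged. The region under [hat b] is a triangle
    with apex over [b]; its slice at height [y] is the interval from [b - b * (1 - y)] to
    [b + (1 - b) * (1 - y)], so it is again a kinked prism, now with profile [1 - y]. Straightening
    this one leaves the corner simplex. *)
Lemma kinked_prism_ball (a b : R) : 0 <= a <= 1 -> 0 <= b <= 1 -> symp (kinked_prism a (hat b)) pball.
Proof.
move=> a01 b01.
have sc (f : R -> R) : smooth setT f -> continuous f by move=> sf y; exact: (smooth_continuous sf).
have c1 : continuous (fun y : R => 1 - y) by apply: sc; smo.
have g1 (y : R) : 0 < y < 1 -> y * (1 - y) <= 1 - y by move=> /andP[? ?]; nra.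
have ch := @continuous_hat b.
have gh y : 0 < y < 1 -> y * (1 - y) <= hat b y.
  move=> y01; have h1 := g1 y y01; case/andP: y01 b01 => y0 y1 /andP[b0 b1]; rewrite /hat.
  case: eqVneq => [//|nb0]; case: eqVneq => [_|nb1]; first by nra.
  have b0' : 0 < b by rewrite lt_neqAle eq_sym nb0.
  have b1' : 0 < 1 - b by rewrite subr_gt0 lt_neqAle nb1.
  by rewrite le_min !ler_pdivlMr//; apply/andP; split; nra.
have S1 := uturn ch gh a01; have S3 := uturn c1 g1 b01.
have [_ oC _] := S1; have S2 := symp_swap oC.
have E2 : [set z | corner_prism (hat b) (swap z)] = kinked_prism b (fun y => 1 - y).
  apply/seteqP; split=> z; rewrite /corner_prism /kinked_prism /square2/= /swap !mkE /hat.
    move=> [x2 [x1 y1] /andP[y2]]; case: eqVneq => [->|nb0].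
      by move=> h; case/andP: y1 => ? ?; split=> //; [split=> //|]; apply/andP; split; lra.
    case: eqVneq => [->|nb1].
      by move=> h; case/andP: y1 => ? ?; split=> //; [split=> //|]; apply/andP; split; lra.
    case/andP: b01 => b0 b1; have b0' : 0 < b by rewrite lt_neqAle eq_sym nb0.
    have b1' : 0 < 1 - b by rewrite subr_gt0 lt_neqAle nb1.
    rewrite lt_min !ltr_pdivlMr// => /andP[h1 h2].
    by case/andP: y1 => ? ?; split=> //; [split=> //|]; apply/andP; split; lra.
  move=> [x1 [x2 /andP[y20 y21]] /andP[h1 h2]]; case/andP: b01 => b0 b1.
  have y1 : 0 < Y1 z < 1 by apply/andP; split; nra.
  split=> //; rewrite y20/=; case: eqVneq => [b0'|nb0]; first by rewrite b0' in h2; lra.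
  case: eqVneq => [b1'|nb1]; first by rewrite b1' in h1; lra.
  have b0' : 0 < b by rewrite lt_neqAle eq_sym nb0.
  have b1' : 0 < 1 - b by rewrite subr_gt0 lt_neqAle nb1.
  by rewrite lt_min !ltr_pdivlMr//; apply/andP; split; lra.
have E3 : corner_prism (fun y => 1 - y) = corner_simplex.
  apply/seteqP; split=> z; rewrite /corner_prism /corner_simplex /square2/=.
    by move=> [? [? /andP[? ?]] /andP[? ?]]; split=> //; lra.
  by move=> [? ? ? ? ?]; split=> //; [split=> //|]; apply/andP; split; lra.
rewrite E2 in S2; rewrite E3 in S3.
exact: symp_trans S1 (symp_trans S2 (symp_trans S3 (@corner_simplex_ball R))).
Qed.

End Straightening.


(** * Plane geometry *)

Section BallLike.
Context {R : realType}.
Notation R4 := 'rV[R]_(2 + 2).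
Local Notation pi := (@pi R).

Definition cball (r : R) : set R4 :=
  [set z | X1 z ^+ 2 + X2 z ^+ 2 + Y1 z ^+ 2 + Y2 z ^+ 2 < r ^+ 2].

Definition ball_like (U : set R4) := exists2 r : R, 0 < r & symp U (cball r).

Lemma open_cball r : open (cball r).
Proof. by apply: open_smooth_lt; smo. Qed.

Lemma ball_like_sympl_to_ball U : ball_like U -> sympl_to_ball U.
Proof.
move=> [r r0 /symp_symplectomorphic S]; exists 0, r; split=> //.
suff -> : eball4 0 r = cball r by [].
rewrite /eball4 /cball funeqE => z /=; congr (is_true (_ < _)).
have l1 : lift ord0 ord0 = 1 :> 'I_2 by apply: val_inj.
rewrite big_split_ord/= !big_ord_recl !big_ord0 l1 !mxE !subr0 !addr0 /X1 /X2 /Y1 /Y2 !mxE.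
by rewrite !addrA.
Qed.

Lemma pball_ball_like U : symp U pball -> ball_like U.
Proof.
move=> S; have p0 : 0 < pi :> R by exact: pi_gt0.
exists (Num.sqrt pi^-1); first by rewrite sqrtr_gt0 invr_gt0.
suff <- : pball = cball (Num.sqrt pi^-1) by [].
rewrite /pball /cball funeqE => z /=; rewrite sqr_sqrtr ?invr_ge0 ?ltW// -mulrDr addrACA !addrA.
by rewrite -[pi^-1]mulr1 ltr_pdivlMl.
Qed.

(** The factor [k] is absorbed by scaling positions by [m] and momenta by [n] with [m * n = k] and
    [n ^+ 2 = m ^+ 2], which maps round balls to round balls. A negative [k] is put into the sign of
    [n], so orientation-reversing frames are covered. *)
Lemma ball_like_conformal U (A Ai : R4 -> R4) (k : R) : k != 0 -> ball_like U ->
  smooth_rV setT A -> smooth_rV setT Ai -> cancel Ai A -> cancel A Ai ->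
  (forall z u v, k * omega ('D_u Ai z) ('D_v Ai z) = omega u v) ->
  ball_like [set z | U (Ai z)].
Proof.
move=> k0 [r r0 [oU oB [f [g [fg gf sf sg om]]]]] sA sAi AAi AiA kom.
pose m := Num.sqrt `|k|; pose n := Num.sg k * m.
have m0 : 0 < m by rewrite sqrtr_gt0 normr_gt0.
have mn : m * n = k by rewrite /n mulrCA -expr2 sqr_sqrtr// -numEsg.
have n0 : n != 0 by rewrite /n mulf_neq0 ?sgr_eq0// gt_eqF.
have n2 : n ^+ 2 = m ^+ 2.
  by rewrite /n exprMn sqr_sg k0 mul1r.
clearbody n; clearbody m.
pose S (z : R4) := mk (m * X1 z) (m * X2 z) (n * Y1 z) (n * Y2 z).
pose Si (z : R4) := mk (m^-1 * X1 z) (m^-1 * X2 z) (n^-1 * Y1 z) (n^-1 * Y2 z).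
have sS : smooth_rV setT S by apply: smooth_mk; smo.
have sSi : smooth_rV setT Si by apply: smooth_mk; smo.
have SSi z : S (Si z) = z by apply: mk_ext; rewrite !mkE mulVKf// gt_eqF.
have SiS z : Si (S z) = z by apply: mk_ext; rewrite !mkE mulKf// gt_eqF.
have SB z : cball (m * r) (S z) = cball r z.
  rewrite /cball/= !mkE !exprMn n2 -!mulrDr ltr_pM2l// exprn_gt0//.
have dS z w : 'D_w S z = S w.
  have dm (c : R) h a : der z w h a -> der z w (fun z => c * h z) (c * a).
    by move=> dh; have := derM (der_cst z w c) dh; rewrite mulr0 addr0.
  exact: (derive_mk (dm m _ _ (derX1 z w)) (dm m _ _ (derX2 z w))
    (dm n _ _ (derY1 z w)) (dm n _ _ (derY2 z w))).
have omS u v : omega (S u) (S v) = k * omega u v by rewrite !omegaE !mkE -mn; ring.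
have oV : open [set z | U (Ai z)].
  rewrite (_ : [set _ | _] = [set z | setT z /\ U (Ai z)]); first exact: open_preimage openT oU sAi.
  by apply/seteqP; split=> z // [].
have sfA : smooth_rV [set z | U (Ai z)] (f \o Ai).
  by apply: (smooth_rV_comp oV _ _ sf) => // j; exact: smooth_sub (sAi j).
exists (m * r); first exact: mulr_gt0.
split=> //; first exact: open_cball.
exists (S \o (f \o Ai)), ((A \o g) \o Si); split.
- by move=> z Uz; have [Bf gf'] := fg _ Uz; rewrite /= SB SiS gf' AAi.
- move=> z; rewrite -{1}(SSi z) SB => /gf[Ug fg'].
  by rewrite /= AiA fg' SSi.
- exact: (smooth_rV_comp oV (fun _ _ => I) sfA sS).
- apply: (@smooth_rV_comp _ _ (cball r) Si (A \o g) (@open_cball (m * r))).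
  + by move=> z; rewrite -{1}(SSi z) SB.
  + by move=> j; exact: smooth_sub (sSi j).
  + exact: (smooth_rV_comp oB (fun _ _ => I) sg sA).
- move=> z Uz u v; rewrite !(derive_comp_vec _ sfA sS Uz I) !dS omS.
  by rewrite !(derive_comp_vec _ sAi sf I Uz) om// kom.
Qed.

Implicit Types (A B : set 'rV[R]_2) (P N : 'M[R]_2) (c d : 'rV[R]_2).

Definition block_aff P N c d (z : R4) : R4 := row_mx (lsubmx z *m P + c) (rsubmx z *m N + d).

Let block_aff_mk P N c d : block_aff P N c d = fun z =>
  mk (X1 z * P 0 0 + X2 z * P 1 0 + c 0 0) (X1 z * P 0 1 + X2 z * P 1 1 + c 0 1)
     (Y1 z * N 0 0 + Y2 z * N 1 0 + d 0 0) (Y1 z * N 0 1 + Y2 z * N 1 1 + d 0 1).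
Proof.
have l1 : lift ord0 ord0 = 1 :> 'I_2 by apply: val_inj.
by rewrite funeqE => z; apply: mk_ext; rewrite mkE /block_aff /X1 /X2 /Y1 /Y2 ?row_mxKl ?row_mxKr !mxE
  !big_ord_recl big_ord0 addr0 l1 !mxE.
Qed.

Lemma smooth_block_aff P N c d : smooth_rV setT (block_aff P N c d).
Proof.
rewrite block_aff_mk.
by apply: smooth_mk; smo.
Qed.

Lemma derive_block_aff P N c d z w : 'D_w (block_aff P N c d) z = block_aff P N 0 0 w.
Proof.
have dl (f g : R4 -> R) a b p q e : der z w f a -> der z w g b ->
    der z w (fun z => f z * p + g z * q + e) (a * p + b * q + 0).
  move=> df dg; have := derD (derD (derM df (der_cst z w p)) (derM dg (der_cst z w q))) (der_cst z w e).
  by congr der; ring.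
rewrite !block_aff_mk !mxE.
exact: (derive_mk (dl _ _ _ _ _ _ _ (derX1 z w) (derX2 z w)) (dl _ _ _ _ _ _ _ (derX1 z w) (derX2 z w))
  (dl _ _ _ _ _ _ _ (derY1 z w) (derY2 z w)) (dl _ _ _ _ _ _ _ (derY1 z w) (derY2 z w))).
Qed.

Lemma omega_mulmx (u v : R4) :
  omega u v = (lsubmx u *m (rsubmx v)^T - rsubmx u *m (lsubmx v)^T) 0 0.
Proof. by rewrite !mxE /omega sumrB; congr (_ - _); apply: eq_bigr => i _; rewrite !mxE. Qed.

(** On row vectors, [P *m N^T = k%:M] is the condition for the linear map given by [P] on positions
    and [N] on momenta to multiply [omega] by [k]. *)
Lemma ball_like_aff A B P N c d (k : R) : k != 0 -> P *m N^T = k%:M ->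
  ball_like (prod4 A B) ->
  ball_like (prod4 [set x | A (x *m P + c)] [set y | B (y *m N + d)]).
Proof.
move=> k0 PN BL.
have NP : N *m P^T = k%:M by rewrite -[LHS]trmxK trmx_mul trmxK PN tr_scalar_mx.
have kk : (k^-1)%:M *m k%:M = 1%:M :> 'M[R]_2 by rewrite -scalar_mxM mulVf.
pose P' := k^-1 *: N^T; pose N' := k^-1 *: P^T.
have kI : k^-1 *: k%:M = 1%:M :> 'M[R]_2 by rewrite scale_scalar_mx mulVf.
have PP' : P *m P' = 1%:M by rewrite /P' -scalemxAr PN.
have NN' : N *m N' = 1%:M by rewrite /N' -scalemxAr NP.
have P'P := mulmx1C PP'; have N'N := mulmx1C NN'.
rewrite (_ : prod4 _ _ = [set z | prod4 A B (block_aff P N c d z)]); last first.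
  by apply/seteqP; split=> z; rewrite /prod4/= /block_aff row_mxKl row_mxKr.
apply: (@ball_like_conformal _ (block_aff P' N' (- (c *m P')) (- (d *m N'))) (block_aff P N c d) k^-1) => //.
- by rewrite invr_eq0.
- exact: smooth_block_aff.
- exact: smooth_block_aff.
- move=> z; rewrite /block_aff row_mxKl row_mxKr !mulmxDl !addrK -!mulmxA PP' NN' !mulmx1.
  exact: hsubmxK.
- move=> z; rewrite /block_aff row_mxKl row_mxKr !mulmxDl !mulNmx -!mulmxA P'P N'N !mulmx1 !subrK.
  exact: hsubmxK.
- move=> z u v; rewrite !derive_block_aff !omega_mulmx /block_aff !row_mxKl !row_mxKr !addr0 !trmx_mul.
  rewrite -[_ *m P *m _]mulmxA (mulmxA P) PN -[_ *m N *m _]mulmxA (mulmxA N) NP.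
  by rewrite !mul_scalar_mx -!scalemxAr -scalerBr mxE mulrA mulVf// mul1r.
Qed.

(** Exchanging positions and momenta is antisymplectic: the case [k = -1] of the conformal lemma. *)
Lemma ball_like_swap A B : ball_like (prod4 A B) -> ball_like (prod4 B A).
Proof.
move=> BL; rewrite (_ : prod4 B A = [set z | prod4 A B (row_mx (rsubmx z) (lsubmx z))]); last first.
  by apply/seteqP; split=> z; rewrite /prod4/= row_mxKl row_mxKr => -[].
have E : (fun z : R4 => row_mx (rsubmx z) (lsubmx z)) = (fun z => mk (Y1 z) (Y2 z) (X1 z) (X2 z)).
  by rewrite funeqE => z; rewrite /mk /X1 /X2 /Y1 /Y2 -!ptE.
have sm : smooth_rV setT (fun z : R4 => row_mx (rsubmx z) (lsubmx z)).
  by rewrite E; apply: smooth_mk; smo.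
have K : cancel (fun z : R4 => row_mx (rsubmx z) (lsubmx z)) (fun z : R4 => row_mx (rsubmx z) (lsubmx z)).
  by move=> z; rewrite row_mxKl row_mxKr hsubmxK.
apply: (ball_like_conformal (k := -1) _ BL sm sm K K); first by rewrite oppr_eq0 oner_neq0.
move=> z u v; rewrite E.
have D w := derive_mk (derY1 z w) (derY2 z w) (derX1 z w) (derX2 z w).
by rewrite !D !omegaE !mkE; ring.
Qed.

End BallLike.


(** * Interiors of plane figures *)

Section Plane.
Context {R : realType}.
Notation R2 := 'rV[R]_2.
Implicit Types (p q x w : R2) (S A B : set R2).

Lemma vec2P p q : p 0 0 = q 0 0 -> p 0 1 = q 0 1 -> p = q.
Proof. by move=> e0 e1; rewrite (ptE p) (ptE q) e0 e1. Qed.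

Lemma mulmx2E p (P : 'M[R]_2) j : (p *m P) 0 j = p 0 0 * P 0 j + p 0 1 * P 1 j.
Proof.
have l1 : lift ord0 ord0 = 1 :> 'I_2 by apply: val_inj.
by rewrite mxE !big_ord_recl big_ord0 addr0 l1.
Qed.

Lemma chull_halfplane S (al be k : R) : (forall p, S p -> al * p 0 0 + be * p 0 1 <= k) ->
  forall x, chull S x -> al * x 0 0 + be * x 0 1 <= k.
Proof.
move=> Sk x [n [w [p [w0 [w1 [Sp ->]]]]]].
rewrite !summxE !mulr_sumr -big_split/= -[k]mul1r -w1 mulr_suml.
apply: ler_sum => i _; rewrite !mxE.
have -> : al * (w i * p i 0 0) + be * (w i * p i 0 1) = w i * (al * p i 0 0 + be * p i 0 1) by ring.
by rewrite ler_wpM2l// Sk.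
Qed.

Lemma chull4 S p1 p2 p3 p4 (w1 w2 w3 w4 : R) : S p1 -> S p2 -> S p3 -> S p4 ->
  0 <= w1 -> 0 <= w2 -> 0 <= w3 -> 0 <= w4 -> w1 + w2 + w3 + w4 = 1 ->
  chull S (w1 *: p1 + w2 *: p2 + w3 *: p3 + w4 *: p4).
Proof.
move=> S1 S2 S3 S4 h1 h2 h3 h4 E.
exists 4, (fun i : 'I_4 => nth 0 [:: w1; w2; w3; w4] i),
  (fun i : 'I_4 => nth 0 [:: p1; p2; p3; p4] i); split.
  by case=> [[|[|[|[|]]]] H].
split; first by rewrite !big_ord_recl big_ord0/= addr0 !addrA.
split; first by case=> [[|[|[|[|]]]] H].
by rewrite !big_ord_recl big_ord0/= addr0 !addrA.
Qed.

Lemma chull2 S p1 p2 (h : R) : S p1 -> S p2 -> 0 <= h <= 1 -> chull S (h *: p1 + (1 - h) *: p2).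
Proof.
move=> S1 S2 /andP[h0 h1].
have := @chull4 S p1 p2 p1 p1 h (1 - h) 0 0 S1 S2 S1 S1.
by rewrite !scale0r !addr0; apply=> //; lra.
Qed.

Lemma interior_segment A p w : interior A p -> exists2 e : R, 0 < e & A (p + e *: w) /\ A (p - e *: w).
Proof.
move=> Ap; have ct : {for 0, continuous (fun t : R => p + t *: w)}.
  apply: (@cvgD _ _ _ (nbhs (0 : R)) _ (cst p) (fun t => t *: w)); first exact: cst_continuous.
  exact: scalel_continuous.
have : nbhs (0 : R) [set t | A (p + t *: w)].
  by apply: ct; rewrite scale0r addr0.
move=> /nbhs_ballP[e /= e0 eA]; exists (e / 2); first by rewrite divr_gt0.
rewrite -scaleNr; split; apply: eA; rewrite /ball/= sub0r ?opprK ?normrN gtr0_norm ?divr_gt0//.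
  by lra.
by lra.
Qed.

Lemma open_ltr (f g : R2 -> R) : continuous f -> continuous g -> open [set p | f p < g p].
Proof.
move=> cf cg; rewrite (_ : [set p | f p < g p] = (fun p => g p - f p) @^-1` [set t | 0 < t]).
  apply: open_comp; last exact: open_gt.
  by move=> p _; apply: (@cvgB _ R _ (nbhs p) _ g f); [exact: cg|exact: cf].
by apply/seteqP; split=> p /=; rewrite subr_gt0.
Qed.

Definition osquare : set R2 := [set p | 0 < p 0 0 < 1 /\ 0 < p 0 1 < 1].

Lemma interior_unit_square : interior (unit_square (R:=R)) = osquare.
Proof.
apply/seteqP; split=> p.
  move=> ip; have [e e0 []] := interior_segment (pt 1 0) ip.
  have [d d0 []] := interior_segment (pt 0 1) ip.
  rewrite /unit_square/= !mxE/= !mulr1 !mulr0 !oppr0 !addr0 => -[_ b1] [_ b2] [b3 _] [b4 _].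
  by split; lra.
move=> op; rewrite /interior; apply: filterS (_ : osquare `<=` _) _.
  by move=> q [/andP[? ?] /andP[? ?]]; split; apply/andP; split; exact: ltW.
apply: open_nbhs_nbhs; split=> //.
rewrite (_ : osquare = ([set p : R2 | 0 < p 0 0] `&` [set p : R2 | p 0 0 < 1]) `&`
  ([set p : R2 | 0 < p 0 1] `&` [set p : R2 | p 0 1 < 1])); last first.
  apply/seteqP; split=> q; first by move=> [/andP[? ?] /andP[? ?]]; do !split.
  by move=> [[? ?] [? ?]]; split; apply/andP.
by repeat apply: openI; apply: open_ltr; solve [exact: cst_continuous|exact: coord_continuous].
Qed.

Definition kite (a b : R) : set R2 := [set p | 0 < p 0 1 < 1 /\
  - (a * hat b (p 0 1)) < p 0 0 - a < (1 - a) * hat b (p 0 1)].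

(** Linear inequalities with the denominators [b] and [1 - b] cleared, so that one form covers
    [b = 0] and [b = 1] and applies directly to convex hulls. *)
Definition closed_kite (a b : R) : set R2 := [set p | [/\ 0 <= p 0 1 <= 1,
  b * (p 0 0 - a) <= (1 - a) * p 0 1, (1 - b) * (p 0 0 - a) <= (1 - a) * (1 - p 0 1),
  b * (a - p 0 0) <= a * p 0 1 & (1 - b) * (a - p 0 0) <= a * (1 - p 0 1)]].

Lemma open_kite (a b : R) : open (kite a b).
Proof.
have cy : continuous (fun p : R2 => p 0 1) by exact: coord_continuous.
have ch (k : R) : continuous (fun p : R2 => k * hat b (p 0 1)).
  move=> p; apply: (@cvgM _ _ (nbhs p) _ (fun=> k) (fun p : R2 => hat b (p 0 1))).
    exact: cst_continuous.
  by apply: (@continuous_comp _ _ _ (fun p : R2 => p 0 1) (hat b) p); [exact: cy|exact: continuous_hat].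
have cx : continuous (fun p : R2 => p 0 0 - a).
  move=> p; apply: (@cvgB _ R _ (nbhs p) _ (fun p : R2 => p 0 0) (fun=> a)).
    exact: coord_continuous.
  exact: cst_continuous.
rewrite (_ : kite a b = ([set p : R2 | 0 < p 0 1] `&` [set p : R2 | p 0 1 < 1]) `&`
  ([set p : R2 | (- a) * hat b (p 0 1) < p 0 0 - a] `&`
   [set p : R2 | p 0 0 - a < (1 - a) * hat b (p 0 1)])); last first.
  apply/seteqP; split=> q; rewrite /kite/= mulNr.
    by move=> [/andP[? ?] /andP[? ?]]; do !split.
  by move=> [[? ?] [? ?]]; split; apply/andP.
repeat apply: openI; apply: open_ltr; solve [exact: cst_continuous|exact: cy|exact: ch|exact: cx].
Qed.

(** An interior point can be moved both ways along each axis, which turns the weak inequalities into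
    strict ones. The sandwich form serves the diamond as well as the triangle. *)
Lemma interior_kite (a b : R) A : 0 <= b <= 1 ->
  kite a b `<=` A -> A `<=` closed_kite a b -> interior A = kite a b.
Proof.
move=> /andP[b0 b1] KA AK; apply/seteqP; split=> p; last first.
  by move=> kp; apply: filterS KA _; apply: open_nbhs_nbhs; split=> //; exact: open_kite.
move=> ip; have [e e0 [/AK + /AK +]] := interior_segment (pt 1 0) ip.
have [d d0 [/AK + /AK +]] := interior_segment (pt 0 1) ip.
rewrite /closed_kite/= !mxE/= !mulr1 !mulr0 !oppr0 !addr0.
move=> [/andP[_ y1] _ _ _ _] [/andP[y0 _] _ _ _ _] [_ f1 f2 _ _] [_ _ _ f3 f4].
have y01 : 0 < p 0 1 < 1 by apply/andP; split; lra.
split=> //; rewrite /hat; case: eqVneq => [bE|nb0].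
  by rewrite bE in f2 f4; apply/andP; split; lra.
case: eqVneq => [bE|nb1]; first by rewrite bE in f1 f3; apply/andP; split; lra.
have b0' : 0 < b by rewrite lt_neqAle eq_sym nb0.
have b1' : 0 < 1 - b by rewrite subr_gt0 lt_neqAle nb1.
have g1 : p 0 0 - a < (1 - a) * (p 0 1 / b) by rewrite mulrA ltr_pdivlMr//; nra.
have g2 : p 0 0 - a < (1 - a) * ((1 - p 0 1) / (1 - b)) by rewrite mulrA ltr_pdivlMr//; nra.
have g3 : - (a * (p 0 1 / b)) < p 0 0 - a by rewrite ltrNl mulrA ltr_pdivlMr//; nra.
have g4 : - (a * ((1 - p 0 1) / (1 - b))) < p 0 0 - a by rewrite ltrNl mulrA ltr_pdivlMr//; nra.
by rewrite /Num.min; case: ifP => _; apply/andP.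
Qed.

Lemma interior_diamond (a b : R) : 0 <= a <= 1 -> 0 <= b <= 1 ->
  interior (diamond a b) = kite a b.
Proof.
move=> a01 b01; apply: interior_kite => // p; last first.
  have H al be k : (forall s : R, 0 <= s <= 1 -> al * s + be * b <= k /\ al * a + be * s <= k) ->
      diamond a b p -> al * p 0 0 + be * p 0 1 <= k.
    move=> H; apply: chull_halfplane => q [[s s01 <-]|[s s01 <-]]; rewrite !mxE/=.
      by case: (H s s01).
    by case: (H s s01).
  case/andP: a01 b01 => a0 a1 /andP[b0 b1] dp; split.
  - apply/andP; split.
      suff : 0 * p 0 0 + (-1) * p 0 1 <= 0 by lra.
      by apply: H => // s /andP[? ?]; split; nra.
    suff : 0 * p 0 0 + 1 * p 0 1 <= 1 by lra.
    by apply: H => // s /andP[? ?]; split; nra.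
  - suff : b * p 0 0 + (a - 1) * p 0 1 <= b * a by lra.
    by apply: H => // s /andP[? ?]; split; nra.
  - suff : (1 - b) * p 0 0 + (1 - a) * p 0 1 <= (1 - a) + (1 - b) * a by lra.
    by apply: H => // s /andP[? ?]; split; nra.
  - suff : (- b) * p 0 0 + (- a) * p 0 1 <= - (b * a) by lra.
    by apply: H => // s /andP[? ?]; split; nra.
  - suff : (b - 1) * p 0 0 + a * p 0 1 <= a - (1 - b) * a by lra.
    by apply: H => // s /andP[? ?]; split; nra.
move=> [/andP[y0 y1] /andP[x0 x1]].
(* Where [hat] is [1 - h], the point divides a segment from [pt a t] to a point of the crossing
   segment at level [b]; below [b] the end used is [t = 0], above it [t = 1]. *)
have P (h t : R) : 0 <= h < 1 -> 0 <= t <= 1 -> h * t + (1 - h) * b = p 0 1 -> hat b (p 0 1) = 1 - h ->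
    diamond a b p.
  move=> /andP[h0 h1] t01 e2 hE; rewrite hE in x0 x1; pose s := (p 0 0 - h * a) / (1 - h).
  have hn : 0 < 1 - h by lra.
  have sE : s * (1 - h) = p 0 0 - h * a by rewrite /s divfK// gt_eqF.
  have -> : p = h *: pt a t + (1 - h) *: pt s b.
    by apply: vec2P; rewrite !mxE/= ?e2//; lra.
  apply: chull2; last by apply/andP; split; lra.
    by right; exists t.
  left; exists s => //=; apply/andP; split; first by apply: divr_ge0; lra.
  by rewrite ler_pdivrMr//; lra.
case/andP: b01 => b0 b1; have [yb|yb] := ltP (p 0 1) b.
  have b0' : b != 0 by lra.
  apply: (P ((b - p 0 1) / b) 0); rewrite ?lexx ?ler01//.
  - by rewrite ltr_pdivrMr ?divr_ge0//; lra.
  - by field.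
  - rewrite /hat (negbTE b0'); case: eqVneq => [->|nb1]; first by field.
    have b1' : 0 < 1 - b by rewrite subr_gt0 lt_neqAle nb1.
    have b0p : 0 < b by lra.
    have h : p 0 1 / b <= (1 - p 0 1) / (1 - b).
      by rewrite ler_pdivrMr// mulrAC ler_pdivlMr//; lra.
    by rewrite (min_idPl h); field.
have b1' : b != 1 by lra.
apply: (P ((p 0 1 - b) / (1 - b)) 1); rewrite ?lexx ?ler01//.
- by rewrite ltr_pdivrMr ?divr_ge0//; lra.
- by field; lra.
- rewrite /hat (negbTE b1'); case: eqVneq => [->|nb0]; first by field.
  have b1p : 0 < 1 - b by lra.
  have b0p : 0 < b by rewrite lt_neqAle eq_sym nb0.
  have h : (1 - p 0 1) / (1 - b) <= p 0 1 / b.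
    by rewrite ler_pdivrMr// mulrAC ler_pdivlMr//; lra.
  by rewrite (min_idPr h); field; lra.
Qed.

Lemma interior_preim (f g : R2 -> R2) A : continuous f -> continuous g -> cancel f g -> cancel g f ->
  interior [set x | A (f x)] = [set x | interior A (f x)].
Proof.
move=> cf cg fg gf; apply/seteqP; split=> x /= ix; last exact: (cf x _ ix).
have h : nbhs (g (f x)) [set x | A (f x)] by rewrite fg.
rewrite /interior; apply: (@filterS _ (nbhs (f x)) _ (g @^-1` [set x | A (f x)])).
  by move=> y /=; rewrite gf.
exact: cg h.
Qed.

Definition aff (P : 'M[R]_2) (c : R2) x := x *m P + c.

Lemma continuous_aff P c : continuous (aff P c).
Proof.
move=> x; apply: continuous_rV => j.
have -> : (fun z : R2 => aff P c z 0 j) = (fun z => z 0 0 * P 0 j + z 0 1 * P 1 j + c 0 j).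
  by rewrite funeqE => z; rewrite /aff mxE mulmx2E.
have cc (i : 'I_2) (k : R) : {for x, continuous (fun z : R2 => z 0 i * k)}.
  apply: (@cvgM _ _ (nbhs x) _ (fun z : R2 => z 0 i) (fun=> k)); first exact: coord_continuous.
  exact: cst_continuous.
apply: (@cvgD _ _ _ (nbhs x) _ (fun z : R2 => z 0 0 * P 0 j + z 0 1 * P 1 j) (fun=> c 0 j)).
  apply: (@cvgD _ _ _ (nbhs x) _ (fun z : R2 => z 0 0 * P 0 j) (fun z => z 0 1 * P 1 j)).
    exact: cc.
  exact: cc.
exact: cst_continuous.
Qed.

Lemma interior_aff P c A : P \in unitmx ->
  interior [set x | A (x *m P + c)] = [set x | interior A (x *m P + c)].
Proof.
move=> uP; apply: (@interior_preim (aff P c) (aff (invmx P) (- (c *m invmx P)))).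
- exact: continuous_aff.
- exact: continuous_aff.
- by move=> x; rewrite /aff mulmxDl mulmxK// addrK.
- by move=> x; rewrite /aff mulmxDl mulmxKV// mulNmx mulmxKV// subrK.
Qed.

Lemma kite_ball (a b : R) : 0 <= a <= 1 -> 0 <= b <= 1 -> ball_like (prod4 osquare (kite a b)).
Proof.
move=> a01 b01; have := pball_ball_like (kinked_prism_ball a01 b01).
suff -> : prod4 osquare (kite a b) = kinked_prism a (hat b) by [].
by apply/seteqP; split=> z; rewrite /prod4 /osquare /kite /kinked_prism /square2 /X1 /X2 /Y1 /Y2/=;
  [move=> [[? ?] [? ?]]|move=> [? [? ?] ?]].
Qed.

Lemma kite_square_ball (a b k : R) (E : 'M[R]_2) (c d : R2) : 0 <= a <= 1 -> 0 <= b <= 1 ->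
  k != 0 -> E \in unitmx ->
  ball_like (prod4 [set x | kite a b (x *m invmx E + c)] [set y | osquare (y *m (k *: E^T) + d)]).
Proof.
move=> a01 b01 k0 uE; apply: (ball_like_aff _ _ k0); last exact: ball_like_swap (kite_ball a01 b01).
by rewrite linearZ/= trmxK -scalemxAr mulVmx// scalemx1.
Qed.

End Plane.

(** * Squares and trapezoids *)

Section Products.
Context {R : realType}.
Notation R2 := 'rV[R]_2.

Lemma square_diamond_ball (c1 c2 s a1 a2 : R) : 0 < s -> 0 <= a1 <= 1 -> 0 <= a2 <= 1 ->
  ball_like (prod4 (interior [set p : R2 | c1 <= p 0 0 <= c1 + s /\ c2 <= p 0 1 <= c2 + s])
    (interior (diamond a1 a2))).
Proof.
move=> s0 a01 b01; rewrite interior_diamond//.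
have sn : s != 0 by rewrite gt_eqF.
pose P : 'M[R]_2 := (s^-1)%:M; pose c := pt (- (c1 / s)) (- (c2 / s)).
have -> : [set p : R2 | c1 <= p 0 0 <= c1 + s /\ c2 <= p 0 1 <= c2 + s] =
    [set p : R2 | unit_square (p *m P + c)].
  apply/seteqP; split=> p; rewrite /unit_square/= /P /c mul_mx_scalar !mxE/= ![s^-1 * _]mulrC -!mulrBl;
    rewrite !ler_pdivrMr// !ler_pdivlMr// !mul0r !mul1r => -[/andP[? ?] /andP[? ?]];
    split; apply/andP; split; lra.
rewrite interior_aff; last by rewrite /P unitmxE det_scalar unitfE expf_neq0// invr_eq0.
rewrite interior_unit_square.
have -> : kite a1 a2 = [set y | kite a1 a2 (y *m 1%:M + 0)].
  by apply/seteqP; split=> y /=; rewrite mulmx1 addr0.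
apply: (@ball_like_aff _ _ _ P 1%:M c 0 s^-1); first by rewrite invr_eq0.
  by rewrite trmx1 mulmx1.
exact: kite_ball.
Qed.

Lemma linE (M : 'M[R]_2) (p : R2) : lin M p = p *m M^T.
Proof. by rewrite /lin trmx_mul trmxK. Qed.

Lemma trapezoid_ball (M : 'M[R]_2) (c : R2) (a1 a2 : R) : M \in unitmx -> 0 <= a1 <= 1 -> 0 <= a2 <= 1 ->
  ball_like (prod4 (interior [set lin M p + c | p in diamond a1 a2])
    (interior [set lin (invmx M^T) q | q in unit_square (R:=R)])).
Proof.
move=> uM a01 b01; have uT : M^T \in unitmx by rewrite unitmx_tr.
have -> : [set lin M p + c | p in diamond a1 a2] =
    [set x | diamond a1 a2 (x *m invmx M^T - c *m invmx M^T)].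
  apply/seteqP; split=> x /=.
    by move=> [p dp <-]; rewrite linE mulmxDl addrK mulmxK.
  by move=> dx; eexists; first exact: dx; rewrite linE mulmxBl !mulmxKV// subrK.
have -> : [set lin (invmx M^T) q | q in unit_square (R:=R)] =
    [set y | unit_square (y *m (1 *: M^T^T) + 0)].
  rewrite scale1r trmxK; apply/seteqP; split=> y /=.
    by move=> [p dp <-]; rewrite linE trmx_inv trmxK mulmxKV// addr0.
  by rewrite addr0 => dy; eexists; first exact: dy; rewrite linE trmx_inv trmxK mulmxK.
rewrite !interior_aff ?unitmx_inv ?scale1r ?trmxK// interior_unit_square interior_diamond//.
have := @kite_square_ball R a1 a2 1 M^T (- (c *m invmx M^T)) 0 a01 b01 (oner_neq0 _) uT.
by rewrite scale1r trmxK.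
Qed.

End Products.


(** * Triangles and their dual parallelograms *)

Section Triangles.
Context {R : realType}.
Notation R2 := 'rV[R]_2.

Lemma aff2E (x : R2) (P : 'M[R]_2) (c : R2) j :
  (x *m P + c) 0 j = x 0 0 * P 0 j + x 0 1 * P 1 j + c 0 j.
Proof. by rewrite mxE mulmx2E. Qed.

Lemma chull_aff (S : set R2) (P : 'M[R]_2) (c : R2) (al be k : R) :
  (forall p, S p -> al * (p *m P + c) 0 0 + be * (p *m P + c) 0 1 <= k) ->
  forall x, chull S x -> al * (x *m P + c) 0 0 + be * (x *m P + c) 0 1 <= k.
Proof.
have E (x : R2) : al * (x *m P + c) 0 0 + be * (x *m P + c) 0 1 =
    (al * P 0 0 + be * P 0 1) * x 0 0 + (al * P 1 0 + be * P 1 1) * x 0 1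
    + (al * c 0 0 + be * c 0 1).
  by rewrite !aff2E; ring.
move=> H x cx; rewrite E -lerBrDr; apply: chull_halfplane cx => p /H.
by rewrite E lerBrDr.
Qed.

Lemma chull_mem (n : nat) (S : set 'rV[R]_n) p : S p -> chull S p.
Proof.
move=> Sp; exists 1%N, (fun=> 1), (fun=> p); rewrite !big_ord1 scale1r.
by do !split=> //; exact: ler01.
Qed.

Lemma closure_le (A : set R2) (f g : R2 -> R) p : continuous f -> continuous g ->
  (forall x, A x -> f x <= g x) -> closure A p -> f p <= g p.
Proof.
move=> cf cg Afg cA; rewrite leNgt; apply/negP => gf.
have [q [/Afg + gfq]] := cA [set x | g x < f x] (open_nbhs_nbhs (conj (open_ltr cg cf) gf)).
by rewrite leNgt gfq.
Qed.

Section Edge.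
Variables (a b c : R2) (sg : R).
Hypotheses (abc : cross2 (b - a) (c - a) != 0) (sg01 : 0 <= sg <= 1).
(** [b + sg *: e] is the given point of the edge and [f] leads from it to the opposite vertex. In
    the frame [(e, f)] at [b] the triangle has the vertices [(sg, 1)], [(0, 0)] and [(1, 0)]. *)
Let e := c - b.
Let f := a - sg *: e - b.
Let E : 'M[R]_2 := \matrix_(i, j) (if i == 0 then e 0 j else f 0 j).
Let ka := cross2 e f.
Let Delta := chull [set a; b; c].

Let kaE : ka = cross2 (b - a) (c - a).
Proof. by rewrite /ka /f /e /cross2 !mxE; ring. Qed.

Let ka0 : ka != 0. Proof. by rewrite kaE. Qed.

Let uE : E \in unitmx.
Proof.
rewrite unitmxE unitfE; suff -> : \det E = ka by [].
have l1 : lift ord0 ord0 = 1 :> 'I_2 by apply: val_inj.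
have l2 : lift 1 0 = 0 :> 'I_2 by apply: val_inj.
by rewrite (expand_det_row _ 0) !big_ord_recl big_ord0 addr0 /cofactor !det_mx11 !mxE/=
  /ka /cross2 /= ?l1 l2 /f /e !mxE addn0 expr0 /bump /= expr1; ring.
Qed.

Definition tri_coord (x : R2) : R2 := x *m invmx E + - (b *m invmx E).

Lemma tri_coordK d : tri_coord (d *m E + b) = d.
Proof. by rewrite /tri_coord mulmxDl addrK mulmxK. Qed.

Lemma tri_coordE x : x = tri_coord x *m E + b.
Proof. by rewrite /tri_coord mulmxDl mulNmx !mulmxKV// subrK. Qed.

Let dE d j : (d *m E + b) 0 j = d 0 0 * e 0 j + d 0 1 * f 0 j + b 0 j.
Proof. by rewrite mxE mulmx2E !mxE. Qed.

Let coord_a : tri_coord a = pt sg 1.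
Proof.
rewrite -[RHS]tri_coordK; congr tri_coord.
by apply: vec2P; rewrite dE /f /e !mxE/=; ring.
Qed.

Let coord_b : tri_coord b = pt 0 0.
Proof.
rewrite -[RHS]tri_coordK; congr tri_coord.
by apply: vec2P; rewrite dE /f /e !mxE/=; ring.
Qed.

Let coord_c : tri_coord c = pt 1 0.
Proof.
rewrite -[RHS]tri_coordK; congr tri_coord.
by apply: vec2P; rewrite dE /f /e !mxE/=; ring.
Qed.

Lemma triangle_sub x : Delta x -> closed_kite sg 0 (tri_coord x).
Proof.
move=> dx; case/andP: sg01 => s0 s1.
have H al be k : al * sg + be <= k -> 0 <= k -> al <= k ->
    al * tri_coord x 0 0 + be * tri_coord x 0 1 <= k.
  move=> h1 h2 h3; apply: chull_aff dx => p; rewrite -/(tri_coord p).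
  by move=> [[->|->]|->]; rewrite ?coord_a ?coord_b ?coord_c !mxE/=; lra.
split.
- apply/andP; split.
    by suff : 0 * tri_coord x 0 0 + -1 * tri_coord x 0 1 <= 0; [lra|apply: H; lra].
  by suff : 0 * tri_coord x 0 0 + 1 * tri_coord x 0 1 <= 1; [lra|apply: H; lra].
- suff : 0 * tri_coord x 0 0 + (sg - 1) * tri_coord x 0 1 <= 0; [lra|apply: H; lra].
- suff : 1 * tri_coord x 0 0 + (1 - sg) * tri_coord x 0 1 <= 1; [lra|apply: H; lra].
- suff : 0 * tri_coord x 0 0 + (- sg) * tri_coord x 0 1 <= 0; [lra|apply: H; lra].
- suff : -1 * tri_coord x 0 0 + sg * tri_coord x 0 1 <= 0; [lra|apply: H; lra].
Qed.

Lemma interior_triangle : interior Delta = [set x | kite sg 0 (tri_coord x)].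
Proof.
have -> : Delta = [set x | Delta (tri_coord x *m E + b)].
  by apply/seteqP; split=> x /=; rewrite -tri_coordE.
rewrite (@interior_aff R (invmx E) _ [set d | Delta (d *m E + b)]) ?unitmx_inv//.
case/andP: sg01 => s0 s1.
rewrite (@interior_kite R sg 0) ?lexx ?ler01//; last first.
  by move=> d /= /triangle_sub; rewrite tri_coordK.
move=> d [/andP[y0 y1]]; rewrite /hat eqxx => /andP[x0 x1] /=.
have := @chull4 R [set a; b; c] a b c c (d 0 1) (1 - d 0 0 + sg * d 0 1 - d 0 1)
  (d 0 0 - sg * d 0 1) 0.
have -> : d *m E + b = d 0 1 *: a + (1 - d 0 0 + sg * d 0 1 - d 0 1) *: b +
    (d 0 0 - sg * d 0 1) *: c + 0 *: c.
  by apply: vec2P; rewrite dE /f /e !mxE; ring.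
by apply; [left; left|left; right|right|right|lra|lra|lra|lra|lra].
Qed.

Hypothesis centroid : a + b + c = 0.
Let t := - Jmap ((1 - sg) *: b + sg *: c).
Let T := chull ([set Jmap p | p in Delta] `|` [set - Jmap p + t | p in Delta]).
(** Dual to the coordinates given by [invmx E] with conformal factor [ka^-1], whose sign is the
    orientation of the triangle; [w0] places [Jmap b] at the corner [(0, 1)]. *)
Let W : 'M[R]_2 := ka^-1 *: E^T.
Let w0 : R2 := pt 0 1 - Jmap b *m W.

(** The centroid condition solved for [b]. Through it the map from [Jmap p] to [- Jmap p + t]
    becomes the reflection in the centre of the unit square. *)
Let bE j : b 0 j = - (f 0 j + (sg + 1) * e 0 j) / 3.
Proof.
have : (a + b + c) 0 j = 0 by rewrite centroid mxE.
by rewrite /f /e !mxE; lra.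
Qed.

Let w0E j : w0 0 j = pt 0 1 0 j - (Jmap b 0 0 * W 0 j + Jmap b 0 1 * W 1 j).
Proof. by rewrite -mulmx2E /w0 mxE; congr (_ + _); rewrite mxE. Qed.

Let WE (y : R2) : (y *m W + w0) 0 0 = ka^-1 * (y 0 0 * e 0 0 + y 0 1 * e 0 1 - (b 0 1 * e 0 0 - b 0 0 * e 0 1)) /\
  (y *m W + w0) 0 1 = 1 + ka^-1 * (y 0 0 * f 0 0 + y 0 1 * f 0 1 - (b 0 1 * f 0 0 - b 0 0 * f 0 1)).
Proof. by rewrite !aff2E !w0E !mxE/=; split; ring. Qed.

Let kaX : e 0 0 * f 0 1 - e 0 1 * f 0 0 != 0. Proof. exact: ka0. Qed.
Let cE j : c 0 j = b 0 j + e 0 j. Proof. by rewrite /e !mxE; ring. Qed.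

Let JE (p : R2) : Jmap p 0 0 = p 0 1 /\ Jmap p 0 1 = - p 0 0.
Proof. by rewrite !mxE. Qed.

Let JtE (p : R2) : (- Jmap p + t) 0 0 = - p 0 1 - ((1 - sg) * b 0 1 + sg * c 0 1) /\
  (- Jmap p + t) 0 1 = p 0 0 + ((1 - sg) * b 0 0 + sg * c 0 0).
Proof. by rewrite /t !mxE/= !opprK. Qed.

(** If [p] has frame coordinates [(d0, d1)], then [Jmap p] becomes [(d1, 1 - d0)] and [- Jmap p + t]
    becomes [(1 - d1, d0)]. The images of [b] and [c] are two corners of the unit square and their
    reflections the other two, so the hull is the whole square. *)
Lemma parallelogramE : T = [set y | unit_square (y *m W + w0)].
Proof.
apply/seteqP; split=> y.
  have G1 p : Delta p -> unit_square (Jmap p *m W + w0).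
    move=> /triangle_sub; have [e1 e2] := WE (Jmap p); rewrite /unit_square/= e1 e2; have [-> ->] := JE p.
    have := dE (tri_coord p); rewrite -tri_coordE => pE; rewrite !pE.
    set d := tri_coord p => -[y01 _ h1 _ h2].
    set s1 := ka^-1 * _; have -> : s1 = d 0 1 by rewrite /s1 /ka /cross2; field.
    set s2 := ka^-1 * _; have -> : 1 + s2 = 1 - d 0 0 by rewrite /s2 /ka /cross2; field.
    by case/andP: sg01 y01 => ? ? /andP[? ?]; split; apply/andP; split; nra.
  have G2 p : Delta p -> unit_square ((- Jmap p + t) *m W + w0).
    move=> /triangle_sub; have [e1 e2] := WE (- Jmap p + t); rewrite /unit_square/= e1 e2; have [-> ->] := JtE p.
    have := dE (tri_coord p); rewrite -tri_coordE => pE; rewrite !pE !cE !bE.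
    set d := tri_coord p => -[y01 _ h1 _ h2].
    set s1 := ka^-1 * _; have -> : s1 = 1 - d 0 1 by rewrite /s1 /ka /cross2; field.
    set s2 := ka^-1 * _; have -> : 1 + s2 = d 0 0 by rewrite /s2 /ka /cross2; field.
    by case/andP: sg01 y01 => ? ? /andP[? ?]; split; apply/andP; split; nra.
  move=> Ty; have H al be k : (forall p, unit_square p -> al * p 0 0 + be * p 0 1 <= k) ->
      al * (y *m W + w0) 0 0 + be * (y *m W + w0) 0 1 <= k.
    by move=> H; apply: chull_aff Ty => p [[x dx <-]|[x dx <-]]; apply: H; [exact: G1|exact: G2].
  split; apply/andP; split.
  - by suff : -1 * (y *m W + w0) 0 0 + 0 * (y *m W + w0) 0 1 <= 0;
      [lra|apply: H => p [/andP[? ?] /andP[? ?]]; lra].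
  - by suff : 1 * (y *m W + w0) 0 0 + 0 * (y *m W + w0) 0 1 <= 1;
      [lra|apply: H => p [/andP[? ?] /andP[? ?]]; lra].
  - by suff : 0 * (y *m W + w0) 0 0 + -1 * (y *m W + w0) 0 1 <= 0;
      [lra|apply: H => p [/andP[? ?] /andP[? ?]]; lra].
  - by suff : 0 * (y *m W + w0) 0 0 + 1 * (y *m W + w0) 0 1 <= 1;
      [lra|apply: H => p [/andP[? ?] /andP[? ?]]; lra].
rewrite /unit_square/=; have [-> ->] := WE y; set s1 := ka^-1 * _; set s2 := ka^-1 * _.
move=> [/andP[h1 h2] /andP[h3 h4]].
have db : Delta b by apply: chull_mem; left; right.
have dc : Delta c by apply: chull_mem; right.
(* Bilinear weights of the point [(s1, 1 + s2)] with respect to the four corners. *)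
have := @chull4 R _ (Jmap b) (Jmap c) (- Jmap b + t) (- Jmap c + t)
  ((1 + s2) * (1 - s1)) (- s2 * (1 - s1)) (- s2 * s1) ((1 + s2) * s1).
have <- : y = (1 + s2) * (1 - s1) *: Jmap b + - s2 * (1 - s1) *: Jmap c +
    - s2 * s1 *: (- Jmap b + t) + (1 + s2) * s1 *: (- Jmap c + t).
  by apply: vec2P; rewrite !mxE/= /s1 /s2 !cE !bE /ka /cross2; field.
apply.
- by left; exists b.
- by left; exists c.
- by right; exists b.
- by right; exists c.
- by apply: mulr_ge0; lra.
- by apply: mulr_ge0; lra.
- by apply: mulr_ge0; lra.
- by apply: mulr_ge0; lra.
- by ring.
Qed.

Lemma triangle_edge_ball : ball_like (prod4 (interior Delta) (interior T)).
Proof.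
rewrite interior_triangle parallelogramE interior_aff; last first.
  by rewrite /W unitmxE detZ unitfE mulf_neq0// ?expf_neq0 ?invr_eq0// -unitfE det_tr -unitmxE.
rewrite interior_unit_square; apply: kite_square_ball => //.
  by rewrite lexx ler01.
by rewrite invr_eq0.
Qed.

End Edge.

(** For [sg = 0] the frame coordinates are the barycentric weights of [c] and [a]. They satisfy weak
    inequalities on the closure, and a point where all three are strict is interior. *)
Lemma triangle_bdry (a b c p : R2) : cross2 (b - a) (c - a) != 0 ->
  bdry (chull [set a; b; c]) p ->
  exists2 s : R, 0 <= s <= 1 & [\/ p = (1 - s) *: b + s *: c, p = (1 - s) *: b + s *: a |
    p = (1 - s) *: a + s *: c].
Proof.
move=> abc [cl ni]; have s01 : 0 <= (0 : R) <= 1 by apply/andP; split; [exact: lexx|exact: ler01].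
rewrite (interior_triangle abc s01) in ni.
set D := tri_coord a b c 0 in ni.
have ct i : continuous (fun x => D x 0 i).
  move=> x; apply: (@continuous_comp _ _ _ D (fun d : R2 => d 0 i)); last exact: coord_continuous.
  exact: continuous_aff.
have cc k : continuous (fun _ : R2 => k : R) by move=> x; exact: cst_continuous.
have dS x : chull [set a; b; c] x -> [/\ 0 <= D x 0 0, 0 <= D x 0 1 & D x 0 0 <= 1 - D x 0 1].
  by move=> /(triangle_sub abc s01)[/andP[? ?] ? ? ? ?]; split; lra.
have x0 : 0 <= D p 0 0.
  by apply: (closure_le (cc 0) (ct 0) _ cl) => x /dS[].
have y0 : 0 <= D p 0 1.
  by apply: (closure_le (cc 0) (ct 1) _ cl) => x /dS[].
have z0 : D p 0 0 <= 1 - D p 0 1.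
  have c1 : continuous (fun x => 1 - D x 0 1).
    by move=> x; apply: (@cvgB _ R _ (nbhs x) _ (fun=> 1) (fun x => D x 0 1)); [exact: cc|exact: ct].
  by apply: (closure_le (ct 0) c1 _ cl) => x /dS[].
have pE : p = (1 - D p 0 0 - D p 0 1) *: b + D p 0 0 *: c + D p 0 1 *: a.
  have e := tri_coordE 0 abc p; apply: vec2P; rewrite [in LHS]e -/D mxE mulmx2E !mxE/=; ring.
have [xp|xn] := ltP 0 (D p 0 0); last first.
  have xE : D p 0 0 = 0 by lra.
  exists (D p 0 1); first by apply/andP; split; lra.
  by constructor 2; rewrite {1}pE xE; apply: vec2P; rewrite !mxE; ring.
have [yp|yn] := ltP 0 (D p 0 1); last first.
  have yE : D p 0 1 = 0 by lra.
  exists (D p 0 0); first by apply/andP; split; lra.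
  by constructor 1; rewrite {1}pE yE; apply: vec2P; rewrite !mxE; ring.
have [zp|zn] := ltP (D p 0 0) (1 - D p 0 1).
  by exfalso; apply: ni; rewrite /kite/= /hat eqxx; split; apply/andP; split; lra.
have zE : D p 0 1 = 1 - D p 0 0 by lra.
exists (D p 0 0); first by apply/andP; split; lra.
by constructor 3; rewrite {1}pE zE; apply: vec2P; rewrite !mxE; ring.
Qed.

(** The vertices are relabelled so that the edge carrying the boundary point plays the role of the
    edge from [b] to [c]; this may reverse the orientation, which the conformal factor permits. *)
Lemma triangle_ball (a b c t : R2) : cross2 (b - a) (c - a) != 0 -> a + b + c = 0 ->
  [set - Jmap p | p in bdry (chull [set a; b; c])] t ->
  ball_like (prod4 (interior (chull [set a; b; c]))
    (interior (chull ([set Jmap p | p in chull [set a; b; c]] `|`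
                      [set - Jmap p + t | p in chull [set a; b; c]])))).
Proof.
move=> abc cen [p /(triangle_bdry abc)[s s01 pE] <-].
have [->|->|->] := pE.
- exact: triangle_edge_ball.
- have -> : [set a; b; c] = [set c; b; a].
    by apply/seteqP; split=> x [[->|->]|->]; by [right|left; right|left; left].
  apply: triangle_edge_ball => //.
    by move: abc; rewrite -oppr_eq0; congr (_ != 0); rewrite /cross2 !mxE; ring.
  by rewrite -[RHS]cen [c + b]addrC [LHS]addrC addrA.
- have -> : [set a; b; c] = [set b; a; c].
    by apply/seteqP; split=> x [[->|->]|->]; by [right|left; right|left; left].
  apply: triangle_edge_ball => //.
    by move: abc; rewrite -oppr_eq0; congr (_ != 0); rewrite /cross2 !mxE; ring.
  by rewrite -[RHS]cen [b + a]addrC.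
Qed.

End Triangles.

Theorem theorem1p3 (R : realType) :
  (* (i) *)
  (forall (a b c t : 'rV[R]_2),
     cross2 (b - a) (c - a) != 0 ->
     a + b + c = 0 ->
     [set - Jmap p | p in bdry (chull [set a; b; c])] t ->
     sympl_to_ball
       (prod4 (interior (chull [set a; b; c]))
              (interior (chull ([set Jmap p | p in chull [set a; b; c]] `|`
                               [set - Jmap p + t | p in chull [set a; b; c]]))))) /\
  (* (ii) *)
  (forall (c1 c2 s a1 a2 : R), 0 < s ->
     0 <= a1 <= 1 -> 0 <= a2 <= 1 ->
     sympl_to_ball
       (prod4 (interior [set p : 'rV[R]_2 | c1 <= p 0 0 <= c1 + s /\ c2 <= p 0 1 <= c2 + s])
              (interior (diamond a1 a2)))) /\
  (* (iii) *)
  (forall (Q : set 'rV[R]_2) (M : 'M[R]_2) (c : 'rV[R]_2) (a1 a2 : R),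
     is_trapezoid Q -> ~ is_triangle Q -> ~ is_parallelogram Q ->
     M \in unitmx -> 0 <= a1 <= 1 -> 0 <= a2 <= 1 ->
     Q = [set lin M p + c | p in diamond a1 a2] ->
     sympl_to_ball
       (prod4 (interior Q)
              (interior [set lin (invmx M^T) q | q in unit_square (R:=R)]))).
Proof.
split=> [a b c t abc cen tE|]; first exact: ball_like_sympl_to_ball (triangle_ball abc cen tE).
split=> [c1 c2 s a1 a2 s0 a01 b01|Q M c a1 a2 _ _ _ uM a01 b01 ->].
  exact: ball_like_sympl_to_ball (square_diamond_ball c1 c2 s0 a01 b01).
exact: ball_like_sympl_to_ball (trapezoid_ball c uM a01 b01).
Qed.
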